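(* Let $A\colon C([-2,0])\supset D(A)\to C([-2,0])$ be the operator given by $$D(A):=\Bigl\{f\in C^1([-2,0])\colon f'(0)=\int_{-2}^{-1}f(x)\,dx-\int_{-1}^0f(x)\,dx\Bigr\},\qquad Af:=f',$$ which generates a $C_0$-semigroup $(e^{tA})_{t\ge 0}$ on $C([-2,0])$. Then: (i) The spectral bound $s(A)$ equals $0$; moreover, it is a dominant spectral value and a pole of the resolvent. (ii) The spectral projection $P$ associated with $s(A)$ is strongly positive. (iii) The semigroup $(e^{tA})_{t\ge0}$ on $C([-2,0])$ is individually eventually strongly positive. (iv) The semigroup $(e^{tA})_{t\ge0}$ is not positive.
   Context: $C([-2,0])$ is the space of complex-valued continuous functions on $[-2,0]$ with the supremum norm. For $f\in C([-2,0])$: $f\ge0$ means $f(x)\ge0$ for all $x$; $f>0$ means $f\ge0$, $f\ne0$; $f\gg0$ means $f\ge\beta\mathbf{1}$ for some $\beta>0$. A bounded operator $T$ is strongly positive if $Tf\gg0$ for all $f>0$. $s(A)=\sup\{\operatorname{Re}\lambda:\lambda\in\sigma(A)\}$; it is a dominant spectral value if $s(A)\in\sigma(A)$ and $\sigma(A)\cap(s(A)+i\mathbb{R})=\{s(A)\}$. The spectral projection associated with an isolated spectral value is the residue of the resolvent $(\lambda I-A)^{-1}$ there. Individually eventually strongly positive: for every $f>0$ there is $t_0\ge0$ with $e^{tA}f\gg0$ for all $t\ge t_0$. Positive: $e^{tA}f\ge0$ for all $f\ge0$ and all $t\ge0$. *)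

(* Defs.v *)
From Stdlib Require Import Reals Lra ProofIrrelevance FunctionalExtensionality.
From Coquelicot Require Import Coquelicot.
Open Scope R_scope.

Section Operators.

Context {E : NormedModule C_AbsRing}.

(* A (possibly unbounded) operator is given by its graph: [A f g] means that
   f lies in D(A) and A f = g. *)
Implicit Types A : E -> E -> Prop.

(* R = (lambda I - A)^{-1}, a bounded everywhere defined operator;
   [is_linear] is Coquelicot's notion of a bounded linear map. *)
Definition is_resolvent A (lambda : C) (R : E -> E) : Prop :=
  is_linear R /\
  (forall g, exists h, A (R g) h /\ minus (scal lambda (R g)) h = g) /\
  (forall f h, A f h -> R (minus (scal lambda f) h) = f).

Definition resolvent_set A (lambda : C) : Prop :=
  exists R, is_resolvent A lambda R.

Definition spectrum A (lambda : C) : Prop := ~ resolvent_set A lambda.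

Definition spectral_bound A : Rbar :=
  Lub_Rbar (fun r => exists lambda : C, spectrum A lambda /\ r = Re lambda).

Definition dominant_spectral_value A (s : R) : Prop :=
  spectral_bound A = Finite s /\
  spectrum A (RtoC s) /\
  (forall lambda : C, spectrum A lambda -> Re lambda = s -> lambda = RtoC s).

(* Convergence of the series of operators sum_k u_k to S in operator norm. *)
Definition is_op_series (u : nat -> E -> E) (S : E -> E) : Prop :=
  forall eps : posreal,
    eventually (fun n => forall f,
      norm (minus (sum_n (fun k => u k f) n) (S f)) <= eps * norm f).

(* Laurent expansion of the resolvent on the punctured disc
   0 < |lambda - mu| < r, where z = lambda - mu:
     (lambda I - A)^{-1} = sum_{k>=0} z^k a_k + sum_{k>=0} z^{-(k+1)} b_k.
   The residue at mu is therefore b_0. *)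
Definition resolvent_laurent A (mu : C) (r : R) (a b : nat -> E -> E) : Prop :=
  0 < r /\
  (forall k, is_linear (a k)) /\
  (forall k, is_linear (b k)) /\
  forall lambda : C, 0 < Cmod (lambda - mu) < r ->
    exists R Rreg Rsing : E -> E,
      is_resolvent A lambda R /\
      is_op_series
        (fun k f => scal (pow_n (K := C_Ring) (lambda - mu)%C k) (a k f)) Rreg /\
      is_op_series
        (fun k f => scal (pow_n (K := C_Ring) (/ (lambda - mu))%C (S k)) (b k f))
        Rsing /\
      (forall f, R f = plus (Rreg f) (Rsing f)).

Definition pole_of_resolvent A (mu : C) : Prop :=
  exists r a b, resolvent_laurent A mu r a b /\
    exists n : nat,
      (exists f, b n f <> zero) /\
      (forall k f, (n < k)%nat -> b k f = zero).

Definition is_spectral_projection A (mu : C) (P : E -> E) : Prop :=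
  spectrum A mu /\
  exists r a b, resolvent_laurent A mu r a b /\ (forall f, P f = b 0%nat f).

(* Only the values T t with 0 <= t matter. *)
Definition C0_semigroup (T : R -> E -> E) : Prop :=
  (forall t, 0 <= t -> is_linear (T t)) /\
  (forall f, T 0 f = f) /\
  (forall s t f, 0 <= s -> 0 <= t -> T (s + t) f = T s (T t f)) /\
  (forall f, filterlim (fun t => T t f) (at_right 0) (locally f)).

Definition is_generator A (T : R -> E -> E) : Prop :=
  forall f g, A f g <->
    filterlim (fun h : R => scal (RtoC (/ h)) (minus (T h f) f))
      (at_right 0) (locally g).

End Operators.

Definition I20 (x : R) : Prop := -2 <= x <= 0.

Definition clamp (x : R) : R := Rmax (-2) (Rmin x 0).

(* A continuous function on [-2,0] is represented by its unique extension to
   the real line that is constant on each side of [-2,0]; this makes Leibniz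
   equality the equality of functions on [-2,0]. *)
Record C20 : Type := mkC20 {
  c20_fun :> R -> C;
  c20_cont : continuous_on I20 c20_fun;
  c20_ext : forall x, c20_fun x = c20_fun (clamp x)
}.

Lemma clamp_in x : I20 (clamp x).
Proof.
  unfold I20, clamp, Rmax, Rmin.
  destruct (Rle_dec x 0); destruct (Rle_dec _ _); lra.
Qed.

Lemma clamp_id x : I20 x -> clamp x = x.
Proof.
  unfold I20, clamp, Rmax, Rmin; intros H.
  destruct (Rle_dec x 0); destruct (Rle_dec _ _); lra.
Qed.

Lemma C20_eq (f g : C20) : (forall x, I20 x -> f x = g x) -> f = g.
Proof.
  intros H.
  assert (Hfg : c20_fun f = c20_fun g).
  { apply functional_extensionality; intros x.
    rewrite (c20_ext f), (c20_ext g). apply H, clamp_in. }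
  destruct f as [f cf ef], g as [g cg eg]; simpl in *; subst g.
  f_equal; apply proof_irrelevance.
Qed.

Lemma clamp_lip x y : Rabs (clamp y - clamp x) <= Rabs (y - x).
Proof.
  unfold clamp, Rmax, Rmin.
  repeat destruct (Rle_dec _ _); unfold Rabs; repeat destruct (Rcase_abs _); lra.
Qed.

Lemma C20_continuous (f : C20) x : continuous f x.
Proof.
  apply filterlim_ext with (fun y => f (clamp y)).
  { intros y; symmetry; apply c20_ext. }
  rewrite (c20_ext f).
  apply filterlim_comp with (within I20 (locally (clamp x))).
  2: { apply c20_cont, clamp_in. }
  intros Q [d Hd]; exists d; intros y Hy.
  apply Hd; [| apply clamp_in].
  apply Rle_lt_trans with (1 := clamp_lip x y), Hy.
Qed.

Lemma C20_bounded (f : C20) : exists M, forall x, I20 x -> Cmod (f x) <= M.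
Proof.
  destruct (continuity_ab_maj (fun x => Cmod (f x)) (-2) 0) as [m [Hm _]].
  { lra. }
  { intros c _. apply continuity_pt_filterlim.
    apply (continuous_comp (f : R -> C_UniformSpace) Cmod).
    - apply C20_continuous.
    - apply (filterlim_norm (K := C_AbsRing) (V := C_NormedModule)). }
  exists (Cmod (f m)); exact Hm.
Qed.

Definition C20_zero : C20.
Proof.
  refine (mkC20 (fun _ => RtoC 0) _ _).
  - intros x _; apply filterlim_const.
  - reflexivity.
Defined.

Definition C20_plus (f g : C20) : C20.
Proof.
  refine (mkC20 (fun x => Cplus (f x) (g x)) _ _).
  - intros x Hx.
    eapply filterlim_comp_2.
    + exact (c20_cont f x Hx).
    + exact (c20_cont g x Hx).
    + apply (filterlim_plus (K := C_AbsRing) (V := C_NormedModule)).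
  - intros x; rewrite (c20_ext f x), (c20_ext g x); reflexivity.
Defined.

Definition C20_scal (c : C) (f : C20) : C20.
Proof.
  refine (mkC20 (fun x => Cmult c (f x)) _ _).
  - intros x Hx.
    apply filterlim_comp with (locally (f x)).
    + exact (c20_cont f x Hx).
    + apply (filterlim_scal_r (K := C_AbsRing) (V := C_NormedModule)).
  - intros x; rewrite (c20_ext f x); reflexivity.
Defined.

Definition C20_opp (f : C20) : C20 := C20_scal (RtoC (-1)) f.

Definition C20_norm (f : C20) : R :=
  real (Lub_Rbar (fun r => exists x, I20 x /\ r = Cmod (f x))).

Lemma C20_norm_lub (f : C20) :
  is_lub_Rbar (fun r => exists x, I20 x /\ r = Cmod (f x)) (C20_norm f).
Proof.
  unfold C20_norm.
  destruct (C20_bounded f) as [M HM].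
  assert (H := Lub_Rbar_correct (fun r => exists x, I20 x /\ r = Cmod (f x))).
  destruct (Lub_Rbar _) as [r| |]; [exact H| |]; exfalso; destruct H as [H1 H2].
  - apply (H2 M). intros r [x [Hx ->]]. apply HM, Hx.
  - apply (H1 (Cmod (f 0))). exists 0; split; [unfold I20; lra | reflexivity].
Qed.

Lemma C20_norm_ge (f : C20) x : I20 x -> Cmod (f x) <= C20_norm f.
Proof. intros Hx; apply (proj1 (C20_norm_lub f)); exists x; auto. Qed.

Lemma C20_norm_le (f : C20) M :
  (forall x, I20 x -> Cmod (f x) <= M) -> C20_norm f <= M.
Proof.
  intros H; apply (proj2 (C20_norm_lub f) M); intros r [x [Hx ->]]; apply H, Hx.
Qed.

Lemma C20_norm_triangle f g : C20_norm (C20_plus f g) <= C20_norm f + C20_norm g.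
Proof.
  apply C20_norm_le; intros x Hx; simpl.
  eapply Rle_trans; [apply Cmod_triangle |].
  apply Rplus_le_compat; apply C20_norm_ge, Hx.
Qed.

Lemma C20_norm_scal c f : C20_norm (C20_scal c f) <= Cmod c * C20_norm f.
Proof.
  apply C20_norm_le; intros x Hx; simpl.
  rewrite Cmod_mult; apply Rmult_le_compat_l; [apply Cmod_ge_0 |].
  apply C20_norm_ge, Hx.
Qed.

Lemma C20_norm_eq0 f : C20_norm f = 0 -> f = C20_zero.
Proof.
  intros H; apply C20_eq; intros x Hx; simpl.
  apply Cmod_eq_0, Rle_antisym; [rewrite <- H; apply C20_norm_ge, Hx | apply Cmod_ge_0].
Qed.

Definition C20_AbelianMonoid_mixin : AbelianMonoid.mixin_of C20.
Proof.
  apply (AbelianMonoid.Mixin _ C20_plus C20_zero);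
    intros; apply C20_eq; intros; simpl; ring.
Defined.

Canonical C20_AbelianMonoid := AbelianMonoid.Pack C20 C20_AbelianMonoid_mixin C20.

Definition C20_AbelianGroup_mixin : AbelianGroup.mixin_of C20_AbelianMonoid.
Proof.
  apply (AbelianGroup.Mixin _ C20_opp).
  intros; apply C20_eq; intros; simpl; ring.
Defined.

Canonical C20_AbelianGroup :=
  AbelianGroup.Pack C20 (AbelianGroup.Class _ _ C20_AbelianGroup_mixin) C20.

Definition C20_ModuleSpace_mixin : ModuleSpace.mixin_of C_Ring C20_AbelianGroup.
Proof.
  apply (ModuleSpace.Mixin C_Ring _ C20_scal); intros; apply C20_eq; intros;
    unfold plus, mult, one; simpl; ring.
Defined.

Canonical C20_ModuleSpace :=
  ModuleSpace.Pack C_Ring C20 (ModuleSpace.Class _ _ _ C20_ModuleSpace_mixin) C20.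

Definition C20_ball (f : C20) (eps : R) (g : C20) : Prop :=
  C20_norm (minus g f) < eps.

Definition C20_UniformSpace_mixin : UniformSpace.mixin_of C20.
Proof.
  apply (UniformSpace.Mixin _ C20_zero C20_ball); unfold C20_ball.
  - intros f e; apply Rle_lt_trans with 0; [| apply cond_pos].
    apply C20_norm_le; intros x _; simpl.
    replace (f x + RtoC (-1) * f x)%C with (RtoC 0) by ring.
    rewrite Cmod_0; lra.
  - intros f g e H; apply Rle_lt_trans with (2 := H).
    apply C20_norm_le; intros x Hx.
    replace (Cmod (minus f g x)) with (Cmod (minus g f x)); [apply C20_norm_ge, Hx |].
    rewrite <- Cmod_opp; f_equal; simpl; ring.
  - intros f g h e1 e2 H1 H2.
    apply Rle_lt_trans with (C20_norm (minus g f) + C20_norm (minus h g)); [| lra].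
    eapply Rle_trans; [| apply C20_norm_triangle]; right; f_equal.
    apply C20_eq; intros; simpl; ring.
Defined.

Canonical C20_UniformSpace := UniformSpace.Pack C20 C20_UniformSpace_mixin C20.

Canonical C20_NormedModuleAux :=
  NormedModuleAux.Pack C_AbsRing C20
    (NormedModuleAux.Class C_AbsRing _
       (ModuleSpace.class _ C20_ModuleSpace)
       (UniformSpace.class C20_UniformSpace)) C20.

Definition C20_NormedModule_mixin :
  NormedModule.mixin_of C_AbsRing C20_NormedModuleAux.
Proof.
  apply (NormedModule.Mixin C_AbsRing _ C20_norm 1).
  - apply C20_norm_triangle.
  - apply C20_norm_scal.
  - intros f g e H; exact H.
  - intros f g e H; rewrite Rmult_1_l; exact H.
  - apply C20_norm_eq0.
Defined.

Canonical C20_NormedModule :=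
  NormedModule.Pack C_AbsRing C20
    (NormedModule.Class _ _ _ C20_NormedModule_mixin) C20.

Definition Cle (z w : C) : Prop := Im z = Im w /\ Re z <= Re w.

Definition C20_nonneg (f : C20) : Prop := forall x, I20 x -> Cle (RtoC 0) (f x).

Definition C20_pos (f : C20) : Prop := C20_nonneg f /\ f <> zero.

Definition C20_strictly_pos (f : C20) : Prop :=
  exists beta : R, 0 < beta /\ forall x, I20 x -> Cle (RtoC beta) (f x).

Definition strongly_positive (T : C20 -> C20) : Prop :=
  forall f, C20_pos f -> C20_strictly_pos (T f).

Definition positive_semigroup (T : R -> C20 -> C20) : Prop :=
  forall t f, 0 <= t -> C20_nonneg f -> C20_nonneg (T t f).

Definition indiv_eventually_strongly_positive (T : R -> C20 -> C20) : Prop :=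
  forall f, C20_pos f ->
    exists t0, 0 <= t0 /\ forall t, t0 <= t -> C20_strictly_pos (T t f).

(* f is continuously differentiable on [-2,0] with derivative g. This is
   [is_derive] with the neighbourhoods of x taken relative to [-2,0], hence a
   one-sided derivative at the end points. *)
Definition has_derivative (f g : C20) : Prop :=
  forall x, I20 x ->
    filterdiff (K := R_AbsRing) (U := R_NormedModule) (V := C_R_NormedModule)
      f (within I20 (locally x)) (fun h : R => scal h (g x)).

Definition integral (f : C20) (a b : R) : C :=
  RInt (V := C_R_CompleteNormedModule) f a b.

Definition opA (f g : C20) : Prop :=
  has_derivative f g /\
  g 0 = (integral f (-2) (-1) - integral f (-1) 0)%C.

(* Main.v *)
(** The equation u' = A u is the delay equation u'(t) = V(t-1) - V(t) with
    V(t) = \int_{t-1}^t u.  In terms of a primitive U of u it reads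
    U'' + U = 2 U(t-1) - U(t-2), which variation of constants solves one unit of time after
    the other; the segments of the solutions form a C0-semigroup with generator A.  The
    functional 2 psi(u) = u(t) + \int_{t-1}^t V is conserved, so w = u - psi(u) equals minus
    an average of its own past.  As w is Lipschitz, |w(t)| is at most 127/128 times the
    maximum of |w| on [t-3,t]; hence u tends to psi(u), which is positive for u > 0.

    A number lambda <> 0 is spectral only if lambda^2 + (1 - e^{-lambda})^2 = 0, which has no
    solution with Re lambda >= 0 or |Im lambda| < 1.  At 0 the resolvent is P / lambda plus the
    Neumann series of the reduced resolvent, where P f = psi(f) 1.  The residue does not
    depend on the Laurent expansion: averaging over roots of unity isolates it.

    Two semigroups T, S with generator A agree because T(t-s) S(s) f has zero right derivative
    in s for f in the domain, which is dense; the local boundedness of T this needs is the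
    uniform boundedness principle. *)

Require Import Defs.
From Stdlib Require Import Reals Lra Lia ZArith Classical ClassicalEpsilon.
From Coquelicot Require Import Coquelicot.
Open Scope R_scope.

(** * Continuous real functions and their primitives *)

(** The boundary functional has real coefficients, so the analysis is done for real continuous
    functions on the whole line and then applied to real and imaginary parts. Derivatives are mostly
    replaced by primitives: integral identities know no one-sided end points and survive shifts,
    linear combinations and gluing at time 0. Since the semigroup is not positive, no monotonicity
    argument gives positivity of the limit; it is read off the explicit value psi(u). Convergence is
    the delicate point: being minus a mean, w is only bounded by its past maximum M. A strict loss
    comes from a clash: w(t) near M would require w near -M on most of [t-2,t], yet w cannot move
    that fast just before t. The claims concern every semigroup with generator A and every Laurent
    expansion at 0, not only those constructed here; this is why uniqueness is proved for both. The
    definition of a C0-semigroup contains no bound locally uniform in t, and the residue is a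
    coefficient of an expansion rather than a contour integral, so both facts need their own
    elementary substitute. *)

Definition cont (p : R -> R) : Prop := forall x : R, continuous p x.

Definition prim (p : R -> R) (t : R) : R := RInt p 0 t.

Lemma cont_eps (p : R -> R) x : continuous p x <->
  forall eps, 0 < eps -> exists d, 0 < d /\
    forall y, Rabs (y - x) < d -> Rabs (p y - p x) < eps.
Proof.
  split.
  - intros H eps He.
    destruct (proj1 (filterlim_locally (F := locally x) p (p x)) H (mkposreal eps He))
      as [d Hd].
    exists d; split; [apply cond_pos |]; intros y Hy; apply Hd, Hy.
  - intros H; apply filterlim_locally; intros eps.
    destruct (H eps (cond_pos eps)) as [d [Hd Hd']].
    exists (mkposreal d Hd); intros y Hy; apply Hd', Hy.
Qed.

Lemma ex_derive_cont (p : R -> R) x l : is_derive p x l -> continuous p x.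
Proof. intros H; apply (ex_derive_continuous (K := R_AbsRing) (V := R_NormedModule)); exists l; exact H. Qed.

Lemma cont_const c : cont (fun _ => c).
Proof. intros x; apply continuous_const. Qed.

Lemma cont_plus p q : cont p -> cont q -> cont (fun x => p x + q x).
Proof. intros Hp Hq x; apply (continuous_plus (V := R_NormedModule) p q); auto. Qed.

Lemma cont_mult p q : cont p -> cont q -> cont (fun x => p x * q x).
Proof. intros Hp Hq x; apply (continuous_mult (K := R_AbsRing) p q); auto. Qed.

Lemma cont_opp p : cont p -> cont (fun x => - p x).
Proof. intros Hp x; apply (continuous_opp (V := R_NormedModule) p); auto. Qed.

Lemma cont_minus p q : cont p -> cont q -> cont (fun x => p x - q x).
Proof. intros Hp Hq; apply cont_plus; [| apply cont_opp]; auto. Qed.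

Lemma cont_comp p q : cont p -> cont q -> cont (fun x => p (q x)).
Proof. intros Hp Hq x; apply (continuous_comp q p); auto. Qed.

Lemma cont_id : cont (fun x => x).
Proof. intros x; apply continuous_id. Qed.

Lemma cont_lip p L : (forall x y, Rabs (p y - p x) <= L * Rabs (y - x)) -> cont p.
Proof.
  intros H x; apply cont_eps; intros eps He.
  (* No sign is assumed of L, so the modulus of continuity is taken with |L| + 1. *)
  assert (HL : 0 < Rabs L + 1) by (generalize (Rabs_pos L); lra).
  exists (eps / (Rabs L + 1)); split; [apply Rdiv_lt_0_compat; lra |].
  intros y Hy; apply Rle_lt_trans with ((Rabs L + 1) * Rabs (y - x)).
  - eapply Rle_trans; [apply H |].
    apply Rmult_le_compat_r; [apply Rabs_pos |]; generalize (Rle_abs L); lra.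
  - apply Rlt_le_trans with ((Rabs L + 1) * (eps / (Rabs L + 1))).
    + apply Rmult_lt_compat_l; auto.
    + right; field; lra.
Qed.

Lemma cont_Rmin c : cont (fun x => Rmin x c).
Proof.
  apply cont_lip with 1; intros x y; rewrite Rmult_1_l.
  unfold Rmin; repeat destruct (Rle_dec _ _); unfold Rabs; repeat destruct (Rcase_abs _); lra.
Qed.

Lemma cont_Rmax c : cont (fun x => Rmax x c).
Proof.
  apply cont_lip with 1; intros x y; rewrite Rmult_1_l.
  unfold Rmax; repeat destruct (Rle_dec _ _); unfold Rabs; repeat destruct (Rcase_abs _); lra.
Qed.

Lemma cont_clamp : cont clamp.
Proof. apply cont_lip with 1; intros x y; rewrite Rmult_1_l; apply clamp_lip. Qed.

Lemma cont_Rabs p : cont p -> cont (fun x => Rabs (p x)).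
Proof. intros Hp x; apply (continuous_comp p Rabs); [apply Hp | apply continuous_Rabs]. Qed.

Lemma cont_derive p dp : (forall x, is_derive p x (dp x)) -> cont p.
Proof. intros H x; apply (ex_derive_cont p x _ (H x)). Qed.

Lemma cont_cos : cont cos.
Proof. apply cont_derive with (fun x => - sin x); intros x; auto_derive; auto; ring. Qed.

Lemma cont_sin : cont sin.
Proof. apply cont_derive with cos; intros x; auto_derive; auto; ring. Qed.

Lemma cont_exp : cont exp.
Proof. apply cont_derive with exp; intros x; auto_derive; auto; ring. Qed.

Lemma cont_ex_RInt p a b : cont p -> ex_RInt p a b.
Proof. intros Hp; apply (ex_RInt_continuous (V := R_CompleteNormedModule)); intros; apply Hp. Qed.

Lemma prim_derive p t : cont p -> is_derive (prim p) t (p t).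
Proof.
  intros Hp; apply (is_derive_RInt (V := R_NormedModule) p (prim p) 0 t); [| apply Hp].
  exists (mkposreal 1 Rlt_0_1); intros y _.
  apply (RInt_correct (V := R_CompleteNormedModule)), cont_ex_RInt, Hp.
Qed.

Lemma prim_0 p : prim p 0 = 0.
Proof. apply (RInt_point (V := R_CompleteNormedModule)). Qed.

Lemma cont_prim p : cont p -> cont (prim p).
Proof. intros Hp; apply cont_derive with p; intros; apply prim_derive, Hp. Qed.

Lemma RInt_ftc (F f : R -> R) a b : (forall t, is_derive F t (f t)) -> cont f ->
  (RInt f a b : R) = F b - F a.
Proof.
  intros H Hf; apply is_RInt_unique.
  apply (is_RInt_derive (V := R_CompleteNormedModule)); intros; [apply H | apply Hf].
Qed.

Lemma RInt_prim p a b : cont p -> (RInt p a b : R) = prim p b - prim p a.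
Proof. intros Hp; apply RInt_ftc; auto; intros; apply prim_derive, Hp. Qed.

Lemma derive_eq (F G f : R -> R) a b : a <= b ->
  (forall t, a <= t <= b -> is_derive F t (f t)) ->
  (forall t, a <= t <= b -> is_derive G t (f t)) -> F b - F a = G b - G a.
Proof.
  intros Hab HF HG.
  destruct (MVT_gen (fun t => F t - G t) a b (fun _ => 0)) as [c [_ Hc]].
  - rewrite Rmin_left, Rmax_right by lra; intros t Ht.
    replace 0 with (f t - f t) by ring.
    apply (is_derive_minus (K := R_AbsRing) (V := R_NormedModule) F G); [apply HF | apply HG]; lra.
  - rewrite Rmin_left, Rmax_right by lra; intros t Ht.
    apply continuity_pt_filterlim.
    apply (continuous_minus (V := R_NormedModule) F G);
      [apply (ex_derive_cont _ _ _ (HF t Ht)) | apply (ex_derive_cont _ _ _ (HG t Ht))].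
  - lra.
Qed.

Lemma derive_shift (F f : R -> R) c t : is_derive F (t + c) (f (t + c)) ->
  is_derive (fun s => F (s + c)) t (f (t + c)).
Proof.
  intros H.
  replace (f (t + c)) with (scal (1 + 0) (f (t + c))) by (unfold scal; simpl; unfold mult; simpl; ring).
  apply (is_derive_comp (K := R_AbsRing) (V := R_NormedModule) F (fun s => s + c)); [exact H |].
  auto_derive; auto; ring.
Qed.

Lemma cont_shift p c : cont p -> cont (fun x => p (x + c)).
Proof. intros Hp; apply (cont_comp p); [exact Hp |]. apply cont_plus; [apply cont_id | apply cont_const]. Qed.

Lemma RInt_shift p c a b : cont p ->
  (RInt (fun s => p (s + c)) a b : R) = prim p (b + c) - prim p (a + c).
Proof.
  intros Hp; apply (RInt_ftc (fun s => prim p (s + c))).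
  - intros t; apply derive_shift, prim_derive, Hp.
  - apply cont_shift, Hp.
Qed.

Lemma prim_shift p c t : cont p -> prim (fun s => p (s + c)) t = prim p (t + c) - prim p c.
Proof. intros Hp; unfold prim at 1; rewrite RInt_shift, Rplus_0_l by exact Hp; reflexivity. Qed.

Lemma RInt_lin p q c d a b : cont p -> cont q ->
  (RInt (fun s => c * p s + d * q s) a b : R) = c * RInt p a b + d * RInt q a b.
Proof.
  intros Hp Hq; rewrite (RInt_prim p), (RInt_prim q) by auto.
  rewrite (RInt_ftc (fun s => c * prim p s + d * prim q s)).
  - ring.
  - intros t.
    apply (is_derive_plus (K := R_AbsRing) (V := R_NormedModule)
             (fun s => c * prim p s) (fun s => d * prim q s));
      apply is_derive_scal, prim_derive; assumption.
  - apply cont_plus; apply cont_mult; auto using cont_const.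
Qed.

Lemma prim_lin p q c d t : cont p -> cont q ->
  prim (fun s => c * p s + d * q s) t = c * prim p t + d * prim q t.
Proof. apply RInt_lin. Qed.

Lemma RInt_abs_le p a b M : cont p -> a <= b ->
  (forall t, a <= t <= b -> Rabs (p t) <= M) -> Rabs (RInt p a b) <= (b - a) * M.
Proof. intros Hp Hab H; apply abs_RInt_le_const; auto; apply cont_ex_RInt, Hp. Qed.

Lemma prim_abs_le p a b M : cont p -> a <= b ->
  (forall t, a <= t <= b -> Rabs (p t) <= M) ->
  Rabs (prim p b - prim p a) <= (b - a) * M.
Proof. intros Hp; rewrite <- RInt_prim by auto; apply RInt_abs_le, Hp. Qed.

Lemma prim_le p a b m : cont p -> a <= b ->
  (forall t, a <= t <= b -> m <= p t) -> (b - a) * m <= prim p b - prim p a.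
Proof.
  intros Hp Hab H; rewrite <- RInt_prim by auto.
  replace ((b - a) * m) with (RInt (fun _ => m) a b).
  - apply RInt_le; auto; try (apply cont_ex_RInt; auto using cont_const).
    intros; apply H; lra.
  - rewrite RInt_const; reflexivity.
Qed.

Lemma prim_gt0 p a b c : cont p -> a < b -> a <= c <= b ->
  (forall t, a <= t <= b -> 0 <= p t) -> 0 < p c -> 0 < prim p b - prim p a.
Proof.
  intros Hp Hab Hc H0 Hpc.
  destruct (proj1 (cont_eps p c) (Hp c) (p c / 2)) as [d [Hd Hd']]; [lra |].
  (* Clipping to [a,b] leaves a nondegenerate interval even when c is an end point. *)
  set (l := Rmax a (c - d / 2)); set (r := Rmin b (c + d / 2)).
  assert (Hl : a <= l <= c /\ c - d / 2 <= l).
  { unfold l, Rmax; destruct (Rle_dec _ _); lra. }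
  assert (Hr : c <= r <= b /\ r <= c + d / 2).
  { unfold r, Rmin; destruct (Rle_dec _ _); lra. }
  assert (Hlr : l < r).
  { unfold l, r, Rmin, Rmax; repeat destruct (Rle_dec _ _); lra. }
  assert (A1 := prim_le p a l 0 Hp (proj1 (proj1 Hl))).
  assert (A2 := prim_le p l r (p c / 2) Hp (Rlt_le _ _ Hlr)).
  assert (A3 := prim_le p r b 0 Hp (proj2 (proj1 Hr))).
  assert (B1 : 0 <= prim p l - prim p a) by (rewrite <- (Rmult_0_r (l - a)); apply A1; intros; apply H0; lra).
  assert (B3 : 0 <= prim p b - prim p r) by (rewrite <- (Rmult_0_r (b - r)); apply A3; intros; apply H0; lra).
  assert (B2 : (r - l) * (p c / 2) <= prim p r - prim p l).
  { apply A2; intros t Ht.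
    assert (Ht' : Rabs (t - c) < d) by (apply Rabs_def1; lra).
    apply Hd' in Ht'; apply Rabs_def2 in Ht'; lra. }
  assert (0 < (r - l) * (p c / 2)) by (apply Rmult_lt_0_compat; lra).
  lra.
Qed.

Lemma cont_abs_max p a b : cont p -> a <= b ->
  exists c, a <= c <= b /\ forall t, a <= t <= b -> Rabs (p t) <= Rabs (p c).
Proof.
  intros Hp Hab.
  destruct (continuity_ab_maj (fun x => Rabs (p x)) a b Hab) as [c [H1 H2]].
  - intros c _; apply continuity_pt_filterlim, cont_Rabs, Hp.
  - exists c; auto.
Qed.

Lemma cont_unif p a b eps : cont p -> 0 < eps -> exists d, 0 < d /\
  forall x y, a <= x <= b -> a <= y <= b -> Rabs (x - y) < d -> Rabs (p x - p y) < eps.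
Proof.
  intros Hp He.
  destruct (@Heine_cor2 p a b (fun x _ => proj2 (continuity_pt_filterlim p x) (Hp x)) (mkposreal eps He))
    as [d Hd].
  exists d; split; [apply cond_pos | exact Hd].
Qed.

(** The supremum of the points up to which P holds satisfies P by closure from the left; below b,
    the step to the right would push it further. *)
Lemma real_induction (P : R -> Prop) a b : a <= b -> P a ->
  (forall s, a <= s < b -> P s ->
     exists d, 0 < d /\ forall y, s < y < s + d -> y <= b -> P y) ->
  (forall s, a < s <= b -> (forall y, a <= y < s -> P y) -> P s) ->
  P b.
Proof.
  intros Hab Ha Hr Hl.
  set (E := fun x => a <= x <= b /\ forall y, a <= y <= x -> P y).
  destruct (completeness E) as [c [Hc1 Hc2]].
  - exists b; intros x [Hx _]; lra.
  - exists a; split; [lra |]; intros y Hy; replace y with a by lra; exact Ha.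
  - assert (Hca : a <= c).
    { apply Hc1; split; [lra |]; intros y Hy; replace y with a by lra; exact Ha. }
    assert (Hcb : c <= b) by (apply Hc2; intros x [Hx _]; lra).
    assert (Hlt : forall y, a <= y < c -> P y).
    { intros y Hy; apply NNPP; intros HN.
      assert (c <= y); [| lra].
      apply Hc2; intros x [Hx1 Hx2]; apply Rnot_lt_le; intros Hyx; apply HN, Hx2; lra. }
    assert (Hc : P c).
    { destruct (Req_dec a c) as [<- | Hn]; [exact Ha | apply Hl; auto; lra]. }
    destruct (Req_dec c b) as [<- | Hn]; [exact Hc |].
    destruct (Hr c) as [d [Hd Hd']]; [lra | exact Hc |].
    set (x := Rmin b (c + d / 2)).
    assert (Hx : c < x <= b /\ x < c + d).
    { unfold x, Rmin; destruct (Rle_dec _ _); lra. }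
    assert (x <= c); [| lra].
    apply Hc1; split; [lra |]; intros y Hy.
    destruct (Rtotal_order y c) as [H | [-> | H]]; [apply Hlt; lra | exact Hc | apply Hd'; lra].
Qed.

(** With right derivatives only, the mean value theorem does not apply; instead |p s - p a| <= eps
    (s - a) is carried from a to b by [real_induction]. It serves for the right difference quotients
    of the semigroup and again for uniqueness of semigroups. *)
Lemma zero_right_derivative (p : R -> R) a b : a <= b ->
  (forall s, a < s <= b -> forall eps, 0 < eps -> exists d, 0 < d /\
     forall y, a <= y < s -> s - d < y -> Rabs (p s - p y) <= eps) ->
  (forall s, a <= s < b -> forall eps, 0 < eps -> exists d, 0 < d /\
     forall y, s < y < s + d -> y <= b -> Rabs (p y - p s) <= eps * (y - s)) ->
  p b = p a.
Proof.
  intros Hab Hl Hr.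
  assert (H : forall eps, 0 < eps -> Rabs (p b - p a) <= eps * (b - a)).
  { intros eps He.
    apply (real_induction (fun x => Rabs (p x - p a) <= eps * (x - a)) a b); auto.
    - replace (p a - p a) with 0 by ring; rewrite Rabs_R0; lra.
    - intros s Hs Ps; destruct (Hr s Hs eps He) as [d [Hd Hd']].
      exists d; split; auto; intros y Hy Hyb.
      replace (p y - p a) with ((p y - p s) + (p s - p a)) by ring.
      eapply Rle_trans; [apply Rabs_triang |]; specialize (Hd' y Hy Hyb); lra.
    - intros s Hs Py; apply le_epsilon; intros e' He'.
      destruct (Hl s Hs e' He') as [d [Hd Hd']].
      set (y := Rmax a (s - d / 2)).
      assert (Hy : a <= y < s /\ s - d < y).
      { unfold y, Rmax; destruct (Rle_dec _ _); lra. }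
      replace (p s - p a) with ((p s - p y) + (p y - p a)) by ring.
      eapply Rle_trans; [apply Rabs_triang |].
      specialize (Hd' y (proj1 Hy) (proj2 Hy)); specialize (Py y (proj1 Hy)).
      assert (eps * (y - a) <= eps * (s - a)) by (apply Rmult_le_compat_l; lra).
      lra. }
  apply Rminus_diag_uniq, Rabs_eq_0, Rle_antisym; [| apply Rabs_pos].
  apply le_epsilon; intros e He.
  apply Rle_trans with (e / (b - a + 1) * (b - a)).
  - apply H, Rdiv_lt_0_compat; lra.
  - apply Rle_trans with (e / (b - a + 1) * (b - a + 1)).
    + apply Rmult_le_compat_l; [apply Rlt_le, Rdiv_lt_0_compat; lra | lra].
    + right; field; lra.
Qed.

(** * The delay equation u'(t) = 2 U(t-1) - U(t) - U(t-2), U' = u *)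

(** Equals the integral of u over [s-2,s-1] minus that over [s-1,s]; at s = 0 this is the boundary
    functional of the operator. *)
Definition lag (u : R -> R) (s : R) : R := 2 * prim u (s - 1) - prim u s - prim u (s - 2).

(** Integrated form of the equation: the initial function is merely continuous, and at 0 the
    solution has in general only a right derivative. *)
Definition is_sol (u : R -> R) : Prop :=
  cont u /\ forall t, 0 <= t -> u t = u 0 + prim (lag u) t.

Lemma prim_ext f g T t : (forall s, s <= T -> f s = g s) -> 0 <= T -> t <= T ->
  prim f t = prim g t.
Proof.
  intros H HT Ht; apply (RInt_ext (V := R_CompleteNormedModule)); intros x Hx; apply H.
  unfold Rmax in Hx; destruct (Rle_dec 0 t); lra.
Qed.

Lemma prim_ext_neg f g a t : (forall s, a <= s <= 0 -> f s = g s) -> a <= t <= 0 ->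
  prim f t = prim g t.
Proof.
  intros H Ht; apply (RInt_ext (V := R_CompleteNormedModule)); intros x Hx; apply H.
  rewrite Rmin_right, Rmax_left in Hx by lra; lra.
Qed.

Lemma prim_ext_all f g t : (forall s, f s = g s) -> prim f t = prim g t.
Proof. intros H; apply (RInt_ext (V := R_CompleteNormedModule)); auto. Qed.

Lemma prim_ext_ge f g t : (forall s, 0 <= s -> f s = g s) -> 0 <= t ->
  prim f t = prim g t.
Proof.
  intros H Ht; apply (RInt_ext (V := R_CompleteNormedModule)); intros x Hx; apply H.
  rewrite Rmin_left, Rmax_right in Hx by lra; lra.
Qed.

Lemma cont_prim_shift u c : cont u -> cont (fun s => prim u (s - c)).
Proof. intros Hu; apply (cont_shift (prim u) (- c)), cont_prim, Hu. Qed.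

Lemma cont_lag u : cont u -> cont (lag u).
Proof.
  intros Hu; unfold lag.
  apply cont_minus; [apply cont_minus |].
  - apply cont_mult; [apply cont_const | apply cont_prim_shift, Hu].
  - apply cont_prim, Hu.
  - apply cont_prim_shift, Hu.
Qed.

Section Steps.

Variable p : R -> R.
Hypothesis Hp : cont p.

(* Since U'' + U = V with V(t) = 2 U(t-1) - U(t-2) known from the past,
   variation of constants gives u = U' on t >= 0 from V. *)
Definition var_const (V : R -> R) (t : R) : R :=
  cos t * (p 0 + prim (fun s => cos s * V s) t) + sin t * prim (fun s => sin s * V s) t.

Definition delayed (u : R -> R) (s : R) : R := 2 * prim u (s - 1) - prim u (s - 2).

(** Method of steps: iterate n is the solution up to time n. [Rmin] and [Rmax] glue the initial
    function to the new formula; the pieces meet at 0 because [var_const] starts at p 0. *)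
Fixpoint step_iter (n : nat) : R -> R :=
  match n with
  | O => p
  | S n => fun t => p (Rmin t 0) - p 0 + var_const (delayed (step_iter n)) (Rmax t 0)
  end.

Lemma cont_delayed u : cont u -> cont (delayed u).
Proof.
  intros Hu; apply cont_minus; [apply cont_mult |]; auto using cont_const, cont_prim_shift.
Qed.

Lemma cont_var_const V : cont V -> cont (var_const V).
Proof.
  intros HV.
  apply cont_plus; apply cont_mult; auto using cont_cos, cont_sin.
  - apply cont_plus; [apply cont_const |]; apply cont_prim, cont_mult; auto using cont_cos.
  - apply cont_prim, cont_mult; auto using cont_sin.
Qed.

Lemma cont_step_iter n : cont (step_iter n).
Proof.
  induction n as [| n IH]; simpl; [exact Hp |].
  apply cont_plus; [apply cont_minus; [| apply cont_const] |].
  - apply (cont_comp p); [exact Hp | apply cont_Rmin].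
  - apply (cont_comp (var_const _)); [apply cont_var_const, cont_delayed, IH | apply cont_Rmax].
Qed.

Lemma var_const_0 V : var_const V 0 = p 0.
Proof. unfold var_const; rewrite !prim_0, cos_0; ring. Qed.

Lemma step_iter_neg n t : t <= 0 -> step_iter n t = p t.
Proof.
  intros Ht; destruct n; simpl; [reflexivity |].
  rewrite Rmin_left, Rmax_right, var_const_0 by lra; ring.
Qed.

Lemma step_iter_pos n t : 0 <= t ->
  step_iter (S n) t = var_const (delayed (step_iter n)) t.
Proof. intros Ht; simpl; rewrite Rmin_right, Rmax_left by lra; ring. Qed.

Lemma step_iter_S n t : t <= INR n -> step_iter (S n) t = step_iter n t.
Proof.
  revert t; induction n as [| n IH]; intros t Ht.
  - apply (step_iter_neg 1), Ht.
  - destruct (Rle_dec t 0) as [H0 | H0].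
    + rewrite !step_iter_neg; auto.
    (* The delayed arguments s - 1 and s - 2 fall below n, where the two iterates already agree. *)
    + assert (H : forall s, s <= INR (S n) ->
        delayed (step_iter (S n)) s = delayed (step_iter n) s).
      { intros s Hs; unfold delayed.
        assert (HI := pos_INR n); rewrite S_INR in Hs.
        rewrite !(prim_ext (step_iter (S n)) (step_iter n) (INR n)); auto; lra. }
      assert (HI := pos_INR (S n)).
      rewrite !step_iter_pos by lra; unfold var_const.
      f_equal; f_equal; [f_equal |]; apply (prim_ext _ _ (INR (S n))); auto;
        intros s Hs; rewrite H; auto.
Qed.

Lemma step_iter_le n m t : (n <= m)%nat -> t <= INR n -> step_iter m t = step_iter n t.
Proof.
  intros Hnm Ht; induction Hnm as [| m Hnm IH]; [reflexivity |].
  rewrite <- IH; apply step_iter_S.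
  eapply Rle_trans; [exact Ht | apply le_INR, Hnm].
Qed.

(** The integral equation, except that the delayed terms still come from the previous iterate; below
    time n the two iterates coincide. *)
Lemma step_iter_sol n t : 0 <= t ->
  step_iter (S n) t =
  p 0 + prim (fun s => delayed (step_iter n) s - prim (step_iter (S n)) s) t.
Proof.
  intros Ht; set (V := delayed (step_iter n)).
  assert (HV : cont V) by apply cont_delayed, cont_step_iter.
  set (c := prim (fun s => cos s * V s)); set (d := prim (fun s => sin s * V s)).
  assert (Hc : forall s, is_derive c s (cos s * V s)).
  { intros s; apply (prim_derive (fun s => cos s * V s)), cont_mult; auto using cont_cos. }
  assert (Hd : forall s, is_derive d s (sin s * V s)).
  { intros s; apply (prim_derive (fun s => sin s * V s)), cont_mult; auto using cont_sin. }
  (* [E2] is the primitive of the new iterate on t >= 0: [DE2] and [DE] together say E2'' + E2 =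
     V. *)
  set (E2 := fun t => sin t * (p 0 + c t) - cos t * d t).
  assert (DE2 : forall s, is_derive E2 s (var_const V s)).
  { intros s; unfold E2; auto_derive.
    - repeat split; eexists; auto.
    - replace (Derive (fun x => c x) s) with (cos s * V s) by (symmetry; apply is_derive_unique, Hc).
      replace (Derive (fun x => d x) s) with (sin s * V s) by (symmetry; apply is_derive_unique, Hd).
      unfold var_const; fold c d; ring. }
  assert (DE : forall s, is_derive (var_const V) s (V s - E2 s)).
  { intros s; unfold var_const; fold c d; auto_derive.
    - repeat split; eexists; auto.
    - replace (Derive (fun x => c x) s) with (cos s * V s) by (symmetry; apply is_derive_unique, Hc).
      replace (Derive (fun x => d x) s) with (sin s * V s) by (symmetry; apply is_derive_unique, Hd).
      unfold E2; assert (H := sin2_cos2 s); unfold Rsqr in H.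
      transitivity ((sin s * sin s + cos s * cos s) * V s - sin s * (p 0 + c s) + cos s * d s);
        [ring | rewrite H; ring]. }
  assert (HE2 : forall s, 0 <= s -> prim (step_iter (S n)) s = E2 s).
  { intros s Hs.
    assert (H := derive_eq (prim (step_iter (S n))) E2 (step_iter (S n)) 0 s Hs).
    rewrite prim_0 in H.
    assert (E20 : E2 0 = 0).
    { unfold E2, c, d; rewrite !prim_0, sin_0; ring. }
    rewrite E20 in H.
    enough (prim (step_iter (S n)) s - 0 = E2 s - 0) by lra.
    apply H; intros r Hr; [apply prim_derive, cont_step_iter |].
    rewrite step_iter_pos by lra; apply DE2. }
  rewrite step_iter_pos by exact Ht; fold V.
  rewrite (prim_ext_ge (fun s => V s - prim (step_iter (S n)) s) (fun s => V s - E2 s) t)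
    by (auto; intros; rewrite HE2; auto).
  assert (HE2c : cont E2) by (apply cont_derive with (var_const V); auto).
  rewrite <- (var_const_0 V).
  assert (H := RInt_ftc (var_const V) (fun s => V s - E2 s) 0 t DE (cont_minus _ _ HV HE2c)).
  unfold prim; rewrite H; ring.
Qed.

Lemma sol_exists : exists u, is_sol u /\ forall t, t <= 0 -> u t = p t.
Proof.
  set (N := fun t => Z.to_nat (up t)).
  assert (HN : forall t, t <= INR (N t)).
  { intros t; unfold N; destruct (archimed t) as [H _].
    destruct (Z_le_gt_dec 0 (up t)) as [H0 | H0].
    - rewrite INR_IZR_INZ, Z2Nat.id by auto; lra.
    - apply Rle_trans with 0; [| apply pos_INR].
      apply Z.gt_lt, IZR_lt in H0; lra. }
  set (u := fun t => step_iter (N t) t).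
  assert (Hu : forall n t, t <= INR n -> u t = step_iter n t).
  { intros n t Ht; unfold u; destruct (Nat.le_ge_cases n (N t)) as [H | H].
    - apply step_iter_le; auto.
    - symmetry; apply step_iter_le; auto. }
  assert (Hc : cont u).
  { intros x; apply (continuous_ext_loc u (step_iter (N (x + 1))) x); [| apply cont_step_iter].
    exists (mkposreal 1 Rlt_0_1); intros y Hy; symmetry; apply Hu.
    apply Rle_trans with (x + 1); [| apply HN].
    apply Rabs_def2 in Hy; unfold minus, plus, opp in Hy; simpl in Hy; lra. }
  assert (Hneg : forall t, t <= 0 -> u t = p t).
  { intros t Ht; apply step_iter_neg, Ht. }
  exists u; split; [split; [exact Hc |] | exact Hneg].
  intros t Ht.
  (* The successor index is chosen because [step_iter_sol] speaks of iterate S n driven by iterate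
     n. *)
  rewrite (Hu (S (N t)) t) by (rewrite S_INR; assert (H := HN t); lra).
  rewrite step_iter_sol, Hneg by lra; f_equal.
  apply (prim_ext _ _ (INR (N t))); [| apply pos_INR | apply HN].
  intros s Hs; unfold lag, delayed.
  rewrite !(prim_ext u (step_iter (N t)) (INR (N t))); auto using pos_INR; try lra.
  rewrite (prim_ext (step_iter (S (N t))) (step_iter (N t)) (INR (N t)));
    auto using pos_INR, step_iter_S; ring.
Qed.

End Steps.

(** * A priori bound, linearity and uniqueness for the delay equation *)

Lemma lag_bound u M s : cont u -> (forall t, s - 2 <= t <= s -> Rabs (u t) <= M) ->
  Rabs (lag u s) <= 2 * M.
Proof.
  intros Hu H; unfold lag.
  replace (2 * prim u (s - 1) - prim u s - prim u (s - 2))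
    with ((prim u (s - 1) - prim u (s - 2)) - (prim u s - prim u (s - 1))) by ring.
  assert (A := prim_abs_le u (s - 2) (s - 1) M Hu).
  assert (B := prim_abs_le u (s - 1) s M Hu).
  eapply Rle_trans; [apply Rabs_triang |]; rewrite Rabs_Ropp.
  replace (2 * M) with ((s - 1 - (s - 2)) * M + (s - (s - 1)) * M) by ring.
  apply Rplus_le_compat; [apply A | apply B]; try lra; intros; apply H; lra.
Qed.

(** The slope is at most twice the maximum of |u|, so over a quarter of a unit |u| gains at most
    half of its new maximum; absorbing that half doubles the bound. The case m = 0 gives uniqueness,
    the general case boundedness of the semigroup. *)
Lemma sol_bound u m : is_sol u -> (forall t, -2 <= t <= 0 -> Rabs (u t) <= m) ->
  forall n t, -2 <= t <= INR n / 4 -> Rabs (u t) <= 2 ^ n * m.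
Proof.
  intros [Hu Hs] Hm.
  assert (m0 : 0 <= m) by (apply Rle_trans with (2 := Hm 0 ltac:(lra)), Rabs_pos).
  induction n as [| n IH]; intros t Ht.
  - simpl in *; rewrite Rmult_1_l; apply Hm; lra.
  - set (a := INR n / 4); set (b := INR (S n) / 4).
    assert (Ha : 0 <= a) by (unfold a; assert (H := pos_INR n); lra).
    assert (Hab : b = a + 1 / 4) by (unfold a, b; rewrite S_INR; field).
    destruct (cont_abs_max u (-2) b Hu) as [c [Hc Hmax]]; [lra |].
    apply Rle_trans with (Rabs (u c)); [apply Hmax, Ht |].
    assert (Hpow : 0 <= 2 ^ n * m) by (apply Rmult_le_pos; [apply pow_le; lra | exact m0]).
    destruct (Rle_dec c a) as [Hca | Hca].
    + apply Rle_trans with (2 ^ n * m); [apply IH; fold a; lra | simpl; lra].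
    + assert (A : Rabs (prim (lag u) c - prim (lag u) a) <= (c - a) * (2 * Rabs (u c))).
      { apply prim_abs_le; [apply cont_lag, Hu | lra |].
        intros s Hs'; apply lag_bound; auto; intros r Hr; apply Hmax; lra. }
      assert (B : u c = u a + (prim (lag u) c - prim (lag u) a)).
      { rewrite (Hs c), (Hs a) by lra; ring. }
      assert (C1 : Rabs (u c) <= Rabs (u a) + Rabs (prim (lag u) c - prim (lag u) a)).
      { rewrite B at 1; apply Rabs_triang. }
      assert (D : Rabs (u a) <= 2 ^ n * m) by (apply IH; fold a; lra).
      assert (F : (c - a) * (2 * Rabs (u c)) <= 1 / 4 * (2 * Rabs (u c))).
      { apply Rmult_le_compat_r; [assert (H := Rabs_pos (u c)); lra | lra]. }
      simpl; lra.
Qed.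

Lemma lag_lin u v c d s : cont u -> cont v ->
  lag (fun t => c * u t + d * v t) s = c * lag u s + d * lag v s.
Proof. intros Hu Hv; unfold lag; rewrite !prim_lin by auto; ring. Qed.

Lemma cont_lin u v c d : cont u -> cont v -> cont (fun t => c * u t + d * v t).
Proof. intros Hu Hv; apply cont_plus; apply cont_mult; auto using cont_const. Qed.

Lemma sol_lin u v c d : is_sol u -> is_sol v -> is_sol (fun t => c * u t + d * v t).
Proof.
  intros [Hu Su] [Hv Sv]; split; [apply cont_lin; auto |].
  intros t Ht; rewrite (Su t), (Sv t) by auto.
  rewrite (prim_ext_ge (lag (fun s => c * u s + d * v s)) (fun s => c * lag u s + d * lag v s) t);
    [| intros; apply lag_lin; assumption | exact Ht].
  rewrite prim_lin by (apply cont_lag; assumption); ring.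
Qed.

Lemma INR_quarter_ge t : exists n, t <= INR n / 4.
Proof.
  exists (Z.to_nat (up (4 * t))); destruct (archimed (4 * t)) as [H _].
  destruct (Z_le_gt_dec 0 (up (4 * t))) as [H0 | H0].
  - rewrite INR_IZR_INZ, Z2Nat.id by auto; lra.
  - apply Z.gt_lt, IZR_lt in H0; assert (H' := pos_INR (Z.to_nat (up (4 * t)))); lra.
Qed.

Lemma sol_unique u v : is_sol u -> is_sol v -> (forall t, -2 <= t <= 0 -> u t = v t) ->
  forall t, -2 <= t -> u t = v t.
Proof.
  intros Hu Hv H t Ht; destruct (INR_quarter_ge t) as [n Hn].
  assert (A := sol_bound _ 0 (sol_lin u v 1 (-1) Hu Hv)).
  assert (B : Rabs (1 * u t + -1 * v t) <= 2 ^ n * 0).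
  { apply A; [| lra].
    intros s Hs; rewrite H by lra.
    replace (1 * v s + -1 * v s) with 0 by ring; rewrite Rabs_R0; lra. }
  rewrite Rmult_0_r in B; assert (C := Rabs_pos (1 * u t + -1 * v t)).
  apply Rle_antisym in B; auto.
  symmetry in B; apply Rabs_eq_0 in B; lra.
Qed.

Lemma sol_shift u s : is_sol u -> 0 <= s -> is_sol (fun x => u (x + s)).
Proof.
  intros [Hu Su] Hs; split; [apply cont_shift, Hu |].
  (* A shift changes the primitive by the constant [prim u s], which [lag] ignores as its
     coefficients 2, -1, -1 add up to zero. *)
  assert (HP : forall t, prim (fun x => u (x + s)) t = prim u (t + s) - prim u s).
  { intros t; apply prim_shift, Hu. }
  intros t Ht.
  rewrite (prim_ext_ge (lag (fun x => u (x + s))) (fun r => lag u (r + s)) t).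
  - unfold prim; rewrite (RInt_shift (lag u)) by apply cont_lag, Hu.
    rewrite (Su (t + s)), (Su (0 + s)) by lra; unfold prim; ring.
  - intros r _; unfold lag; rewrite !HP.
    replace (r - 1 + s) with (r + s - 1) by ring.
    replace (r - 2 + s) with (r + s - 2) by ring; ring.
  - exact Ht.
Qed.

(** * The conserved functional and convergence to equilibrium *)

Definition unit_int (p : R -> R) (s : R) : R := prim p s - prim p (s - 1).

(** The mean of p over [t-2,t] with the triangular weight of total mass one that peaks at t - 1. *)
Definition avg (p : R -> R) (t : R) : R := prim (unit_int p) t - prim (unit_int p) (t - 1).

(** A left null vector of the operator ([psi_derivative]), normalised to be 1 on the constant 1. *)
Definition psi (p : R -> R) : R := (p 0 + avg p 0) / 2.

Lemma cont_unit_int p : cont p -> cont (unit_int p).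
Proof. intros Hp; apply cont_minus; [apply cont_prim, Hp | apply cont_prim_shift, Hp]. Qed.

(** With V = [unit_int u], the slope V(t-1) - V(t) of u is minus the derivative of [avg u]. *)
Lemma sol_conserved u t : is_sol u -> 0 <= t -> u t + avg u t = 2 * psi u.
Proof.
  intros [Hu Su] Ht; rewrite (Su t) by auto; unfold psi, avg.
  assert (HJ := cont_unit_int u Hu).
  assert (HJ' : cont (fun s => unit_int u (s + -1))) by apply cont_shift, HJ.
  rewrite (prim_ext_ge (lag u) (fun s => 1 * unit_int u (s + -1) + -1 * unit_int u s)).
  - rewrite prim_lin by auto.
    unfold prim at 1; rewrite RInt_shift by auto.
    rewrite prim_0; replace (0 + -1) with (0 - 1) by ring.
    replace (t + -1) with (t - 1) by ring; field.
  - intros s _; unfold lag, unit_int; replace (s + -1 - 1) with (s - 2) by ring.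
    replace (s + -1) with (s - 1) by ring; ring.
  - exact Ht.
Qed.

Lemma avg_lin p q c d t : cont p -> cont q ->
  avg (fun s => c * p s + d * q s) t = c * avg p t + d * avg q t.
Proof.
  intros Hp Hq; unfold avg.
  assert (E : forall t, prim (unit_int (fun s => c * p s + d * q s)) t =
    c * prim (unit_int p) t + d * prim (unit_int q) t).
  { intros r; rewrite <- prim_lin by auto using cont_unit_int.
    apply prim_ext_all; intros x.
    unfold unit_int; rewrite !prim_lin by auto; ring. }
  rewrite !E; ring.
Qed.

Lemma psi_lin p q c d : cont p -> cont q ->
  psi (fun s => c * p s + d * q s) = c * psi p + d * psi q.
Proof. intros Hp Hq; unfold psi; rewrite avg_lin by auto; field. Qed.

Lemma psi_ext p q : (forall t, -2 <= t <= 0 -> p t = q t) -> psi p = psi q.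
Proof.
  intros H; unfold psi, avg; rewrite (H 0) by lra.
  do 3 f_equal; apply (prim_ext_neg _ _ (-1)); try lra; intros s Hs; unfold unit_int;
    rewrite !(prim_ext_neg p q (-2)); auto; lra.
Qed.

Lemma prim_const c t : prim (fun _ => c) t = c * t.
Proof.
  unfold prim; rewrite RInt_const; unfold scal; simpl; unfold mult; simpl; ring.
Qed.

Lemma avg_const c t : avg (fun _ => c) t = c.
Proof.
  unfold avg.
  assert (E : forall t, prim (unit_int (fun _ => c)) t = c * t).
  { intros r; rewrite <- prim_const; apply prim_ext_all.
    intros x; unfold unit_int; rewrite !prim_const; ring. }
  rewrite !E; ring.
Qed.

Lemma psi_const c : psi (fun _ => c) = c.
Proof. unfold psi; rewrite avg_const; field. Qed.

Lemma avg_abs_le p M t : cont p -> (forall s, t - 2 <= s <= t -> Rabs (p s) <= M) ->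
  Rabs (avg p t) <= M.
Proof.
  intros Hp H; replace M with ((t - (t - 1)) * ((t - (t - 1)) * M)) by ring.
  apply prim_abs_le; [apply cont_unit_int, Hp | lra |]; intros s Hs.
  replace (t - (t - 1)) with (s - (s - 1)) by ring.
  apply prim_abs_le; [exact Hp | lra |]; intros; apply H; lra.
Qed.

Lemma psi_abs_le p M : cont p -> (forall s, -2 <= s <= 0 -> Rabs (p s) <= M) ->
  Rabs (psi p) <= M.
Proof.
  intros Hp H.
  assert (A : Rabs (avg p 0) <= M) by (apply avg_abs_le; auto; intros; apply H; lra).
  assert (B := H 0 ltac:(lra)).
  unfold psi; apply Rabs_le_between in A; apply Rabs_le_between in B.
  apply Rabs_le_between; lra.
Qed.

Lemma psi_pos p x : cont p -> (forall s, -2 <= s <= 0 -> 0 <= p s) ->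
  -2 <= x <= 0 -> 0 < p x -> 0 < psi p.
Proof.
  intros Hp H Hx Hpx; unfold psi, avg.
  assert (HJ : forall s, -1 <= s <= 0 -> 0 <= unit_int p s).
  { intros s Hs; unfold unit_int; replace 0 with ((s - (s - 1)) * 0) by ring.
    apply prim_le; [exact Hp | lra |]; intros; apply H; lra. }
  assert (H0 := H 0 ltac:(lra)).
  enough (0 < prim (unit_int p) 0 - prim (unit_int p) (0 - 1)) by lra.
  assert (HJc := cont_unit_int p Hp).
  (* Depending on which half of [-2,0] contains x, [unit_int p] is positive at -1 or at 0, both in
     the range over which [avg p 0] integrates it. *)
  destruct (Rle_dec x (-1)).
  - apply (prim_gt0 _ _ _ (-1)); try lra; auto.
    + intros; apply HJ; lra.
    + unfold unit_int; apply (prim_gt0 _ _ _ x); try lra; auto; intros; apply H; lra.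
  - apply (prim_gt0 _ _ _ 0); try lra; auto.
    + intros; apply HJ; lra.
    + unfold unit_int; apply (prim_gt0 _ _ _ x); try lra; auto; intros; apply H; lra.
Qed.

(** 1 - (1/8)(1/16): on the last eighth of the averaging range, [unit_int w] exceeds its trivial
    lower bound -M by at least M/16. *)
Definition contraction_factor : R := 127 / 128.

(* If w t is near M then w = - avg w forces w near -M on most of [t-2, t],
   which the Lipschitz bound forbids just to the left of t. *)
Lemma equilibrium_step_pos w M t : cont w -> (forall s, 0 <= s -> w s = - avg w s) ->
  1 <= t -> (forall s, t - 3 <= s <= t -> Rabs (w s) <= M) ->
  0 <= w t -> w t <= contraction_factor * M.
Proof.
  intros Hw Havg Ht HM Hpos; unfold contraction_factor.
  assert (HJ := cont_unit_int w Hw).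
  assert (HJM : forall s, t - 2 <= s <= t -> Rabs (unit_int w s) <= M).
  { intros s Hs; replace M with ((s - (s - 1)) * M) by ring.
    apply prim_abs_le; [exact Hw | lra |]; intros; apply HM; lra. }
  assert (M0 : 0 <= M) by (apply Rle_trans with (2 := HM t ltac:(lra)), Rabs_pos).
  (* Both ends of the outer integral in [avg] contribute a rate of at most M, so w is 2M-Lipschitz
     here; starting from w t >= 0 it falls by at most M/2 within a quarter. The assumption 1 <= t
     keeps s >= 0, where w = - avg w is known. *)
  assert (Hlow : forall s, t - 1 / 4 <= s <= t -> - M / 2 <= w s).
  { intros s Hs.
    assert (A := prim_abs_le (unit_int w) s t M HJ ltac:(lra) ltac:(intros; apply HJM; lra)).
    assert (B := prim_abs_le (unit_int w) (s - 1) (t - 1) M HJ ltac:(lra) ltac:(intros; apply HJM; lra)).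
    apply Rabs_le_between in A; apply Rabs_le_between in B.
    assert (C1 := Havg s ltac:(lra)); assert (C2 := Havg t ltac:(lra)); unfold avg in C1, C2.
    assert ((t - s) * M <= 1 / 4 * M) by (apply Rmult_le_compat_r; lra).
    replace (t - 1 - (s - 1)) with (t - s) in B by ring; lra. }
  (* At least an eighth of [s-1,s] lies in [t-1/4,t], where w >= -M/2 instead of -M; the gain is
     (1/8)(M/2) = M/16. *)
  assert (HJlow : forall s, t - 1 / 8 <= s <= t -> - 15 / 16 * M <= unit_int w s).
  { intros s Hs; unfold unit_int.
    assert (A := prim_le w (t - 1 / 4) s (- M / 2) Hw ltac:(lra) ltac:(intros; apply Hlow; lra)).
    assert (B : (t - 1 / 4 - (s - 1)) * (- M) <= prim w (t - 1 / 4) - prim w (s - 1)).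
    { apply prim_le; [exact Hw | lra |]; intros r Hr.
      assert (H := HM r ltac:(lra)); apply Rabs_le_between in H; lra. }
    assert (C1 : 1 / 8 * (M / 2) <= (s - (t - 1 / 4)) * (M / 2)) by (apply Rmult_le_compat_r; lra).
    lra. }
  assert (A := prim_le (unit_int w) (t - 1 / 8) t _ HJ ltac:(lra) HJlow).
  assert (B : (t - 1 / 8 - (t - 1)) * (- M) <= prim (unit_int w) (t - 1 / 8) - prim (unit_int w) (t - 1)).
  { apply prim_le; [exact HJ | lra |]; intros r Hr.
    assert (H := HJM r ltac:(lra)); apply Rabs_le_between in H; lra. }
  assert (C1 := Havg t ltac:(lra)); unfold avg in C1; lra.
Qed.

Lemma equilibrium_step w M t : cont w -> (forall s, 0 <= s -> w s = - avg w s) ->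
  1 <= t -> (forall s, t - 3 <= s <= t -> Rabs (w s) <= M) ->
  Rabs (w t) <= contraction_factor * M.
Proof.
  intros Hw Havg Ht HM; apply Rabs_le_between.
  assert (M0 : 0 <= M) by (apply Rle_trans with (2 := HM t ltac:(lra)), Rabs_pos).
  destruct (Rle_dec 0 (w t)) as [H | H].
  - split; [unfold contraction_factor; lra | apply equilibrium_step_pos; auto].
  - split; [| unfold contraction_factor; lra].
    enough (-1 * w t + 0 * w t <= contraction_factor * M) by lra.
    (* This is -w, written as a combination so that [avg_lin] applies. *)
    apply (equilibrium_step_pos (fun s => -1 * w s + 0 * w s)); auto; try lra.
    + apply cont_lin; auto.
    + intros s Hs; rewrite avg_lin, (Havg s) by auto; ring.
    + intros s Hs; replace (-1 * w s + 0 * w s) with (- w s) by ring.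
      rewrite Rabs_Ropp; auto.
Qed.

Lemma equilibrium_decay w : cont w -> (forall s, 0 <= s -> w s = - avg w s) ->
  forall eps, 0 < eps -> exists t0, 0 <= t0 /\ forall t, t0 <= t -> Rabs (w t) < eps.
Proof.
  intros Hw Havg eps He.
  destruct (cont_abs_max w (-2) 1 Hw) as [c0 [Hc0 Hmax0]]; [lra |].
  set (M := Rabs (w c0)) in *.
  assert (M0 : 0 <= M) by apply Rabs_pos.
  (* A maximum of |w| on [-2,t] attained after time 1 would be at most 127/128 of itself, hence
     zero. *)
  assert (HM : forall t, -2 <= t -> Rabs (w t) <= M).
  { intros t Ht; destruct (cont_abs_max w (-2) t Hw Ht) as [c [Hc Hmax]].
    apply Rle_trans with (Rabs (w c)); [apply Hmax; lra |].
    destruct (Rle_dec c 1) as [H1 | H1]; [apply Hmax0; lra |].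
    assert (A := equilibrium_step w (Rabs (w c)) c Hw Havg ltac:(lra)
                   ltac:(intros; apply Hmax; lra)).
    unfold contraction_factor in A; assert (B := Rabs_pos (w c)); lra. }
  (* Each block of three time units, the length of the window in [equilibrium_step], wins one more
     factor. *)
  assert (Hn : forall n t, -2 + 3 * INR n <= t -> Rabs (w t) <= contraction_factor ^ n * M).
  { induction n as [| n IH]; intros t Ht.
    - simpl in *; rewrite Rmult_1_l; apply HM; lra.
    - rewrite S_INR in Ht; assert (HI := pos_INR n); simpl; rewrite Rmult_assoc.
      apply equilibrium_step; auto; [lra |]; intros s Hs; apply IH; lra. }
  destruct (pow_lt_1_zero contraction_factor) with (y := eps / (M + 1)) as [n Hpow].
  - unfold contraction_factor; rewrite Rabs_pos_eq; lra.
  - apply Rdiv_lt_0_compat; lra.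
  - exists (3 * INR n); split; [assert (HI := pos_INR n); lra |]; intros t Ht.
    apply Rle_lt_trans with (contraction_factor ^ n * M); [apply Hn; lra |].
    specialize (Hpow n (le_n n)).
    assert (Hq : 0 <= contraction_factor ^ n) by (apply pow_le; unfold contraction_factor; lra).
    rewrite Rabs_pos_eq in Hpow by auto.
    apply Rle_lt_trans with (contraction_factor ^ n * (M + 1)); [apply Rmult_le_compat_l; lra |].
    apply Rlt_le_trans with (eps / (M + 1) * (M + 1)); [apply Rmult_lt_compat_r; lra |].
    right; field; lra.
Qed.

Lemma is_sol_const c : is_sol (fun _ => c).
Proof.
  split; [apply cont_const |]; intros t Ht.
  rewrite (prim_ext_ge (lag (fun _ => c)) (fun _ => 0) t).
  - rewrite prim_const; ring.
  - intros s _; unfold lag; rewrite !prim_const; ring.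
  - exact Ht.
Qed.

Lemma sol_limit u eps : is_sol u -> 0 < eps ->
  exists t0, 0 <= t0 /\ forall t, t0 <= t -> Rabs (u t - psi u) < eps.
Proof.
  intros Hu He.
  (* Here w = u - psi u; since psi w = 0, conservation becomes w = - avg w. *)
  assert (Hu1 : is_sol (fun t => 1 * u t + - psi u * (fun _ => 1) t))
    by (apply sol_lin; [exact Hu | apply is_sol_const]).
  destruct (equilibrium_decay _ (proj1 Hu1)) with (eps := eps) as [t0 [H0 Ht0]]; auto.
  - intros s Hs; assert (A := sol_conserved _ s Hu1 Hs).
    rewrite psi_lin, psi_const in A by (auto using cont_const; apply Hu); lra.
  - exists t0; split; auto; intros t Ht.
    replace (u t - psi u) with (1 * u t + - psi u * 1) by ring; apply Ht0, Ht.
Qed.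

(** * Real and imaginary parts of elements of C([-2,0]) *)

Definition re (f : C20) (x : R) : R := Re (f x).
Definition im (f : C20) (x : R) : R := Im (f x).

Lemma cont_re f : cont (re f).
Proof.
  intros x; apply (continuous_comp (f : R -> C_UniformSpace) (fst : C_UniformSpace -> R_UniformSpace)).
  - apply C20_continuous.
  - apply (continuous_fst (U := R_UniformSpace) (V := R_UniformSpace)).
Qed.

Lemma cont_im f : cont (im f).
Proof.
  intros x; apply (continuous_comp (f : R -> C_UniformSpace) (snd : C_UniformSpace -> R_UniformSpace)).
  - apply C20_continuous.
  - apply (continuous_snd (U := R_UniformSpace) (V := R_UniformSpace)).
Qed.

Global Hint Resolve cont_re cont_im : core.

Lemma C20_ext f g : (forall x, I20 x -> re f x = re g x /\ im f x = im g x) -> f = g.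
Proof.
  intros H; apply C20_eq; intros x Hx; destruct (H x Hx) as [H1 H2].
  unfold re, im in *; destruct (f x), (g x); simpl in *; subst; reflexivity.
Qed.

Lemma continuous_to_C (p q : R -> R) (x : R) : continuous p x -> continuous q x ->
  filterlim (fun y => (p y, q y) : C_UniformSpace) (locally x) (locally (p x, q x)).
Proof.
  intros Hp Hq; apply filterlim_locally; intros eps.
  generalize (filter_and _ _ (proj1 (filterlim_locally p (p x)) Hp eps)
    (proj1 (filterlim_locally q (q x)) Hq eps)).
  apply filter_imp; intros y [H1 H2]; split; [exact H1 | exact H2].
Qed.

Lemma pair_clamp_continuous_on (p q : R -> R) : cont p -> cont q ->
  continuous_on I20 (fun x => (p (clamp x), q (clamp x)) : C_UniformSpace).
Proof.
  intros Hp Hq x _.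
  assert (H := continuous_to_C (fun x => p (clamp x)) (fun x => q (clamp x)) x
    (cont_comp p clamp Hp cont_clamp x) (cont_comp q clamp Hq cont_clamp x)).
  intros P HP; destruct (H P HP) as [d Hd]; exists d; intros y Hy _; apply Hd, Hy.
Qed.

(** Composition with [clamp] yields the representative that is constant on each side of [-2,0]. *)
Definition mkC (p q : R -> R) (Hp : cont p) (Hq : cont q) : C20.
Proof.
  refine (mkC20 (fun x => (p (clamp x), q (clamp x))) _ _).
  - apply pair_clamp_continuous_on; assumption.
  - intros x; rewrite (clamp_id (clamp x)); [reflexivity | apply clamp_in].
Defined.

Lemma re_mkC p q Hp Hq x : I20 x -> re (mkC p q Hp Hq) x = p x.
Proof. intros Hx; unfold re; simpl; rewrite clamp_id; auto. Qed.

Lemma im_mkC p q Hp Hq x : I20 x -> im (mkC p q Hp Hq) x = q x.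
Proof. intros Hx; unfold im; simpl; rewrite clamp_id; auto. Qed.

Lemma re_C20_plus f g x : re (plus f g) x = re f x + re g x.
Proof. reflexivity. Qed.

Lemma im_C20_plus f g x : im (plus f g) x = im f x + im g x.
Proof. reflexivity. Qed.

Lemma re_C20_scal (c : C) f x : re (scal c f) x = Re c * re f x - Im c * im f x.
Proof. reflexivity. Qed.

Lemma im_C20_scal (c : C) f x : im (scal c f) x = Re c * im f x + Im c * re f x.
Proof. reflexivity. Qed.

Lemma re_C20_minus f g x : re (minus f g) x = re f x - re g x.
Proof. change (re f x + (-1 * re g x - 0 * im g x) = re f x - re g x); ring. Qed.

Lemma im_C20_minus f g x : im (minus f g) x = im f x - im g x.
Proof. change (im f x + (-1 * im g x + 0 * re g x) = im f x - im g x); ring. Qed.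

Lemma re_C20_zero x : re zero x = 0.
Proof. reflexivity. Qed.

Lemma im_C20_zero x : im zero x = 0.
Proof. reflexivity. Qed.

Lemma norm_re f x : I20 x -> Rabs (re f x) <= C20_norm f.
Proof.
  intros Hx; apply Rle_trans with (Cmod (f x)); [| apply C20_norm_ge, Hx].
  eapply Rle_trans; [apply Rmax_l | apply Rmax_Cmod].
Qed.

Lemma norm_im f x : I20 x -> Rabs (im f x) <= C20_norm f.
Proof.
  intros Hx; apply Rle_trans with (Cmod (f x)); [| apply C20_norm_ge, Hx].
  eapply Rle_trans; [apply Rmax_r | apply Rmax_Cmod].
Qed.

Lemma Cmod_le_sum (z : C) : Cmod z <= Rabs (Re z) + Rabs (Im z).
Proof.
  destruct z as [a b]; simpl.
  replace (a, b) with (RtoC a + RtoC b * Ci)%C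
    by (unfold Ci, RtoC, Cplus, Cmult; simpl; f_equal; ring).
  eapply Rle_trans; [apply Cmod_triangle |].
  rewrite Cmod_mult, !Cmod_R; unfold Cmod, Ci; simpl.
  replace (0 * (0 * 1) + 1 * (1 * 1)) with 1 by ring; rewrite sqrt_1; lra.
Qed.

Lemma norm_le_sum f a b :
  (forall x, I20 x -> Rabs (re f x) <= a) -> (forall x, I20 x -> Rabs (im f x) <= b) ->
  C20_norm f <= a + b.
Proof.
  intros Ha Hb; apply C20_norm_le; intros x Hx.
  eapply Rle_trans; [apply Cmod_le_sum |]; apply Rplus_le_compat; [apply Ha | apply Hb]; auto.
Qed.

Lemma C20_norm_ge0 f : 0 <= C20_norm f.
Proof.
  apply Rle_trans with (2 := norm_re f 0 ltac:(unfold I20; lra)), Rabs_pos.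
Qed.

(** * The operator in terms of primitives *)

(** Integral form of p' = q on [-2,0]; for continuous p and q it amounts to differentiability
    relative to [-2,0] ([der_near], [near_der]). *)
Definition der (p q : R -> R) : Prop := forall x, I20 x -> p x = p 0 + prim q x.

Lemma prim_near q x eps : cont q -> 0 < eps -> exists d, 0 < d /\
  forall y, Rabs (y - x) < d -> Rabs (prim q y - prim q x - (y - x) * q x) <= eps * Rabs (y - x).
Proof.
  intros Hq He; destruct (proj2 (prim_derive q x Hq) x (fun P HP => HP) (mkposreal eps He)) as [d Hd].
  exists d; split; [apply cond_pos |]; exact Hd.
Qed.

Definition near_deriv (p : R -> R) (l x : R) : Prop :=
  forall eps, 0 < eps -> exists d, 0 < d /\ forall y, I20 y -> Rabs (y - x) < d ->
    Rabs (p y - p x - (y - x) * l) <= eps * Rabs (y - x).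

Lemma der_near p q : cont q -> der p q -> forall x, I20 x -> near_deriv p (q x) x.
Proof.
  intros Hq H x Hx eps He; destruct (prim_near q x eps Hq He) as [d [Hd Hd']].
  exists d; split; auto; intros y Hy Hyx.
  rewrite (H y Hy), (H x Hx).
  replace (p 0 + prim q y - (p 0 + prim q x) - (y - x) * q x)
    with (prim q y - prim q x - (y - x) * q x) by ring; auto.
Qed.

(** The difference of p and the primitive of q has right derivative zero. Right derivatives have to
    suffice, as the generator is a limit for h > 0 only. *)
Lemma right_deriv_der p q : cont p -> cont q ->
  (forall x, -2 <= x < 0 -> forall eps, 0 < eps -> exists d, 0 < d /\
     forall y, x < y < x + d -> y <= 0 -> Rabs (p y - p x - (y - x) * q x) <= eps * (y - x)) ->
  der p q.
Proof.
  intros Hp Hq H x [Hx1 Hx2].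
  assert (Hr : cont (fun s => p s - prim q s)) by (apply cont_minus; auto using cont_prim).
  enough (p 0 - prim q 0 = p x - prim q x) by (rewrite prim_0 in *; lra).
  apply (zero_right_derivative (fun s => p s - prim q s) x 0); auto.
  - intros s Hs eps He.
    destruct (proj1 (cont_eps _ s) (Hr s) eps He) as [d [Hd Hd']].
    exists d; split; auto; intros y Hy Hsy.
    rewrite Rabs_minus_sym; apply Rlt_le, Hd', Rabs_def1; lra.
  - intros s Hs eps He.
    destruct (H s ltac:(lra) (eps / 2) ltac:(lra)) as [d [Hd Hd']].
    destruct (prim_near q s (eps / 2) Hq ltac:(lra)) as [d' [He1 He2]].
    exists (Rmin d d'); split; [apply Rmin_pos; auto |]; intros y Hy Hyb.
    assert (A1 := Rmin_l d d'); assert (A2 := Rmin_r d d').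
    specialize (Hd' y ltac:(lra) Hyb).
    assert (E : Rabs (y - s) = y - s) by (apply Rabs_pos_eq; lra).
    specialize (He2 y); rewrite E in He2; specialize (He2 ltac:(lra)).
    apply Rabs_le_between in Hd'; apply Rabs_le_between in He2; apply Rabs_le_between; lra.
Qed.

Lemma near_der p q : cont p -> cont q -> (forall x, I20 x -> near_deriv p (q x) x) -> der p q.
Proof.
  intros Hp Hq H; apply right_deriv_der; auto; intros x Hx eps He.
  destruct (H x ltac:(unfold I20; lra) eps He) as [d [Hd Hd']].
  exists d; split; auto; intros y Hy Hyb.
  rewrite <- (Rabs_pos_eq (y - x)) at 2 by lra.
  apply Hd'; [unfold I20; lra | rewrite Rabs_pos_eq; lra].
Qed.

Lemma C_R_norm (z : C) : norm (V := C_R_NormedModule) z = Cmod z.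
Proof.
  destruct z as [a b].
  change (sqrt (Rabs a ^ 2 + Rabs b ^ 2) = sqrt (a ^ 2 + b ^ 2)).
  rewrite !pow2_abs; reflexivity.
Qed.

Lemma has_derivative_iff f g :
  has_derivative f g <-> der (re f) (re g) /\ der (im f) (im g).
Proof.
  split.
  - intros H.
    assert (HN : forall x, I20 x -> near_deriv (re f) (re g x) x /\ near_deriv (im f) (im g x) x).
    { intros x Hx; destruct (H x Hx) as [_ Hd]; specialize (Hd x).
      (* [filterdiff] asks for the expansion at every limit of the filter; x is one, and the
         converse direction must show that it is the only one. *)
      assert (Hl : is_filter_lim (within I20 (locally x)) x).
      { intros P [d HP]; exists d; intros y Hy _; apply HP, Hy. }
      specialize (Hd Hl).
      split; intros eps He; destruct (Hd (mkposreal eps He)) as [d Hd'];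
        (exists d; split; [apply cond_pos |]); intros y Hy Hyx;
        specialize (Hd' y Hyx Hy); rewrite C_R_norm in Hd';
        (eapply Rle_trans; [| exact Hd']).
      + eapply Rle_trans; [| eapply Rle_trans; [apply Rmax_l | apply Rmax_Cmod]].
        right; f_equal.
      + eapply Rle_trans; [| eapply Rle_trans; [apply Rmax_r | apply Rmax_Cmod]].
        right; f_equal. }
    split; apply near_der; auto; intros x Hx; apply HN, Hx.
  - intros [H1 H2] x Hx; split.
    + apply (is_linear_scal_l (K := R_AbsRing) (V := C_R_NormedModule)).
    + intros x0 Hx0.
      assert (x0 = x) as ->.
      { apply NNPP; intros HN.
        destruct (Hx0 (fun y => Rabs (y - x0) < Rabs (x - x0))) as [d Hd].
        - exists (mkposreal (Rabs (x - x0)) (Rabs_pos_lt _ (Rminus_eq_contra _ _ (not_eq_sym HN)))); intros y Hy; exact Hy.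
        - specialize (Hd x (ball_center x d) Hx); lra. }
      intros [eps He]; simpl.
      destruct (der_near _ _ (cont_re g) H1 x Hx (eps / 2) ltac:(lra)) as [d1 [P1 Q1]].
      destruct (der_near _ _ (cont_im g) H2 x Hx (eps / 2) ltac:(lra)) as [d2 [P2 Q2]].
      exists (mkposreal (Rmin d1 d2) (Rmin_pos _ _ P1 P2)); intros y Hy Hyi.
      rewrite C_R_norm.
      assert (A : Rabs (y - x) < Rmin d1 d2) by exact Hy.
      specialize (Q1 y Hyi (Rlt_le_trans _ _ _ A (Rmin_l d1 d2))).
      specialize (Q2 y Hyi (Rlt_le_trans _ _ _ A (Rmin_r d1 d2))).
      eapply Rle_trans; [apply Cmod_le_sum |].
      change (norm (minus y x)) with (Rabs (y - x)).
      replace (eps * Rabs (y - x)) with (eps / 2 * Rabs (y - x) + eps / 2 * Rabs (y - x)) by field.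
      apply Rplus_le_compat; [exact Q1 | exact Q2].
Qed.

Lemma integral_re_im f a b :
  integral f a b = (prim (re f) b - prim (re f) a, prim (im f) b - prim (im f) a).
Proof.
  unfold integral; apply (is_RInt_unique (V := C_R_CompleteNormedModule)).
  rewrite <- (RInt_prim (re f)), <- (RInt_prim (im f)) by auto.
  apply (is_RInt_fct_extend_pair (U := R_NormedModule) (V := R_NormedModule));
    apply (RInt_correct (V := R_CompleteNormedModule)), cont_ex_RInt; [apply cont_re | apply cont_im].
Qed.

Definition dom_eq (p q : R -> R) : Prop := der p q /\ q 0 = lag p 0.

Lemma opA_iff f g : opA f g <-> dom_eq (re f) (re g) /\ dom_eq (im f) (im g).
Proof.
  unfold opA, dom_eq; rewrite has_derivative_iff, !integral_re_im.
  set (A := (prim (re f) (-1) - prim (re f) (-2))%R); set (B := (prim (im f) (-1) - prim (im f) (-2))%R).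
  set (A' := (prim (re f) 0 - prim (re f) (-1))%R); set (B' := (prim (im f) 0 - prim (im f) (-1))%R).
  assert (E : g 0 = Cminus (A, B) (A', B') <-> re g 0 = lag (re f) 0 /\ im g 0 = lag (im f) 0).
  { unfold A, B, A', B', lag; change (re g 0) with (Re (g 0)); change (im g 0) with (Im (g 0)); rewrite !prim_0.
    replace (0 - 1) with (-1) by ring; replace (0 - 2) with (-2) by ring.
    split.
    - intros ->; simpl; split; ring.
    - intros [E1 E2]; destruct (g 0) as [a b]; simpl in *; subst a b.
      unfold Cminus, Cplus, Copp; simpl; f_equal; ring. }
  rewrite E; tauto.
Qed.

Lemma dom_eq_ext p q p' q' : (forall x, I20 x -> p' x = p x) -> (forall x, I20 x -> q' x = q x) ->
  dom_eq p q -> dom_eq p' q'.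
Proof.
  intros Hp Hq [Hd Hb]; assert (H0 : I20 0) by (unfold I20; lra); split.
  - intros x Hx; rewrite !Hp, (Hd x) by assumption.
    f_equal; symmetry; apply (prim_ext_neg _ _ (-2)); [exact Hq | exact Hx].
  - rewrite Hq, Hb by exact H0; unfold lag.
    rewrite !(prim_ext_neg p' p (-2)); auto; lra.
Qed.

Lemma opA_mkC p1 p2 q1 q2 Cp1 Cp2 Cq1 Cq2 : dom_eq p1 q1 -> dom_eq p2 q2 ->
  opA (mkC p1 p2 Cp1 Cp2) (mkC q1 q2 Cq1 Cq2).
Proof.
  intros H1 H2; apply opA_iff; split.
  - apply (dom_eq_ext p1 q1); auto using re_mkC.
  - apply (dom_eq_ext p2 q2); auto using im_mkC.
Qed.

Lemma filterlim_right_norm {E : NormedModule C_AbsRing} (u : R -> E) (g : E) :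
  filterlim u (at_right 0) (locally g) <->
  forall eps, 0 < eps -> exists d, 0 < d /\
    forall h, 0 < h < d -> norm (minus (u h) g) < eps.
Proof.
  rewrite (filterlim_locally_ball_norm (K := C_AbsRing) (U := E)); split.
  - intros H eps He; destruct (H (mkposreal eps He)) as [d Hd].
    exists d; split; [apply cond_pos |]; intros h Hh; apply Hd; [| apply Hh].
    change (Rabs (h - 0) < d); rewrite Rminus_0_r, Rabs_pos_eq; lra.
  - intros H eps; destruct (H eps (cond_pos eps)) as [d [Hd Hd']].
    exists (mkposreal d Hd); intros h Hh Hh0; apply Hd'; split; auto.
    change (Rabs (h - 0) < d) in Hh; rewrite Rminus_0_r in Hh.
    apply Rle_lt_trans with (1 := Rle_abs h), Hh.
Qed.

(** * The delay semigroup *)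

Definition delay_flow (p : R -> R) (Hp : cont p) : R -> R :=
  proj1_sig (constructive_indefinite_description _ (sol_exists p Hp)).

Lemma delay_flow_sol p Hp : is_sol (delay_flow p Hp).
Proof. exact (proj1 (proj2_sig (constructive_indefinite_description _ (sol_exists p Hp)))). Qed.

Lemma delay_flow_init p Hp t : t <= 0 -> delay_flow p Hp t = p t.
Proof. exact (proj2 (proj2_sig (constructive_indefinite_description _ (sol_exists p Hp))) t). Qed.

Lemma delay_flow_cont p Hp : cont (delay_flow p Hp).
Proof. apply delay_flow_sol. Qed.

Lemma delay_flow_unique p Hp u t : is_sol u -> (forall x, I20 x -> u x = p x) -> -2 <= t ->
  delay_flow p Hp t = u t.
Proof.
  intros Hu H Ht; apply sol_unique; auto using delay_flow_sol.
  intros s Hs; rewrite delay_flow_init, H by (unfold I20; lra); reflexivity.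
Qed.

Lemma delay_flow_bound p Hp m n t : (forall x, I20 x -> Rabs (p x) <= m) ->
  -2 <= t <= INR n / 4 -> Rabs (delay_flow p Hp t) <= 2 ^ n * m.
Proof.
  intros H Ht; apply sol_bound; auto using delay_flow_sol.
  intros s Hs; rewrite delay_flow_init by lra; apply H; unfold I20; lra.
Qed.

(** The segment over [t-2,t] of the solution that starts from f. *)
Definition flow (t : R) (f : C20) : C20 :=
  mkC (fun x => delay_flow (re f) (cont_re f) (x + t)) (fun x => delay_flow (im f) (cont_im f) (x + t))
    (cont_shift _ t (delay_flow_cont _ _)) (cont_shift _ t (delay_flow_cont _ _)).

Lemma re_flow t f x : I20 x -> re (flow t f) x = delay_flow (re f) (cont_re f) (x + t).
Proof. intros Hx; unfold flow; rewrite re_mkC; auto. Qed.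

Lemma im_flow t f x : I20 x -> im (flow t f) x = delay_flow (im f) (cont_im f) (x + t).
Proof. intros Hx; unfold flow; rewrite im_mkC; auto. Qed.

(** The combination r is given only pointwise on [-2,0], with p and q unrelated; taking them as real
    and imaginary part covers complex scalars. *)
Lemma delay_flow_lin p Hp q Hq r Hr c d t : (forall x, I20 x -> r x = c * p x + d * q x) ->
  -2 <= t -> delay_flow r Hr t = c * delay_flow p Hp t + d * delay_flow q Hq t.
Proof.
  intros H Ht.
  apply (delay_flow_unique r Hr (fun t => c * delay_flow p Hp t + d * delay_flow q Hq t)).
  - apply sol_lin; apply delay_flow_sol.
  - intros x Hx; rewrite !delay_flow_init by apply Hx; symmetry; apply H, Hx.
  - exact Ht.
Qed.

Lemma I20_shift x t : I20 x -> 0 <= t -> -2 <= x + t.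
Proof. unfold I20; lra. Qed.

Lemma flow_linear t : 0 <= t -> is_linear (flow t).
Proof.
  intros Ht; split.
  - intros f g; apply C20_ext; intros x Hx.
    rewrite re_C20_plus, im_C20_plus, !re_flow, !im_flow by exact Hx.
    assert (A := I20_shift x t Hx Ht); split.
    + rewrite (delay_flow_lin (re f) (cont_re f) (re g) (cont_re g) _ _ 1 1); auto; [ring |].
      intros; rewrite re_C20_plus; ring.
    + rewrite (delay_flow_lin (im f) (cont_im f) (im g) (cont_im g) _ _ 1 1); auto; [ring |].
      intros; rewrite im_C20_plus; ring.
  - intros k f; apply C20_ext; intros x Hx.
    rewrite re_C20_scal, im_C20_scal, !re_flow, !im_flow by exact Hx.
    assert (A := I20_shift x t Hx Ht); split.
    + rewrite (delay_flow_lin (re f) (cont_re f) (im f) (cont_im f) _ _ (Re k) (- Im k)); auto; [ring |].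
      intros; rewrite re_C20_scal; ring.
    + rewrite (delay_flow_lin (im f) (cont_im f) (re f) (cont_re f) _ _ (Re k) (Im k));
        [ring | intros; apply im_C20_scal | exact A].
  - destruct (INR_quarter_ge t) as [n Hn].
    exists (2 ^ n + 2 ^ n); split; [assert (H := pow_lt 2 n); lra |]; intros f.
    rewrite Rmult_plus_distr_r; apply norm_le_sum; intros x Hx.
    + rewrite re_flow by exact Hx; apply delay_flow_bound.
      * intros; apply norm_re; auto.
      * unfold I20 in Hx; lra.
    + rewrite im_flow by exact Hx; apply delay_flow_bound.
      * intros; apply norm_im; auto.
      * unfold I20 in Hx; lra.
Qed.

Lemma flow_0 f : flow 0 f = f.
Proof.
  apply C20_ext; intros x Hx; rewrite re_flow, im_flow, Rplus_0_r by exact Hx.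
  split; apply delay_flow_init, Hx.
Qed.

Lemma flow_add s t f : 0 <= s -> 0 <= t -> flow (s + t) f = flow s (flow t f).
Proof.
  intros Hs Ht; apply C20_ext; intros x Hx.
  rewrite !re_flow, !im_flow by exact Hx.
  replace (x + (s + t)) with (x + s + t) by ring.
  assert (A := I20_shift x s Hx Hs); split; symmetry.
  - apply (delay_flow_unique _ _ (fun r => delay_flow (re f) (cont_re f) (r + t))); auto.
    + apply sol_shift; auto using delay_flow_sol.
    + intros y Hy; rewrite re_flow; auto.
  - apply (delay_flow_unique _ _ (fun r => delay_flow (im f) (cont_im f) (r + t))); auto.
    + apply sol_shift; auto using delay_flow_sol.
    + intros y Hy; rewrite im_flow; auto.
Qed.

Lemma delay_flow_right_cont p Hp eps : 0 < eps -> exists d, 0 < d /\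
  forall h, 0 < h < d -> forall x, I20 x -> Rabs (delay_flow p Hp (x + h) - p x) <= eps.
Proof.
  intros He.
  destruct (cont_unif (delay_flow p Hp) (-2) 1 eps (delay_flow_cont _ _) He) as [d [Hd Hd']].
  exists (Rmin d 1); split; [apply Rmin_pos; lra |]; intros h Hh x Hx.
  assert (A := Rmin_l d 1); assert (B := Rmin_r d 1); unfold I20 in Hx.
  rewrite <- (delay_flow_init p Hp x) by lra.
  apply Rlt_le, Hd'; try lra.
  replace (x + h - x) with h by ring; rewrite Rabs_pos_eq; lra.
Qed.

Lemma flow_C0 : C0_semigroup flow.
Proof.
  repeat split; auto using flow_0, flow_add; try (apply flow_linear; assumption).
  intros f; apply filterlim_right_norm; intros eps He.
  destruct (delay_flow_right_cont (re f) (cont_re f) (eps / 3)) as [d1 [P1 Q1]]; [lra |].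
  destruct (delay_flow_right_cont (im f) (cont_im f) (eps / 3)) as [d2 [P2 Q2]]; [lra |].
  exists (Rmin d1 d2); split; [apply Rmin_pos; auto |]; intros h Hh.
  assert (A := Rmin_l d1 d2); assert (B := Rmin_r d1 d2).
  apply Rle_lt_trans with (eps / 3 + eps / 3); [| lra].
  apply norm_le_sum; intros x Hx.
  - rewrite re_C20_minus, re_flow by exact Hx; apply Q1; auto; lra.
  - rewrite im_C20_minus, im_flow by exact Hx; apply Q2; auto; lra.
Qed.

(** * Its generator *)

Definition unif_right_deriv (u q : R -> R) : Prop :=
  forall eps, 0 < eps -> exists d, 0 < d /\
    forall h, 0 < h < d -> forall x, I20 x -> Rabs (/ h * (u (x + h) - u x) - q x) <= eps.

Lemma quotient_bound h a b eps : 0 < h ->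
  Rabs (/ h * a - b) <= eps <-> Rabs (a - h * b) <= eps * h.
Proof.
  intros Hh; replace (a - h * b) with ((/ h * a - b) * h) by (field; lra).
  rewrite Rabs_mult, (Rabs_pos_eq h) by lra; split; intros H.
  - apply Rmult_le_compat_r; lra.
  - apply Rmult_le_reg_r with h; auto.
Qed.

(** The derivative of u is q before time 0 and [lag u] afterwards; the boundary condition in
    [dom_eq] says precisely that the two pieces match at 0. *)
Lemma sol_C1 u p q : is_sol u -> cont q -> (forall x, I20 x -> u x = p x) ->
  dom_eq p q -> exists v, cont v /\ (forall x, I20 x -> v x = q x) /\
  forall t, -2 <= t -> u t = u 0 + prim v t.
Proof.
  intros [Hu Su] Hq Hup [Hd Hb].
  exists (fun s => q (Rmin s 0) - q 0 + lag u (Rmax s 0)).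
  assert (E : lag u 0 = q 0).
  { rewrite Hb; unfold lag; rewrite !(prim_ext_neg u p (-2)); auto; lra. }
  assert (Hv : cont (fun s => q (Rmin s 0) - q 0 + lag u (Rmax s 0))).
  { apply cont_plus; [apply cont_minus; [| apply cont_const] |].
    - apply (cont_comp q); auto using cont_Rmin.
    - apply (cont_comp (lag u)); auto using cont_Rmax, cont_lag. }
  assert (Hneg : forall s, s <= 0 -> q (Rmin s 0) - q 0 + lag u (Rmax s 0) = q s).
  { intros s Hs; rewrite Rmin_left, Rmax_right, E by lra; ring. }
  split; [exact Hv | split].
  - intros x [_ Hx]; apply Hneg, Hx.
  - intros t Ht; destruct (Rle_dec t 0) as [H0 | H0].
    + rewrite (prim_ext_neg _ q (-2)) by (try lra; intros; apply Hneg; lra).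
      rewrite !Hup by (unfold I20; lra); apply Hd; unfold I20; lra.
    + rewrite (prim_ext_ge _ (lag u)); [apply Su; lra | | lra].
      intros s Hs; rewrite Rmin_right, Rmax_left by lra; ring.
Qed.

Lemma dom_eq_unif u p q : is_sol u -> cont p -> cont q -> (forall x, I20 x -> u x = p x) ->
  dom_eq p q <-> unif_right_deriv u q.
Proof.
  intros Hsol Hp Hq Hup; split.
  - intros H eps He.
    destruct (sol_C1 u p q Hsol Hq Hup H) as [v [Hv [Hvq Huv]]].
    destruct (cont_unif v (-2) 1 eps Hv He) as [d [Hd Hd']].
    exists (Rmin d 1); split; [apply Rmin_pos; lra |]; intros h Hh x Hx.
    assert (A := Rmin_l d 1); assert (B := Rmin_r d 1).
    apply quotient_bound; [lra |].
    rewrite <- Hvq by exact Hx; unfold I20 in Hx.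
    rewrite (Huv (x + h)), (Huv x) by lra.
    (* The linear term is moved under the integral: v - v x is integrated over [x,x+h], inside
       [-2,1], where v is uniformly continuous. *)
    assert (C1 : Rabs (prim (fun s => 1 * v s + - v x * (fun _ => 1) s) (x + h) -
      prim (fun s => 1 * v s + - v x * (fun _ => 1) s) x) <= (x + h - x) * eps).
    { apply prim_abs_le; [apply cont_lin; auto using cont_const | lra |].
      intros s Hs; replace (1 * v s + - v x * 1) with (v s - v x) by ring.
      apply Rlt_le, Hd'; try lra; rewrite Rabs_pos_eq; lra. }
    rewrite !prim_lin, !prim_const in C1 by (auto using cont_const).
    replace (u 0 + prim v (x + h) - (u 0 + prim v x) - h * v x)
      with (1 * prim v (x + h) + - v x * (1 * (x + h)) - (1 * prim v x + - v x * (1 * x))) by ring.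
    replace (eps * h) with ((x + h - x) * eps) by ring; exact C1.
  - intros H; split.
    + apply right_deriv_der; auto; intros x Hx eps He.
      destruct (H eps He) as [d [Hd Hd']]; exists d; split; auto; intros y Hy Hy0.
      assert (Hh : 0 < y - x < d) by lra.
      specialize (Hd' _ Hh x ltac:(unfold I20; lra)).
      apply quotient_bound in Hd'; [| lra].
      replace (x + (y - x)) with y in Hd' by ring.
      rewrite !Hup in Hd' by (unfold I20; lra); exact Hd'.
    (* At x = 0 the quotient tends to q 0 by assumption and to [lag u 0] by the equation; their
       equality is the boundary condition. *)
    + assert (E : lag u 0 = lag p 0).
      { unfold lag; rewrite !(prim_ext_neg u p (-2)); auto; lra. }
      destruct Hsol as [Hu Su].
      apply cond_eq; intros eps He.
      destruct (H (eps / 3) ltac:(lra)) as [d1 [P1 Q1]].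
      destruct (prim_near (lag u) 0 (eps / 3) (cont_lag u Hu) ltac:(lra)) as [d2 [P2 Q2]].
      set (h := Rmin d1 d2 / 2).
      assert (A := Rmin_l d1 d2); assert (B := Rmin_r d1 d2).
      assert (C1 := Rmin_pos _ _ P1 P2).
      specialize (Q1 h ltac:(unfold h; lra) 0 ltac:(unfold I20; lra)).
      assert (Hh : 0 < h) by (unfold h; lra).
      specialize (Q2 h); rewrite !Rminus_0_r, Rabs_pos_eq, prim_0 in Q2 by lra.
      specialize (Q2 ltac:(unfold h; lra)); rewrite Rminus_0_r, E in Q2.
      rewrite Rplus_0_l, (Su h) in Q1 by lra.
      replace (u 0 + prim (lag u) h - u 0) with (prim (lag u) h) in Q1 by ring.
      apply quotient_bound in Q2; [| lra].
      apply Rabs_le_between in Q1; apply Rabs_le_between in Q2; apply Rabs_def1; lra.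
Qed.

Lemma re_quotient h f x : I20 x ->
  re (scal (RtoC (/ h)) (minus (flow h f) f)) x =
  / h * (delay_flow (re f) (cont_re f) (x + h) - delay_flow (re f) (cont_re f) x).
Proof.
  intros Hx; rewrite re_C20_scal, re_C20_minus, re_flow, (delay_flow_init _ _ x) by apply Hx.
  simpl; ring.
Qed.

Lemma im_quotient h f x : I20 x ->
  im (scal (RtoC (/ h)) (minus (flow h f) f)) x =
  / h * (delay_flow (im f) (cont_im f) (x + h) - delay_flow (im f) (cont_im f) x).
Proof.
  intros Hx; rewrite im_C20_scal, im_C20_minus, im_flow, (delay_flow_init _ _ x) by apply Hx.
  simpl; ring.
Qed.

Lemma flow_generator : is_generator opA flow.
Proof.
  intros f g; rewrite opA_iff.
  eapply iff_trans; [| symmetry; apply (filterlim_right_norm (E := C20_NormedModule))].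
  rewrite (dom_eq_unif (delay_flow (re f) (cont_re f)) (re f) (re g))
    by (auto using delay_flow_sol; intros; apply delay_flow_init; apply H).
  rewrite (dom_eq_unif (delay_flow (im f) (cont_im f)) (im f) (im g))
    by (auto using delay_flow_sol; intros; apply delay_flow_init; apply H).
  split.
  - intros [H1 H2] eps He.
    destruct (H1 (eps / 3) ltac:(lra)) as [d1 [P1 Q1]].
    destruct (H2 (eps / 3) ltac:(lra)) as [d2 [P2 Q2]].
    exists (Rmin d1 d2); split; [apply Rmin_pos; auto |]; intros h Hh.
    assert (A := Rmin_l d1 d2); assert (B := Rmin_r d1 d2).
    apply Rle_lt_trans with (eps / 3 + eps / 3); [| lra].
    apply norm_le_sum; intros x Hx.
    + rewrite re_C20_minus, re_quotient by exact Hx; apply Q1; auto; lra.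
    + rewrite im_C20_minus, im_quotient by exact Hx; apply Q2; auto; lra.
  - intros H; split; intros eps He; destruct (H eps He) as [d [Hd Hd']];
      exists d; split; auto; intros h Hh x Hx; specialize (Hd' h Hh);
      (eapply Rle_trans; [| apply Rlt_le, Hd']).
    + rewrite <- re_quotient, <- re_C20_minus by exact Hx; apply norm_re, Hx.
    + rewrite <- im_quotient, <- im_C20_minus by exact Hx; apply norm_im, Hx.
Qed.

(** * Uniform boundedness on C([-2,0]) *)

Ltac vec := apply C20_eq; intros; simpl; ring.

Lemma C20_norm_sym f g : C20_norm (minus f g) = C20_norm (minus g f).
Proof.
  assert (H : forall f g, C20_norm (minus f g) <= C20_norm (minus g f)).
  { intros u v; replace (minus u v) with (C20_scal (RtoC (-1)) (minus v u)) by vec.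
    eapply Rle_trans; [apply C20_norm_scal |].
    rewrite Cmod_R, Rabs_left by lra; right; ring. }
  apply Rle_antisym; apply H.
Qed.

Lemma C20_dist_triangle f g h :
  C20_norm (minus f h) <= C20_norm (minus f g) + C20_norm (minus g h).
Proof.
  replace (minus f h) with (C20_plus (minus f g) (minus g h)) by vec.
  apply C20_norm_triangle.
Qed.

Lemma C20_norm_le_dist f g : C20_norm f <= C20_norm (minus f g) + C20_norm g.
Proof.
  replace f with (C20_plus (minus f g) g) at 1 by vec.
  apply C20_norm_triangle.
Qed.

Lemma C20_dist_0 f g : C20_norm (minus f g) <= 0 -> f = g.
Proof.
  intros H; assert (E : minus f g = C20_zero).
  { apply C20_norm_eq0, Rle_antisym; [exact H | apply C20_norm_ge0]. }
  replace f with (C20_plus (minus f g) g) by vec; rewrite E; vec.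
Qed.

Lemma linear_minus {E : NormedModule C_AbsRing} (T : E -> E) f g :
  is_linear T -> T (minus f g) = minus (T f) (T g).
Proof. intros HT; unfold minus; rewrite (linear_plus T HT), (linear_opp T g HT); reflexivity. Qed.

Lemma C20_linear_minus (T : C20 -> C20) (f g : C20) :
  is_linear T -> T (minus f g) = minus (T f) (T g).
Proof. exact (linear_minus (E := C20_NormedModule) T f g). Qed.

Lemma C20_linear_plus (T : C20 -> C20) (f g : C20) :
  is_linear T -> T (plus f g) = plus (T f) (T g).
Proof. intros HT; exact (linear_plus T HT f g). Qed.

Lemma C20_linear_scal (T : C20 -> C20) (c : C) (f : C20) :
  is_linear T -> T (scal c f) = scal c (T f).
Proof. intros HT; exact (linear_scal T HT c f). Qed.

Definition bounded_by (T : C20 -> C20) (M : R) : Prop :=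
  forall f, C20_norm (T f) <= M * C20_norm f.

Lemma bounded_by_le T M N : bounded_by T M -> M <= N -> bounded_by T N.
Proof.
  intros H HMN f; eapply Rle_trans; [apply H |].
  apply Rmult_le_compat_r; [apply C20_norm_ge0 | exact HMN].
Qed.

Lemma is_linear_bounded T : is_linear T -> exists M, 0 < M /\ bounded_by T M.
Proof. intros [_ _ H]; exact H. Qed.

Lemma lim_seq_0_eps r eps : is_lim_seq r 0 -> 0 < eps ->
  exists N, forall n, (N <= n)%nat -> Rabs (r n) < eps.
Proof.
  intros Hr He; apply is_lim_seq_spec in Hr; destruct (Hr (mkposreal eps He)) as [N HN].
  exists N; intros n Hn; specialize (HN n Hn); simpl in HN; rewrite Rminus_0_r in HN; exact HN.
Qed.

Lemma cauchy_limit_rate (a r : nat -> R) : is_lim_seq r 0 ->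
  (forall n m, (n <= m)%nat -> Rabs (a m - a n) <= r n) ->
  exists l, forall n, Rabs (a n - l) <= r n.
Proof.
  intros Hr Ha.
  destruct (proj2 (ex_lim_seq_cauchy_corr a)) as [l Hl].
  - intros eps.
    destruct (lim_seq_0_eps r (eps / 2) Hr (is_pos_div_2 eps)) as [N HN].
    exists N; intros n m Hn Hm.
    assert (A := Ha N n Hn); assert (B := Ha N m Hm).
    specialize (HN N (le_n N)).
    apply Rabs_le_between in A; apply Rabs_le_between in B; apply Rabs_def2 in HN.
    apply Rabs_def1; lra.
  - exists l; intros n.
    apply (is_lim_seq_le_loc (fun m => Rabs (a n - a m)) (fun _ => r n)
             (Rabs (a n - l)) (r n)).
    + exists n; intros m Hm; rewrite Rabs_minus_sym; auto.
    + apply (is_lim_seq_abs _ (a n - l)), is_lim_seq_minus'; [apply is_lim_seq_const | exact Hl].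
    + apply is_lim_seq_const.
Qed.

Lemma uniform_limit_cont (p : nat -> R -> R) (q : R -> R) r : is_lim_seq r 0 ->
  (forall n, cont (p n)) -> (forall n x, Rabs (p n x - q x) <= r n) -> cont q.
Proof.
  intros Hr Hp H x; apply cont_eps; intros eps He.
  destruct (lim_seq_0_eps r (eps / 3) Hr ltac:(lra)) as [N HN].
  specialize (HN N (le_n N)); apply Rabs_def2 in HN.
  destruct (proj1 (cont_eps (p N) x) (Hp N x) (eps / 3) ltac:(lra)) as [d [Hd Hd']].
  exists d; split; auto; intros y Hy; specialize (Hd' y Hy).
  assert (A := H N x); assert (B := H N y).
  apply Rabs_le_between in A; apply Rabs_le_between in B; apply Rabs_def2 in Hd'.
  apply Rabs_def1; lra.
Qed.

(** Real and imaginary parts converge uniformly with rate r, and [norm_le_sum] adds the two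
    rates. *)
Lemma C20_complete (x : nat -> C20) r : is_lim_seq r 0 ->
  (forall n m, (n <= m)%nat -> C20_norm (minus (x m) (x n)) <= r n) ->
  exists l : C20, forall n, C20_norm (minus (x n) l) <= r n + r n.
Proof.
  intros Hr Hx.
  assert (H1 : forall s, exists l, forall n, Rabs (re (x n) (clamp s) - l) <= r n).
  { intros s; apply (cauchy_limit_rate (fun n => re (x n) (clamp s))); auto; intros n m Hnm.
    rewrite <- re_C20_minus; eapply Rle_trans; [apply norm_re, clamp_in | apply Hx, Hnm]. }
  assert (H2 : forall s, exists l, forall n, Rabs (im (x n) (clamp s) - l) <= r n).
  { intros s; apply (cauchy_limit_rate (fun n => im (x n) (clamp s))); auto; intros n m Hnm.
    rewrite <- im_C20_minus; eapply Rle_trans; [apply norm_im, clamp_in | apply Hx, Hnm]. }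
  set (p := fun s => proj1_sig (constructive_indefinite_description _ (H1 s))).
  set (q := fun s => proj1_sig (constructive_indefinite_description _ (H2 s))).
  assert (Hp : forall n s, Rabs (re (x n) (clamp s) - p s) <= r n).
  { intros n s; unfold p; destruct (constructive_indefinite_description _ _); simpl; auto. }
  assert (Hq : forall n s, Rabs (im (x n) (clamp s) - q s) <= r n).
  { intros n s; unfold q; destruct (constructive_indefinite_description _ _); simpl; auto. }
  assert (Cp : cont p).
  { apply (uniform_limit_cont (fun n s => re (x n) (clamp s)) p r); auto.
    intros n; apply (cont_comp (re (x n)) clamp); auto using cont_clamp. }
  assert (Cq : cont q).
  { apply (uniform_limit_cont (fun n s => im (x n) (clamp s)) q r); auto.
    intros n; apply (cont_comp (im (x n)) clamp); auto using cont_clamp. }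
  exists (mkC p q Cp Cq); intros n; apply norm_le_sum; intros s Hs.
  - rewrite re_C20_minus, re_mkC by exact Hs.
    rewrite <- (clamp_id s Hs) at 1; apply Hp.
  - rewrite im_C20_minus, im_mkC by exact Hs.
    rewrite <- (clamp_id s Hs) at 1; apply Hq.
Qed.

(** Stands in for the operator norm: some bound L0 is shrunk by factors 3/4, and the last bound that
    still holds is attained by some v up to the factor 3/4. *)
Lemma almost_norming T M : is_linear T -> 0 < M -> ~ bounded_by T M ->
  exists L v, M < L /\ bounded_by T L /\ 3 / 4 * L * C20_norm v < C20_norm (T v).
Proof.
  intros HT HM HN.
  destruct (is_linear_bounded T HT) as [L0 [HL0 HB]].
  assert (Hj : exists j, ~ bounded_by T ((3 / 4) ^ j * L0)).
  { destruct (pow_lt_1_zero (3 / 4)) with (y := M / L0) as [j Hj].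
    - rewrite Rabs_pos_eq; lra.
    - apply Rdiv_lt_0_compat; auto.
    - exists j; intros H; apply HN, (bounded_by_le T _ M H).
      specialize (Hj j (le_n j)); rewrite Rabs_pos_eq in Hj by (apply pow_le; lra).
      apply Rlt_le, Rlt_le_trans with (M / L0 * L0); [apply Rmult_lt_compat_r; auto |].
      right; field; lra. }
  destruct Hj as [j Hj]; induction j as [| j IH].
  - exfalso; apply Hj; simpl; rewrite Rmult_1_l; exact HB.
  - destruct (classic (bounded_by T ((3 / 4) ^ j * L0))) as [H | H]; [| apply IH, H].
    apply not_all_ex_not in Hj; destruct Hj as [v Hv].
    exists ((3 / 4) ^ j * L0), v; repeat split; auto.
    + apply Rnot_le_lt; intros Hle; apply HN, (bounded_by_le T _ M H Hle).
    + apply Rnot_le_lt in Hv; simpl in Hv; lra.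
Qed.

Lemma norm_scal_ge (c : R) (T : C20 -> C20) v : is_linear T -> 0 < c ->
  C20_norm (scal (RtoC c) v) <= c * C20_norm v /\
  c * C20_norm (T v) <= C20_norm (T (scal (RtoC c) v)).
Proof.
  intros HT Hc; split.
  - eapply Rle_trans; [apply C20_norm_scal |]; rewrite Cmod_R, Rabs_pos_eq by lra; lra.
  - rewrite (linear_scal T HT).
    apply Rmult_le_reg_l with (/ c); [apply Rinv_0_lt_compat, Hc |].
    rewrite <- Rmult_assoc, Rinv_l, Rmult_1_l by lra.
    replace (T v) with (C20_scal (RtoC (/ c)) (scal (RtoC c) (T v))) at 1.
    + eapply Rle_trans; [apply C20_norm_scal |].
      rewrite Cmod_R, Rabs_pos_eq by (apply Rlt_le, Rinv_0_lt_compat, Hc); apply Rle_refl.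
    + apply C20_eq; intros s _; simpl.
      rewrite RtoC_inv by lra; field; intros E; apply RtoC_inj in E; lra.
Qed.

(* Sokal's form of the gliding hump: for every x, one of T (x + v), T (x - v)
   is at least as large as T v. *)
Lemma linear_pm_large (T : C20 -> C20) x v : is_linear T -> C20_norm (T (plus x v)) < C20_norm (T v) ->
  C20_norm (T v) <= C20_norm (T (minus x v)).
Proof.
  intros HT H.
  assert (A : C20_norm (scal (RtoC 2) (T v)) <= C20_norm (T (plus x v)) + C20_norm (T (minus x v))).
  { replace (scal (RtoC 2) (T v)) with (minus (T (plus x v)) (T (minus x v))).
    - replace (C20_norm (T (minus x v))) with (C20_norm (C20_scal (RtoC (-1)) (T (minus x v)))).
      + apply C20_norm_triangle.
      + apply Rle_antisym; [eapply Rle_trans; [apply C20_norm_scal |] |].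
        * rewrite Cmod_R, Rabs_left by lra; lra.
        * replace (T (minus x v)) with (C20_scal (RtoC (-1)) (C20_scal (RtoC (-1)) (T (minus x v)))) at 1
            by vec.
          eapply Rle_trans; [apply C20_norm_scal |]; rewrite Cmod_R, Rabs_left by lra; lra.
    - rewrite (linear_plus T HT), linear_minus by exact HT; vec. }
  assert (B := proj2 (norm_scal_ge 2 (fun f => f) (T v) (is_linear_id (V := C20_NormedModule)) ltac:(lra))).
  simpl in B; lra.
Qed.

(** A gliding hump: x moves by v k or its negative at step k, keeping T (i k) at least as large as
    on v k, that is 3/4 of L k / 8^k. The later steps move x by at most (2/7) / 8^k, so at the limit
    more than a quarter of L k / 8^k survives, which is at least k + 1. *)
Theorem uniform_boundedness {I : Type} (T : I -> C20 -> C20) :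
  (forall i, is_linear (T i)) ->
  (forall f, exists B, forall i, C20_norm (T i f) <= B) ->
  exists M, 0 < M /\ forall i, bounded_by (T i) M.
Proof.
  intros HT HB; apply NNPP; intros HN.
  assert (H : forall k : nat, exists z : I * (R * C20),
    let '(i, (L, v)) := z in
    4 * 8 ^ k * (INR k + 1) < L /\ bounded_by (T i) L /\
    C20_norm v <= / 8 ^ k /\ 3 / 4 * L * / 8 ^ k <= C20_norm (T i v)).
  { intros k; assert (Hk := pos_INR k); assert (H8 : 0 < 8 ^ k) by (apply pow_lt; lra).
    assert (HM : 0 < 4 * 8 ^ k * (INR k + 1)).
    { apply Rmult_lt_0_compat; lra. }
    destruct (not_all_ex_not _ _ (fun H => HN (ex_intro _ _ (conj HM H)))) as [i Hi].
    destruct (almost_norming (T i) _ (HT i) HM Hi) as [L [v [HL [HbL Hv]]]].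
    assert (Hv0 : 0 < C20_norm v).
    { apply Rnot_le_lt; intros H0.
      assert (E : C20_norm v = 0) by (apply Rle_antisym; auto using C20_norm_ge0).
      specialize (HbL v); rewrite E in *; lra. }
    assert (Hc : 0 < / 8 ^ k * / C20_norm v) by (apply Rmult_lt_0_compat; apply Rinv_0_lt_compat; auto).
    (* v is rescaled to norm 8^(-k); it is nonzero because the inequality in [almost_norming] is
       strict. *)
    exists (i, (L, scal (RtoC (/ 8 ^ k * / C20_norm v)) v)).
    destruct (norm_scal_ge _ (T i) v (HT i) Hc) as [N1 N2].
    repeat split; auto.
    - eapply Rle_trans; [apply N1 |]; right; field; lra.
    - eapply Rle_trans; [| apply N2].
      apply Rle_trans with (/ 8 ^ k * / C20_norm v * (3 / 4 * L * C20_norm v)).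
      + right; field; lra.
      + apply Rmult_le_compat_l; lra. }
  set (z := fun k => proj1_sig (constructive_indefinite_description _ (H k))).
  assert (Hz : forall k, let '(i, (L, v)) := z k in
    4 * 8 ^ k * (INR k + 1) < L /\ bounded_by (T i) L /\
    C20_norm v <= / 8 ^ k /\ 3 / 4 * L * / 8 ^ k <= C20_norm (T i v)).
  { intros k; unfold z; destruct (constructive_indefinite_description _ (H k)); auto. }
  set (i := fun k => fst (z k)); set (L := fun k => fst (snd (z k))); set (v := fun k => snd (snd (z k))).
  assert (Hk : forall k, 4 * 8 ^ k * (INR k + 1) < L k /\ bounded_by (T (i k)) (L k) /\
    C20_norm (v k) <= / 8 ^ k /\ 3 / 4 * L k * / 8 ^ k <= C20_norm (T (i k) (v k))).
  { intros k; specialize (Hz k); unfold i, L, v; destruct (z k) as [a [b c]]; exact Hz. }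
  clearbody i L v; clear Hz z H.
  set (x := fix x (n : nat) : C20 := match n with
    | O => zero
    | S k => if Rle_dec (C20_norm (T (i k) (v k))) (C20_norm (T (i k) (plus (x k) (v k))))
             then plus (x k) (v k) else minus (x k) (v k)
    end).
  assert (Hbig : forall k, C20_norm (T (i k) (v k)) <= C20_norm (T (i k) (x (S k)))).
  { intros k; simpl; destruct (Rle_dec _ _) as [Hle | Hgt]; [exact Hle |].
    apply linear_pm_large; [apply HT | lra]. }
  assert (Hstep : forall k, C20_norm (minus (x (S k)) (x k)) <= / 8 ^ k).
  { intros k; eapply Rle_trans; [| apply Hk]; simpl; destruct (Rle_dec _ _).
    - right; f_equal; vec.
    - rewrite C20_norm_sym; right; f_equal; vec. }
  assert (Hcauchy : forall n m, (n <= m)%nat ->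
    C20_norm (minus (x m) (x n)) <= 8 / 7 * (/ 8 ^ n - / 8 ^ m)).
  { intros n m Hnm; induction Hnm as [| m Hnm IH].
    - replace (minus (x n) (x n)) with C20_zero by vec.
      assert (A := norm_le_sum C20_zero 0 0).
      assert (B : C20_norm C20_zero <= 0 + 0).
      { apply A; intros s _; change (Rabs 0 <= 0); rewrite Rabs_R0; lra. }
      lra.
    - eapply Rle_trans; [apply (C20_dist_triangle _ (x m)) |].
      assert (A := Hstep m); assert (H8 : 0 < 8 ^ m) by (apply pow_lt; lra).
      replace (/ 8 ^ S m) with (/ 8 * / 8 ^ m) by (simpl; field; lra); lra. }
  destruct (C20_complete x (fun n => 8 / 7 * / 8 ^ n)) as [l Hl].
  - replace (Finite 0) with (Rbar_mult (Finite (8 / 7)) (Finite 0)) by (simpl; f_equal; ring).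
    apply is_lim_seq_scal_l.
    apply (is_lim_seq_ext (fun n => (/ 8) ^ n)).
    + intros n; rewrite pow_inv; reflexivity.
    + apply is_lim_seq_geom; rewrite Rabs_pos_eq; lra.
  - intros n m Hnm; eapply Rle_trans; [apply Hcauchy, Hnm |].
    assert (H8 : 0 < / 8 ^ m) by (apply Rinv_0_lt_compat, pow_lt; lra); lra.
  - destruct (HB l) as [B HBl].
    (* k is the integer part of |B|, so that B < k + 1 contradicts the size of T (i k) l. *)
    destruct (nfloor_ex (Rabs B) (Rabs_pos B)) as [k HkB].
    destruct (Hk k) as [HL [HbL [_ HTv]]].
    assert (H8 : 0 < 8 ^ k) by (apply pow_lt; lra).
    assert (A1 := HbL (minus (x (S k)) l)).
    rewrite C20_linear_minus in A1 by apply HT.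
    assert (A2 := C20_norm_le_dist (T (i k) (x (S k))) (T (i k) l)).
    assert (A3 := Hbig k); assert (A4 := HBl (i k)); assert (A5 := Hl (S k)).
    replace (/ 8 ^ S k) with (/ 8 * / 8 ^ k) in A5 by (simpl; field; lra).
    assert (Hkp := pos_INR k).
    assert (Lp : 0 < L k).
    { eapply Rlt_trans; [| exact HL]; apply Rmult_lt_0_compat; lra. }
    assert (A6 : L k * C20_norm (minus (x (S k)) l) <= L k * (2 / 7 * / 8 ^ k)).
    { apply Rmult_le_compat_l; lra. }
    assert (A7 : INR k + 1 <= 1 / 4 * L k * / 8 ^ k).
    { apply Rmult_le_reg_r with (4 * 8 ^ k); [lra |].
      replace (1 / 4 * L k * / 8 ^ k * (4 * 8 ^ k)) with (L k) by (field; lra); lra. }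
    assert (A8 : 0 < L k * / 8 ^ k) by (apply Rmult_lt_0_compat; [| apply Rinv_0_lt_compat]; lra).
    assert (A9 := Rle_abs B); lra.
Qed.

(** * A C0-semigroup on C([-2,0]) is determined by its generator *)

Lemma C20_norm_scal_pos (c : R) f : 0 < c -> C20_norm (scal (RtoC c) f) <= c * C20_norm f.
Proof.
  intros Hc; eapply Rle_trans; [apply C20_norm_scal |].
  rewrite Cmod_R, Rabs_pos_eq by lra; apply Rle_refl.
Qed.

(** The form without quotients, to which a bounded operator can be applied directly. *)
Lemma generator_eps A (T : R -> C20 -> C20) (f g : C20) : is_generator A T ->
  A f g <-> forall eps, 0 < eps -> exists d, 0 < d /\ forall h, 0 < h < d ->
    C20_norm (minus (minus (T h f) f) (scal (RtoC h) g)) <= eps * h.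
Proof.
  intros HA; eapply iff_trans; [apply HA |].
  eapply iff_trans; [apply (filterlim_right_norm (E := C20_NormedModule)) |].
  split; intros H eps He.
  - destruct (H eps He) as [d [Hd Hd']]; exists d; split; auto; intros h Hh.
    specialize (Hd' h Hh).
    assert (E : minus (minus (T h f) f) (scal (RtoC h) g) =
      scal (RtoC h) (minus (scal (RtoC (/ h)) (minus (T h f) f)) g)).
    { apply C20_eq; intros x _; simpl; rewrite RtoC_inv by lra.
      field; intros E; apply RtoC_inj in E; lra. }
    rewrite E; eapply Rle_trans; [apply C20_norm_scal_pos; lra |].
    rewrite (Rmult_comm eps); apply Rmult_le_compat_l; [lra | apply Rlt_le, Hd'].
  - destruct (H (eps / 2) ltac:(lra)) as [d [Hd Hd']]; exists d; split; auto; intros h Hh.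
    specialize (Hd' h Hh).
    assert (E : minus (scal (RtoC (/ h)) (minus (T h f) f)) g =
      scal (RtoC (/ h)) (minus (minus (T h f) f) (scal (RtoC h) g))).
    { apply C20_eq; intros x _; simpl; rewrite RtoC_inv by lra.
      field; intros E; apply RtoC_inj in E; lra. }
    change (C20_norm (minus (scal (RtoC (/ h)) (minus (T h f) f)) g) < eps).
    rewrite E; eapply Rle_lt_trans; [apply C20_norm_scal_pos, Rinv_0_lt_compat; lra |].
    apply Rle_lt_trans with (/ h * (eps / 2 * h)).
    + apply Rmult_le_compat_l; [apply Rlt_le, Rinv_0_lt_compat; lra | exact Hd'].
    + replace (/ h * (eps / 2 * h)) with (eps / 2) by (field; lra); lra.
Qed.

Lemma semigroup_right_cont (T : R -> C20 -> C20) (f : C20) : C0_semigroup T ->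
  forall eps, 0 < eps -> exists d, 0 < d /\ forall h, 0 < h < d ->
    C20_norm (minus (T h f) f) < eps.
Proof.
  intros [_ [_ [_ H]]].
  apply (proj1 (filterlim_right_norm (E := C20_NormedModule) (fun t => T t f) f)), H.
Qed.

Lemma prefix_bounded (a : nat -> R) N : exists B, forall n, (n < N)%nat -> a n <= B.
Proof.
  induction N as [| N [B HB]].
  - exists 0; intros n Hn; lia.
  - exists (Rmax B (a N)); intros n Hn; destruct (Nat.eq_dec n N) as [-> | Hne].
    + apply Rmax_r.
    + apply Rle_trans with B; [apply HB; lia | apply Rmax_l].
Qed.

(** Otherwise there are times t n tending to 0 with T (t n) not bounded by n + 1. Yet each sequence
    T (t n) f is bounded, by convergence to f for large n and finiteness for the rest, against
    uniform boundedness. *)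
Lemma semigroup_bounded_near_0 (T : R -> C20 -> C20) : C0_semigroup T ->
  exists d M, 0 < d /\ 0 < M /\ forall t, 0 <= t <= d -> bounded_by (T t) M.
Proof.
  intros HT; apply NNPP; intros HN.
  assert (H : forall n : nat, exists t, 0 <= t <= / (INR n + 1) /\ ~ bounded_by (T t) (INR n + 1)).
  { intros n; assert (Hn := pos_INR n); apply NNPP; intros H; apply HN.
    exists (/ (INR n + 1)), (INR n + 1); split; [apply Rinv_0_lt_compat; lra | split; [lra |]].
    intros t Ht; apply NNPP; intros H'; apply H; exists t; auto. }
  set (t := fun n => proj1_sig (constructive_indefinite_description _ (H n))).
  assert (Ht : forall n, 0 <= t n <= / (INR n + 1) /\ ~ bounded_by (T (t n)) (INR n + 1)).
  { intros n; unfold t; destruct (constructive_indefinite_description _ (H n)); auto. }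
  clearbody t.
  destruct (uniform_boundedness (fun n => T (t n))) as [M [HM HB]].
  - intros n; apply HT, Ht.
  - intros f; destruct (semigroup_right_cont T f HT 1 Rlt_0_1) as [d [Hd Hd']].
    destruct (nfloor_ex (/ d)) as [N [_ HN']]; [apply Rlt_le, Rinv_0_lt_compat, Hd |].
    destruct (prefix_bounded (fun n => C20_norm (T (t n) f)) N) as [B HB].
    exists (Rmax B (1 + C20_norm f)); intros n.
    destruct (le_lt_dec N n) as [Hn | Hn].
    + eapply Rle_trans; [| apply Rmax_r].
      (* The filter [at_right 0] says nothing at the point 0 itself. *)
      destruct (Req_dec (t n) 0) as [-> | H0].
      * destruct HT as [_ [HT0 _]]; rewrite HT0; lra.
      * eapply Rle_trans; [apply (C20_norm_le_dist _ f) |]; apply Rplus_le_compat_r, Rlt_le, Hd'.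
        destruct (Ht n) as [Ht1 _]; split; [lra |].
        apply Rle_lt_trans with (1 := proj2 Ht1).
        rewrite <- (Rinv_inv d); apply Rinv_lt_contravar.
        -- apply Rmult_lt_0_compat; [apply Rinv_0_lt_compat, Hd |]; assert (A := pos_INR n); lra.
        -- apply le_INR in Hn; lra.
    + eapply Rle_trans; [apply HB, Hn | apply Rmax_l].
  - destruct (nfloor_ex M) as [n [_ Hn]]; [lra |].
    apply (proj2 (Ht n)), (bounded_by_le _ M); [apply HB | lra].
Qed.

Lemma semigroup_locally_bounded (T : R -> C20 -> C20) b : C0_semigroup T ->
  exists M, 0 < M /\ forall t, 0 <= t <= b -> bounded_by (T t) M.
Proof.
  intros HT; destruct (semigroup_bounded_near_0 T HT) as [d [M [Hd [HM HB]]]].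
  (* The base M + 1 is at least 1, so the bounds grow with n and each also covers the shorter
     times. *)
  assert (H : forall n t, 0 <= t <= INR n * d -> bounded_by (T t) ((M + 1) ^ n)).
  { induction n as [| n IH]; intros t Ht f.
    - simpl in *; replace t with 0 by lra.
      destruct HT as [_ [HT0 _]]; rewrite HT0; lra.
    - assert (Hp : 1 <= (M + 1) ^ n) by (apply pow_R1_Rle; lra).
      destruct (Rle_dec t d) as [Hle | Hgt].
      + eapply Rle_trans; [apply (bounded_by_le _ M ((M + 1) ^ S n)); [apply HB; lra |] |].
        * simpl; apply Rle_trans with ((M + 1) * 1); [lra | apply Rmult_le_compat_l; lra].
        * apply Rle_refl.
      + rewrite S_INR in Ht.
        replace t with (d + (t - d)) by ring.
        destruct HT as [_ [_ [HTa _]]]; rewrite HTa by lra.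
        eapply Rle_trans; [apply HB; lra |]; simpl; rewrite Rmult_assoc.
        assert (A := IH (t - d) ltac:(lra) f); assert (B := C20_norm_ge0 (T (t - d) f)).
        apply Rle_trans with ((M + 1) * C20_norm (T (t - d) f)); [lra |].
        apply Rmult_le_compat_l; lra. }
  destruct (nfloor_ex (Rmax 0 (b / d)) (Rmax_l _ _)) as [n [_ Hn]].
  exists ((M + 1) ^ S n); split; [apply pow_lt; lra |]; intros t Ht; apply H; split; [lra |].
  rewrite S_INR; apply Rle_trans with b; [apply Ht |].
  apply Rle_trans with (b / d * d); [right; field; lra |].
  apply Rmult_le_compat_r; [lra |]; assert (A := Rmax_r 0 (b / d)); lra.
Qed.

Section Uniqueness.

Variables (A : C20 -> C20 -> Prop) (T S : R -> C20 -> C20).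
Hypotheses (HT : C0_semigroup T) (HS : C0_semigroup S).
Hypotheses (GT : is_generator A T) (GS : is_generator A S).

(** S s commutes with S h and is bounded, so it carries the first-order expansion at f to one at S s
    f. *)
Lemma generator_orbit f g s : A f g -> 0 <= s -> A (S s f) (S s g).
Proof.
  intros Hfg Hs; apply (generator_eps A S _ _ GS); intros eps He.
  destruct HS as [HL [_ [Hadd _]]].
  destruct (is_linear_bounded (S s) (HL s Hs)) as [M [HM HB]].
  destruct (proj1 (generator_eps A S f g GS) Hfg (eps / M)) as [d [Hd Hd']].
  { apply Rdiv_lt_0_compat; auto. }
  exists d; split; auto; intros h Hh; specialize (Hd' h Hh).
  rewrite <- Hadd, Rplus_comm, Hadd by lra.
  assert (E : minus (minus (S s (S h f)) (S s f)) (scal (RtoC h) (S s g)) =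
    S s (minus (minus (S h f) f) (scal (RtoC h) g))).
  { rewrite !C20_linear_minus by (apply HL; exact Hs).
    rewrite (linear_scal (S s) (HL s Hs)); reflexivity. }
  rewrite E; eapply Rle_trans; [apply HB |].
  apply Rle_trans with (M * (eps / M * h)); [apply Rmult_le_compat_l; lra |].
  right; field; lra.
Qed.

Lemma semigroups_tangent f g eps : A f g -> 0 < eps -> exists d, 0 < d /\ forall h, 0 < h < d -> C20_norm (minus (T h f) (S h f)) <= eps * h.
Proof.
  intros Hfg He.
  destruct (proj1 (generator_eps A T f g GT) Hfg (eps / 2) ltac:(lra)) as [d1 [P1 Q1]].
  destruct (proj1 (generator_eps A S f g GS) Hfg (eps / 2) ltac:(lra)) as [d2 [P2 Q2]].
  exists (Rmin d1 d2); split; [apply Rmin_pos; auto |]; intros h Hh.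
  assert (B1 := Rmin_l d1 d2); assert (B2 := Rmin_r d1 d2).
  specialize (Q1 h ltac:(lra)); specialize (Q2 h ltac:(lra)).
  assert (E : minus (T h f) (S h f) =
    minus (minus (minus (T h f) f) (scal (RtoC h) g)) (minus (minus (S h f) f) (scal (RtoC h) g))) by vec.
  rewrite E.
  assert (B3 := C20_dist_triangle (minus (minus (T h f) f) (scal (RtoC h) g)) C20_zero
    (minus (minus (S h f) f) (scal (RtoC h) g))).
  assert (E1 : forall u : C20, C20_norm (minus u C20_zero) = C20_norm u).
  { intros u; f_equal; vec. }
  rewrite (C20_norm_sym C20_zero), !E1 in B3; lra.
Qed.

(** S s f - S y f = S y (S (s-y) f - f), with S y bounded uniformly; this turns right continuity at
    0 into continuity from the left. *)
Lemma orbit_left_cont f t M : (forall s, 0 <= s <= t -> bounded_by (S s) M) -> 0 < M ->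
  forall eps, 0 < eps -> exists d, 0 < d /\ forall s y, 0 <= y < s -> s <= t -> s - y < d ->
    C20_norm (minus (S s f) (S y f)) < eps.
Proof.
  intros HB HM eps He.
  destruct (semigroup_right_cont S f HS (eps / M)) as [d [Hd Hd']].
  { apply Rdiv_lt_0_compat; auto. }
  exists d; split; auto; intros s y Hy Hs Hsy.
  destruct HS as [HL [_ [Hadd _]]].
  replace s with (y + (s - y)) by ring; rewrite Hadd by lra.
  rewrite <- C20_linear_minus by (apply HL; lra).
  eapply Rle_lt_trans; [apply (HB y); lra |].
  apply Rlt_le_trans with (M * (eps / M)); [| right; field; lra].
  apply Rmult_lt_compat_l; auto; apply Hd'; lra.
Qed.

Lemma semigroup_unique_dom f g t : A f g -> 0 <= t -> T t f = S t f.
Proof.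
  intros Hfg Ht.
  destruct (semigroup_locally_bounded T t HT) as [M1 [HM1 HB1]].
  destruct (semigroup_locally_bounded S t HS) as [M2 [HM2 HB2]].
  set (phi := fun s => T (t - s) (S s f)).
  assert (HLT := proj1 HT); assert (HLS := proj1 HS).
  assert (HaT := proj1 (proj2 (proj2 HT))); assert (HaS := proj1 (proj2 (proj2 HS))).
  (* [zero_right_derivative] is about real functions, hence it is applied to the distance of phi s
     from phi 0. *)
  assert (E : C20_norm (minus (phi t) (phi 0)) = C20_norm (minus (phi 0) (phi 0))).
  { assert (Hdiff : forall s y, Rabs (C20_norm (minus (phi y) (phi 0)) - C20_norm (minus (phi s) (phi 0)))
      <= C20_norm (minus (phi y) (phi s))).
    { intros s y.
      assert (B1 := C20_dist_triangle (phi y) (phi s) (phi 0)).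
      assert (B2 := C20_dist_triangle (phi s) (phi y) (phi 0)).
      rewrite (C20_norm_sym (phi s) (phi y)) in B2; apply Rabs_le_between; lra. }
    (* phi y - phi s = T (t-y) (S h - T h) S s f with h = y - s *)
    assert (Hphi : forall s y, 0 <= s < y -> y <= t ->
      C20_norm (minus (phi y) (phi s)) <= M1 * C20_norm (minus (T (y - s) (S s f)) (S (y - s) (S s f)))).
    { intros s y Hs Hy; unfold phi.
      replace (S y f) with (S (y - s) (S s f)) by (rewrite <- HaS by lra; f_equal; ring).
      replace (T (t - s)) with (T ((t - y) + (y - s))) by (f_equal; ring).
      rewrite HaT by lra.
      rewrite <- C20_linear_minus by (apply HLT; lra).
      rewrite (C20_norm_sym (T (y - s) (S s f))); apply HB1; lra. }
    apply (zero_right_derivative (fun s => C20_norm (minus (phi s) (phi 0))) 0 t Ht).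
    - intros s Hs eps He.
      (* T (s-y) (S y f) is compared with S s f through T (s-y) (S s f): the costs M1 e and e, times
         the outer M1, stay below eps. *)
      set (e := eps / (M1 * (M1 + 4))).
      assert (Hc : 0 < M1 * (M1 + 4)) by (apply Rmult_lt_0_compat; lra).
      assert (Hep : 0 < e) by (apply Rdiv_lt_0_compat; auto).
      destruct (orbit_left_cont f t M2 HB2 HM2 e Hep) as [d1 [P1 Q1]].
      destruct (semigroup_right_cont T (S s f) HT e Hep) as [d2 [P2 Q2]].
      destruct (semigroup_right_cont S (S s f) HS e Hep) as [d3 [P3 Q3]].
      exists (Rmin d1 (Rmin d2 d3)); split; [repeat apply Rmin_pos; auto |]; intros y Hy Hsy.
      assert (B1 := Rmin_l d1 (Rmin d2 d3)); assert (B2 := Rmin_r d1 (Rmin d2 d3)).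
      assert (B3 := Rmin_l d2 d3); assert (B4 := Rmin_r d2 d3).
      eapply Rle_trans; [apply Hdiff |]; eapply Rle_trans; [apply Hphi; lra |].
      replace (S (s - y) (S y f)) with (S s f) by (rewrite <- HaS by lra; f_equal; ring).
      specialize (Q1 s y ltac:(lra) ltac:(lra) ltac:(lra)).
      specialize (Q2 (s - y) ltac:(lra)).
      assert (B5 := C20_dist_triangle (T (s - y) (S y f)) (T (s - y) (S s f)) (S s f)).
      rewrite <- C20_linear_minus in B5 by (apply HLT; lra).
      assert (B6 := HB1 (s - y) ltac:(lra) (minus (S y f) (S s f))).
      rewrite (C20_norm_sym (S y f)) in B6.
      assert (B7 : M1 * C20_norm (minus (S s f) (S y f)) <= M1 * e)
        by (apply Rmult_le_compat_l; lra).
      apply Rle_trans with (M1 * (M1 * e + e)).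
      + apply Rmult_le_compat_l; lra.
      + apply Rle_trans with (M1 * (M1 + 4) * e); [| right; unfold e; field; lra].
        assert (0 < M1 * e) by (apply Rmult_lt_0_compat; auto); lra.
    - intros s Hs eps He.
      destruct (semigroups_tangent (S s f) (S s g) (eps / M1)) as [d [Hd Hd']].
      + apply generator_orbit; [exact Hfg | lra].
      + apply Rdiv_lt_0_compat; auto.
      + exists d; split; auto; intros y Hy Hyt.
        eapply Rle_trans; [apply Hdiff |]; eapply Rle_trans; [apply Hphi; lra |].
        apply Rle_trans with (M1 * (eps / M1 * (y - s))); [| right; field; lra].
        apply Rmult_le_compat_l; [lra |]; apply Hd'; lra. }
  replace (minus (phi 0) (phi 0)) with C20_zero in E by vec.
  assert (Z : C20_norm C20_zero <= 0 + 0).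
  { apply norm_le_sum; intros s _; change (Rabs 0 <= 0); rewrite Rabs_R0; lra. }
  assert (F : phi t = phi 0) by (apply C20_dist_0; lra).
  unfold phi in F; rewrite Rminus_diag, Rminus_0_r in F by reflexivity.
  rewrite (proj1 (proj2 HT)), (proj1 (proj2 HS)) in F; symmetry; exact F.
Qed.

Theorem semigroup_unique f t :
  (forall eps, 0 < eps -> exists u v, A u v /\ C20_norm (minus f u) <= eps) ->
  0 <= t -> T t f = S t f.
Proof.
  intros Hdense Ht.
  destruct (semigroup_locally_bounded T t HT) as [M1 [HM1 HB1]].
  destruct (semigroup_locally_bounded S t HS) as [M2 [HM2 HB2]].
  apply C20_dist_0, le_epsilon; intros eps He.
  destruct (Hdense (eps / (M1 + M2))) as [u [v [Huv Hu]]]; [apply Rdiv_lt_0_compat; lra |].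
  assert (B := C20_dist_triangle (T t f) (T t u) (S t f)).
  rewrite (semigroup_unique_dom u v t Huv Ht) in B at 2.
  rewrite (C20_norm_sym (S t u)) in B.
  rewrite <- !C20_linear_minus in B by (apply HT + apply HS; exact Ht).
  assert (B1 := HB1 t ltac:(lra) (minus f u)); assert (B2 := HB2 t ltac:(lra) (minus f u)).
  assert (B3 : (M1 + M2) * C20_norm (minus f u) <= (M1 + M2) * (eps / (M1 + M2)))
    by (apply Rmult_le_compat_l; lra).
  replace ((M1 + M2) * (eps / (M1 + M2))) with eps in B3 by (field; lra).
  lra.
Qed.

End Uniqueness.

(** * Density of the domain *)

(** q is the mean of the orbit of p over the times in [0,h]. Such means lie in the domain of a
    generator, whereas a mere mollification of p need not meet the boundary condition. *)
Lemma dom_dense_real p (Hp : cont p) eps : 0 < eps -> exists q r, cont q /\ cont r /\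
  dom_eq q r /\ forall x, I20 x -> Rabs (p x - q x) <= eps.
Proof.
  intros He; set (u := delay_flow p Hp).
  destruct (delay_flow_sol p Hp) as [Hu Su]; fold u in Hu, Su.
  destruct (cont_unif u (-2) 1 eps Hu He) as [d [Hd Hd']].
  set (h := Rmin d 1 / 2).
  assert (A := Rmin_l d 1); assert (B := Rmin_r d 1); assert (C1 := Rmin_pos d 1 Hd Rlt_0_1).
  assert (Hh : 0 < h) by (unfold h; lra).
  assert (HU := cont_prim u Hu).
  exists (fun x => / h * (fun x => prim u (x + h)) x + - / h * prim u x),
    (fun x => / h * (fun x => u (x + h)) x + - / h * u x).
  assert (Hq : cont (fun x => prim u (x + h))) by apply (cont_shift (prim u)), HU.
  assert (Hr : cont (fun x => u (x + h))) by apply (cont_shift u), Hu.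
  assert (PU : forall x, prim (fun x => u (x + h)) x = prim u (x + h) - prim u h).
  { intros x; apply prim_shift, Hu. }
  assert (PW : forall x, prim (fun x => prim u (x + h)) x = prim (prim u) (x + h) - prim (prim u) h).
  { intros x; apply prim_shift, HU. }
  repeat split.
  - apply cont_lin; assumption.
  - apply cont_lin; assumption.
  - intros x Hx; rewrite prim_lin by assumption.
    rewrite PU, prim_0, Rplus_0_l; ring.
  - rewrite lag_lin by assumption.
    rewrite Rplus_0_l, (Su h) by lra.
    unfold lag at 2 3; rewrite !PW, !prim_0.
    (* Integrating the equation over [0,h] writes u h - u 0 in terms of the second primitive of u,
       of which [lag] of the mean also consists. *)
    replace (prim (lag u) h) with (2 * (prim (prim u) (h - 1) - prim (prim u) (- 1)) -
      prim (prim u) h - (prim (prim u) (h - 2) - prim (prim u) (-2))).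
    + replace (0 - 1) with (- 1) by ring; replace (0 - 2) with (-2) by ring.
      replace (0 + h) with h by ring.
      replace (-1 + h) with (h - 1) by ring; replace (-2 + h) with (h - 2) by ring; ring.
    + assert (H1 : cont (fun s => prim u (s + - (1)))) by apply (cont_shift (prim u)), HU.
      assert (H2 : cont (fun s => prim u (s + - (2)))) by apply (cont_shift (prim u)), HU.
      rewrite (prim_ext_all (lag u) (fun s => 1 * (2 * prim u (s + - (1)) + -1 * prim u (s + - (2))) + -1 * prim u s))
        by (intros; unfold lag, Rminus; ring).
      rewrite prim_lin; [| apply (cont_lin (fun s => prim u (s + - (1))) (fun s => prim u (s + - (2)))); assumption | assumption].
      rewrite (prim_lin (fun s => prim u (s + - (1))) (fun s => prim u (s + - (2)))) by assumption.
      rewrite !(prim_shift (prim u)) by exact HU.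
      unfold Rminus; replace (- (1)) with (-1) by ring; replace (- (2)) with (-2) by ring; ring.
  - intros x Hx; unfold I20 in Hx.
    assert (D : Rabs (prim (fun s => 1 * u s + - u x * (fun _ => 1) s) (x + h) -
      prim (fun s => 1 * u s + - u x * (fun _ => 1) s) x) <= (x + h - x) * eps).
    { apply prim_abs_le; [apply cont_lin; auto using cont_const | lra |].
      intros s Hs; replace (1 * u s + - u x * 1) with (u s - u x) by ring.
      apply Rlt_le, Hd'; try (unfold h in *; lra); rewrite Rabs_pos_eq; unfold h in *; lra. }
    rewrite !prim_lin, !prim_const in D by (auto using cont_const).
    rewrite <- (delay_flow_init p Hp x) by lra; fold u.
    rewrite Rabs_minus_sym.
    replace (/ h * prim u (x + h) + - / h * prim u x - u x)
      with (/ h * (prim u (x + h) - prim u x) - u x) by ring.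
    apply quotient_bound; [exact Hh |].
    replace (prim u (x + h) - prim u x - h * u x)
      with (1 * prim u (x + h) + - u x * (1 * (x + h)) - (1 * prim u x + - u x * (1 * x))) by ring.
    replace (eps * h) with ((x + h - x) * eps) by ring; exact D.
Qed.

Lemma opA_dense f eps : 0 < eps -> exists u v, opA u v /\ C20_norm (minus f u) <= eps.
Proof.
  intros He.
  destruct (dom_dense_real (re f) (cont_re f) (eps / 2)) as [q1 [r1 [Cq1 [Cr1 [D1 E1]]]]]; [lra |].
  destruct (dom_dense_real (im f) (cont_im f) (eps / 2)) as [q2 [r2 [Cq2 [Cr2 [D2 E2]]]]]; [lra |].
  exists (mkC q1 q2 Cq1 Cq2), (mkC r1 r2 Cr1 Cr2).
  split; [apply opA_mkC; assumption |].
  replace eps with (eps / 2 + eps / 2) by field.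
  apply norm_le_sum; intros x Hx.
  - rewrite re_C20_minus, re_mkC by exact Hx; apply E1, Hx.
  - rewrite im_C20_minus, im_mkC by exact Hx; apply E2, Hx.
Qed.

Lemma flow_unique (T : R -> C20 -> C20) f t :
  C0_semigroup T -> is_generator opA T -> 0 <= t -> T t f = flow t f.
Proof.
  intros HT GT Ht; apply (semigroup_unique opA T flow); auto using flow_C0, flow_generator.
  apply opA_dense.
Qed.

(** * Uniqueness of the residue *)

Fixpoint csum (f : nat -> C) (n : nat) : C :=
  match n with O => RtoC 0 | S n => (csum f n + f n)%C end.

Lemma csum_ext f g n : (forall k, (k < n)%nat -> f k = g k) -> csum f n = csum g n.
Proof.
  induction n as [| n IH]; intros H; simpl; [reflexivity |].
  rewrite IH, H by (intros; try apply H; lia); reflexivity.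
Qed.

Lemma csum_plus f g n : csum (fun k => f k + g k)%C n = (csum f n + csum g n)%C.
Proof. induction n as [| n IH]; simpl; [ring | rewrite IH; ring]. Qed.

Lemma csum_mult c f n : csum (fun k => c * f k)%C n = (c * csum f n)%C.
Proof. induction n as [| n IH]; simpl; [ring | rewrite IH; ring]. Qed.

Lemma csum_const c n : csum (fun _ => c) n = (RtoC (INR n) * c)%C.
Proof.
  induction n as [| n IH]; [simpl; ring |].
  rewrite S_INR, RtoC_plus; simpl csum; rewrite IH; ring.
Qed.

Lemma csum_abs_le f n M : (forall k, (k < n)%nat -> Cmod (f k) <= M) ->
  Cmod (csum f n) <= INR n * M.
Proof.
  induction n as [| n IH]; intros H.
  - simpl csum; rewrite Cmod_0; simpl; lra.
  - rewrite S_INR; simpl csum; eapply Rle_trans; [apply Cmod_triangle |].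
    assert (A := IH (fun k Hk => H k (Nat.lt_lt_succ_r _ _ Hk))).
    assert (B := H n (Nat.lt_succ_diag_r n)); lra.
Qed.

Definition csum_lim (f : nat -> C) (l : C) : Prop :=
  forall eps, 0 < eps -> exists N, forall n, (N <= n)%nat -> Cmod (csum f n - l) < eps.

Lemma csum_lim_terms_bounded f l : csum_lim f l ->
  exists M, 0 < M /\ forall k, Cmod (f k) <= M.
Proof.
  intros H; destruct (H 1 Rlt_0_1) as [N HN].
  destruct (prefix_bounded (fun k => Cmod (f k)) N) as [B HB].
  exists (Rmax B 2); split; [apply Rlt_le_trans with 2; [lra | apply Rmax_r] |]; intros k.
  destruct (le_lt_dec N k) as [Hk | Hk].
  - eapply Rle_trans; [| apply Rmax_r].
    replace (f k) with ((csum f (S k) - l) + - (csum f k - l))%C by (simpl; ring).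
    eapply Rle_trans; [apply Cmod_triangle |]; rewrite Cmod_opp.
    assert (A1 := HN k Hk); assert (A2 := HN (S k) (Nat.le_le_succ_r _ _ Hk)); lra.
  - eapply Rle_trans; [apply HB, Hk | apply Rmax_l].
Qed.

Definition cis (t : R) : C := (cos t, sin t).

Lemma cis_plus s t : cis (s + t) = (cis s * cis t)%C.
Proof. unfold cis, Cmult; simpl; rewrite cos_plus, sin_plus; f_equal; ring. Qed.

Lemma cis_pow t n : (cis t ^ n)%C = cis (INR n * t).
Proof.
  induction n as [| n IH].
  - simpl; unfold cis; rewrite Rmult_0_l, cos_0, sin_0; reflexivity.
  - rewrite Cpow_S, IH, <- cis_plus, S_INR; f_equal; ring.
Qed.

Lemma Cmod_cis t : Cmod (cis t) = 1.
Proof.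
  unfold cis, Cmod; simpl; assert (H := sin2_cos2 t); unfold Rsqr in H.
  rewrite !Rmult_1_r, Rplus_comm, H; apply sqrt_1.
Qed.

Lemma cis_opp t : (/ cis t)%C = cis (- t).
Proof.
  assert (H : (cis t * cis (- t) = 1)%C).
  { rewrite <- cis_plus, Rplus_opp_r; unfold cis; rewrite cos_0, sin_0; reflexivity. }
  assert (Hn : cis t <> 0%C).
  { intros E; assert (A := Cmod_cis t); rewrite E, Cmod_0 in A; lra. }
  transitivity (/ cis t * (cis t * cis (- t)))%C; [rewrite H; ring | field; exact Hn].
Qed.

(** A geometric sum; sin (t/2) <> 0 expresses that the ratio [cis t] is not 1. *)
Lemma root_of_unity_sum t n : sin (t / 2) <> 0 -> cis (INR n * t) = 1%C ->
  csum (fun j => cis t ^ j)%C n = 0%C.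
Proof.
  intros Hs Hn.
  assert (G : (csum (fun j => cis t ^ j)%C n * (cis t - 1) = cis t ^ n - 1)%C).
  { clear; induction n as [| n IH]; simpl; [ring |].
    rewrite Cmult_plus_distr_r, IH; ring. }
  rewrite cis_pow, Hn in G.
  assert (H1 : (cis t - 1)%C <> 0%C).
  { intros E; apply Hs.
    assert (Hc : cos t = 1).
    { assert (E' : Re (cis t - 1)%C = 0) by (rewrite E; reflexivity).
      simpl in E'; lra. }
    replace t with (2 * (t / 2)) in Hc by field; rewrite cos_2a_sin in Hc.
    apply Rsqr_0_uniq; unfold Rsqr; lra. }
  apply (f_equal (fun z => z * / (cis t - 1))%C) in G.
  rewrite <- Cmult_assoc, Cinv_r, Cmult_1_r in G by exact H1.
  rewrite G; ring.
Qed.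

Lemma root_of_unity_sum_pos N k : (0 < k < N)%nat ->
  csum (fun j => cis (INR k * (2 * PI / INR N)) ^ j)%C N = 0%C /\
  csum (fun j => cis (- (INR k * (2 * PI / INR N))) ^ j)%C N = 0%C.
Proof.
  intros [Hk HkN].
  assert (k0 : 0 < INR k) by (apply lt_0_INR; lia).
  assert (kN : INR k < INR N) by (apply lt_INR; lia).
  assert (Hs : 0 < sin (INR k * (2 * PI / INR N) / 2)).
  { replace (INR k * (2 * PI / INR N) / 2) with (INR k / INR N * PI) by (field; lra).
    assert (P := PI_RGT_0).
    assert (0 < INR k / INR N) by (apply Rdiv_lt_0_compat; lra).
    assert (INR k / INR N < 1).
    { apply Rmult_lt_reg_r with (INR N); [lra |]; unfold Rdiv; rewrite Rmult_assoc, Rinv_l; lra. }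
    apply sin_gt_0; [apply Rmult_lt_0_compat; lra |].
    rewrite <- (Rmult_1_l PI) at 2; apply Rmult_lt_compat_r; lra. }
  assert (H1 : cis (INR N * (INR k * (2 * PI / INR N))) = 1%C).
  { replace (INR N * (INR k * (2 * PI / INR N))) with (0 + 2 * INR k * PI) by (field; lra).
    unfold cis; rewrite cos_period, sin_period, cos_0, sin_0; reflexivity. }
  split; apply root_of_unity_sum.
  - lra.
  - exact H1.
  - replace (- (INR k * (2 * PI / INR N)) / 2) with (- (INR k * (2 * PI / INR N) / 2)) by (field; lra).
    rewrite sin_neg; lra.
  - rewrite Ropp_mult_distr_r_reverse, <- cis_opp, H1; field.
Qed.

Section Residue.

Variables (alpha beta : nat -> C) (r : R).
Hypothesis Hr : 0 < r.
Hypothesis Hlaurent : forall z : C, 0 < Cmod z < r -> exists a b : C,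
  csum_lim (fun k => z ^ k * alpha k)%C a /\ csum_lim (fun k => (/ z) ^ S k * beta k)%C b /\
  (a + b = 0)%C.

Let rho := r / 2.
Let q := 2 / 3.

(** Convergence at radius 3r/4 bounds alpha and convergence at radius r/4 bounds beta. On the circle
    of radius r/2 in between, the terms decay with ratios 2/3 and 1/2; q is the larger. *)
Lemma laurent_terms : exists K, 0 < K /\ forall k (z : C), Cmod z = rho ->
  Cmod (z ^ S k * alpha k + (/ z) ^ k * beta k)%C <= K * q ^ k.
Proof.
  assert (H1 : 0 < Cmod (RtoC (3 / 4 * r)) < r) by (rewrite Cmod_R, Rabs_pos_eq; lra).
  assert (H2 : 0 < Cmod (RtoC (1 / 4 * r)) < r) by (rewrite Cmod_R, Rabs_pos_eq; lra).
  destruct (Hlaurent _ H1) as [a1 [_ [A1 _]]]; destruct (Hlaurent _ H2) as [_ [b2 [_ [B2 _]]]].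
  destruct (csum_lim_terms_bounded _ _ A1) as [M1 [P1 Q1]].
  destruct (csum_lim_terms_bounded _ _ B2) as [M2 [P2 Q2]].
  exists (rho * M1 + rho * M2); split.
  { unfold rho; assert (0 < r / 2 * M1) by (apply Rmult_lt_0_compat; lra).
    assert (0 < r / 2 * M2) by (apply Rmult_lt_0_compat; lra); lra. }
  intros k z Hz; eapply Rle_trans; [apply Cmod_triangle |].
  assert (z0 : z <> 0%C) by (intros E; rewrite E, Cmod_0 in Hz; unfold rho in Hz; lra).
  rewrite !Cmod_mult, !Cmod_pow, Cmod_inv, Hz by exact z0.
  specialize (Q1 k); specialize (Q2 k); cbv beta in Q1, Q2.
  rewrite Cmod_mult, Cmod_pow, Cmod_R, Rabs_pos_eq in Q1 by lra.
  rewrite Cmod_mult, Cmod_pow, Cmod_inv, Cmod_R, Rabs_pos_eq in Q2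
    by (try (intros E; apply RtoC_inj in E); lra).
  assert (Eq1 : rho ^ S k * Cmod (alpha k) = rho * q ^ k * ((3 / 4 * r) ^ k * Cmod (alpha k))).
  { replace rho with (q * (3 / 4 * r)) at 1 by (unfold rho, q; field).
    simpl; rewrite Rpow_mult_distr; unfold rho, q; field. }
  assert (Eq2 : (/ rho) ^ k * Cmod (beta k) <=
    rho * q ^ k * ((/ (1 / 4 * r)) ^ S k * Cmod (beta k))).
  { replace (/ (1 / 4 * r)) with (2 * / rho) by (unfold rho; field; lra).
    simpl; rewrite Rpow_mult_distr.
    assert (E : rho * q ^ k * (2 * / rho * (2 ^ k * (/ rho) ^ k) * Cmod (beta k)) =
      (2 * (q ^ k * 2 ^ k)) * ((/ rho) ^ k * Cmod (beta k))) by (unfold rho; field; lra).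
    rewrite E, <- Rpow_mult_distr.
    rewrite <- (Rmult_1_l ((/ rho) ^ k * Cmod (beta k))) at 1.
    apply Rmult_le_compat_r.
    - apply Rmult_le_pos; [| apply Cmod_ge_0].
      apply pow_le, Rlt_le, Rinv_0_lt_compat; unfold rho; lra.
    - assert (1 <= (q * 2) ^ k) by (apply pow_R1_Rle; unfold q; lra); lra. }
  assert (q0 : 0 <= rho * q ^ k) by (apply Rmult_le_pos; [unfold rho; lra | apply pow_le; unfold q; lra]).
  assert (D1 := Rmult_le_compat_l _ _ _ q0 Q1); assert (D2 := Rmult_le_compat_l _ _ _ q0 Q2).
  rewrite Eq1; lra.
Qed.

(* Averaging z times the Laurent series over the points rho w^j, w a primitive
   N-th root of unity, kills all coefficients but beta_0 up to order N. *)
Lemma residue_zero : beta O = 0%C.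
Proof.
  destruct laurent_terms as [K [HK Hterms]].
  assert (rho0 : 0 < rho) by (unfold rho; lra).
  assert (Hm : forall m, Cmod (beta O) <= 3 * K * q ^ m).
  (* The term of index n carries the powers S n and n of the root of unity; N = m + 2 makes both
     sums vanish for 1 <= n <= m. *)
  { intros m; set (N := S (S m)).
    assert (HN : 0 < INR N) by (apply lt_0_INR; unfold N; lia).
    set (w := 2 * PI / INR N).
    assert (Hroot : forall k, (0 < k < N)%nat ->
      csum (fun j => cis (INR k * w) ^ j)%C N = 0%C /\
      csum (fun j => cis (- (INR k * w)) ^ j)%C N = 0%C)
      by (intros k; apply root_of_unity_sum_pos).
    set (z := fun j => (RtoC rho * cis w ^ j)%C).
    assert (Hz : forall j, Cmod (z j) = rho).
    { intros j; unfold z; rewrite Cmod_mult, Cmod_pow, Cmod_cis, pow1, Cmod_R, Rabs_pos_eq; lra. }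
    assert (z0 : forall j, z j <> 0%C).
    { intros j E; assert (A := Hz j); rewrite E, Cmod_0 in A; lra. }
    (* The sum over the N points of z times the n-th partial sums: it tends to 0 by hypothesis and
       equals N beta_0 up to the tail beyond m. *)
    set (F := fun n => csum (fun j => z j * (csum (fun k => z j ^ k * alpha k) n +
      csum (fun k => (/ z j) ^ S k * beta k) n))%C N).
    set (inc := fun n => csum (fun j => z j ^ S n * alpha n + (/ z j) ^ n * beta n)%C N).
    assert (HF : forall n, F (S n) = (F n + inc n)%C).
    { intros n; unfold F, inc; rewrite <- csum_plus; apply csum_ext; intros j _; simpl csum.
      rewrite !Cpow_S; field; apply z0. }
    assert (F0 : F O = 0%C).
    { unfold F; simpl csum at 2 3; rewrite (csum_ext _ (fun _ => 0%C)) by (intros; ring).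
      rewrite csum_const; ring. }
    assert (zpow : forall j k, (z j ^ k = RtoC rho ^ k * cis (INR k * w) ^ j)%C).
    { intros j k; unfold z; rewrite Cpow_mult_l, <- Cpow_mult_r, Nat.mul_comm, Cpow_mult_r, cis_pow.
      reflexivity. }
    assert (zinv : forall j k, ((/ z j) ^ k = (/ RtoC rho) ^ k * cis (- (INR k * w)) ^ j)%C).
    { intros j k; rewrite Cpow_inv, zpow by apply z0.
      rewrite Cpow_inv, <- cis_opp by (intros E; apply RtoC_inj in E; lra).
      assert (Hc : forall t, cis t <> 0%C).
      { intros t E; assert (A := Cmod_cis t); rewrite E, Cmod_0 in A; lra. }
      rewrite Cpow_inv by apply Hc; field; split; apply Cpow_nz; [apply Hc |].
      intros E; apply RtoC_inj in E; lra. }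
    assert (inc_split : forall n, inc n =
      (RtoC rho ^ S n * alpha n * csum (fun j => cis (INR (S n) * w) ^ j) N +
       (/ RtoC rho) ^ n * beta n * csum (fun j => cis (- (INR n * w)) ^ j) N)%C).
    { intros n; unfold inc; rewrite <- !csum_mult, <- csum_plus; apply csum_ext; intros j _.
      rewrite zpow, zinv; ring. }
    assert (inc0 : inc O = (RtoC (INR N) * beta O)%C).
    { rewrite inc_split.
      rewrite (proj1 (Hroot 1%nat ltac:(unfold N; lia))).
      rewrite (csum_ext (fun j => cis (- (INR 0 * w)) ^ j)%C (fun _ => 1%C)).
      - rewrite csum_const; simpl Cpow; ring.
      - intros j _; simpl INR; rewrite Rmult_0_l, Ropp_0, cis_pow, Rmult_0_r; unfold cis.
        rewrite cos_0, sin_0; reflexivity. }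
    assert (incz : forall n, (1 <= n <= m)%nat -> inc n = 0%C).
    { intros n Hn; rewrite inc_split.
      rewrite (proj1 (Hroot (S n) ltac:(unfold N; lia))).
      rewrite (proj2 (Hroot n ltac:(unfold N; lia))); ring. }
    assert (incb : forall n, Cmod (inc n) <= INR N * (K * q ^ n)).
    { intros n; apply csum_abs_le; intros j _; apply Hterms, Hz. }
    assert (Fm : forall n, (1 <= n <= S m)%nat -> F n = (RtoC (INR N) * beta O)%C).
    { induction n as [| n IH]; [lia |]; intros Hn; rewrite HF.
      destruct n as [| n]; [rewrite F0, inc0; ring |].
      rewrite IH, incz by lia; ring. }
    (* The factor 3 is 1 / (1 - q), from summing the geometric bounds of the increments. *)
    assert (Fb : forall n, (S m <= n)%nat ->
      Cmod (F n - RtoC (INR N) * beta O)%C <= INR N * (3 * K * (q ^ m - q ^ n))).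
    { intros n Hn; induction Hn as [| n Hn IH].
      - rewrite Fm by lia.
        replace (RtoC (INR N) * beta O - RtoC (INR N) * beta O)%C with (RtoC 0) by ring.
        rewrite Cmod_0; apply Rmult_le_pos; [lra |]; apply Rmult_le_pos; [lra |].
        assert (0 < q ^ m) by (apply pow_lt; unfold q; lra); simpl; unfold q in *; lra.
      - rewrite HF.
        replace (F n + inc n - RtoC (INR N) * beta O)%C
          with ((F n - RtoC (INR N) * beta O) + inc n)%C by ring.
        eapply Rle_trans; [apply Cmod_triangle |].
        assert (A := incb n).
        replace (INR N * (3 * K * (q ^ m - q ^ S n))) with
          (INR N * (3 * K * (q ^ m - q ^ n)) + INR N * (K * q ^ n)) by (simpl; unfold q; field).
        lra. }
    assert (Flim : forall eps, 0 < eps -> exists n0, forall n, (n0 <= n)%nat -> Cmod (F n) <= eps).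
    { intros eps He; unfold F; clear - Hlaurent Hz rho0 He HN.
      assert (Hone : forall j, exists n0, forall n, (n0 <= n)%nat ->
        Cmod (z j * (csum (fun k => z j ^ k * alpha k) n +
          csum (fun k => (/ z j) ^ S k * beta k) n))%C <= eps / INR N).
      { intros j; destruct (Hlaurent (z j)) as [a [b [Ha [Hb Hab]]]].
        - rewrite Hz; unfold rho in *; lra.
        - assert (He' : 0 < eps / INR N / rho / 2) by (apply Rdiv_lt_0_compat; [apply Rdiv_lt_0_compat; [apply Rdiv_lt_0_compat |] |]; lra).
          destruct (Ha _ He') as [n1 H1]; destruct (Hb _ He') as [n2 H2].
          exists (Nat.max n1 n2); intros n Hn.
          specialize (H1 n ltac:(lia)); specialize (H2 n ltac:(lia)).
          rewrite Cmod_mult, Hz.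
          set (u := csum (fun k => z j ^ k * alpha k)%C n) in *.
          set (v := csum (fun k => (/ z j) ^ S k * beta k)%C n) in *.
          replace (u + v)%C with ((u - a) + (v - b))%C
            by (transitivity (u + v - (a + b))%C; [ring | rewrite Hab; ring]).
          assert (A := Cmod_triangle (u - a) (v - b)).
          apply Rle_trans with (rho * (eps / INR N / rho)); [apply Rmult_le_compat_l; lra |].
          right; field; lra. }
      assert (Hall : forall M, exists n0, forall j, (j < M)%nat -> forall n, (n0 <= n)%nat ->
        Cmod (z j * (csum (fun k => z j ^ k * alpha k) n +
          csum (fun k => (/ z j) ^ S k * beta k) n))%C <= eps / INR N).
      { induction M as [| M [n1 H1]]; [exists O; intros; lia |].
        destruct (Hone M) as [n2 H2]; exists (Nat.max n1 n2); intros j Hj n Hn.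
        destruct (Nat.eq_dec j M) as [-> | Hne]; [apply H2 | apply H1]; lia. }
      destruct (Hall N) as [n0 H0]; exists n0; intros n Hn.
      replace eps with (INR N * (eps / INR N)) by (field; lra).
      apply csum_abs_le; intros j Hj; apply H0; auto. }
    apply Rmult_le_reg_l with (INR N); [exact HN |].
    apply le_epsilon; intros eps He.
    destruct (Flim eps He) as [n0 Hn0].
    set (n := Nat.max n0 (S m)).
    assert (A := Hn0 n ltac:(unfold n; lia)); assert (B := Fb n ltac:(unfold n; lia)).
    assert (D : INR N * Cmod (beta O) = Cmod (RtoC (INR N) * beta O)).
    { rewrite Cmod_mult, Cmod_R, Rabs_pos_eq; lra. }
    rewrite D.
    replace (RtoC (INR N) * beta O)%C with (F n + - (F n - RtoC (INR N) * beta O))%C by ring.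
    eapply Rle_trans; [apply Cmod_triangle |]; rewrite Cmod_opp.
    assert (0 <= q ^ n) by (apply pow_le; unfold q; lra).
    assert (INR N * (3 * K * (q ^ m - q ^ n)) <= INR N * (3 * K * q ^ m)).
    { apply Rmult_le_compat_l; [lra |]; apply Rmult_le_compat_l; lra. }
    lra. }
  apply Cmod_eq_0, Rle_antisym; [| apply Cmod_ge_0].
  apply le_epsilon; intros eps He.
  destruct (pow_lt_1_zero q) with (y := eps / (3 * K)) as [m Hq].
  - unfold q; rewrite Rabs_pos_eq; lra.
  - apply Rdiv_lt_0_compat; lra.
  - specialize (Hq m (le_n m)); rewrite Rabs_pos_eq in Hq by (apply pow_le; unfold q; lra).
    eapply Rle_trans; [apply (Hm m) |]; rewrite Rplus_0_l.
    apply Rle_trans with (3 * K * (eps / (3 * K))); [apply Rmult_le_compat_l; lra |].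
    right; field; lra.
Qed.

End Residue.

Lemma C20_minus_eval (f g : C20) x : minus f g x = (f x - g x)%C.
Proof. simpl; ring. Qed.

Lemma sum_n_eval (u : nat -> C20) n x :
  (sum_n u n : C20) x = csum (fun k => u k x) (S n).
Proof.
  induction n as [| n IH].
  - rewrite sum_O; simpl; ring.
  - rewrite sum_Sn.
    change ((sum_n u n : C20) x + u (S n) x = csum (fun k => u k x) (S (S n)))%C.
    rewrite IH; reflexivity.
Qed.

Lemma op_series_eval (u : nat -> C20 -> C20) (V : C20 -> C20) f x : I20 x ->
  is_op_series u V -> csum_lim (fun k => u k f x) (V f x).
Proof.
  intros Hx H eps He.
  assert (Hf := C20_norm_ge0 f).
  assert (He' : 0 < eps / (C20_norm f + 1)) by (apply Rdiv_lt_0_compat; lra).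
  destruct (H (mkposreal _ He')) as [N HN].
  exists (S N); intros n Hn; destruct n as [| n]; [lia |].
  specialize (HN n ltac:(lia) f); simpl in HN.
  rewrite <- sum_n_eval.
  assert (A := C20_norm_ge (minus (sum_n (fun k => u k f) n) (V f)) x Hx).
  rewrite C20_minus_eval in A.
  apply Rle_lt_trans with (1 := A).
  apply Rle_lt_trans with (1 := HN).
  change (eps / (C20_norm f + 1) * C20_norm f < eps).
  apply Rlt_le_trans with (eps / (C20_norm f + 1) * (C20_norm f + 1)).
  - apply Rmult_lt_compat_l; lra.
  - right; field; lra.
Qed.

Lemma resolvent_unique {E : NormedModule C_AbsRing} (A : E -> E -> Prop) lambda R R' f :
  is_resolvent A lambda R -> is_resolvent A lambda R' -> R f = R' f.
Proof.
  intros [_ [H1 _]] [_ [_ H2]]; destruct (H1 f) as [h [Hh Heq]].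
  specialize (H2 _ _ Hh); rewrite Heq in H2; symmetry; exact H2.
Qed.

(** Evaluated at f and at a point x, two expansions of the same resolvent differ by a scalar Laurent
    series that vanishes on the smaller punctured disc. *)
Lemma laurent_residue_unique (A : C20 -> C20 -> Prop) mu r a b r' a' b' f :
  resolvent_laurent A mu r a b -> resolvent_laurent A mu r' a' b' -> b O f = b' O f.
Proof.
  intros [Hr [_ [_ H]]] [Hr' [_ [_ H']]].
  apply C20_eq; intros x Hx.
  enough (E : (b O f x - b' O f x)%C = 0%C).
  { transitivity ((b O f x - b' O f x) + b' O f x)%C; [ring | rewrite E; ring]. }
  apply (residue_zero (fun k => a k f x - a' k f x)%C (fun k => b k f x - b' k f x)%C (Rmin r r')
    (Rmin_pos _ _ Hr Hr')).
  intros z Hz.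
  assert (Hz1 : 0 < Cmod ((mu + z)%C - mu) < r).
  { replace ((mu + z)%C - mu)%C with z by ring; assert (B := Rmin_l r r'); lra. }
  assert (Hz2 : 0 < Cmod ((mu + z)%C - mu) < r').
  { replace ((mu + z)%C - mu)%C with z by ring; assert (B := Rmin_r r r'); lra. }
  destruct (H _ Hz1) as [R1 [P1 [Q1 [HR1 [HP1 [HQ1 S1]]]]]].
  destruct (H' _ Hz2) as [R2 [P2 [Q2 [HR2 [HP2 [HQ2 S2]]]]]].
  apply (op_series_eval _ _ f x Hx) in HP1; apply (op_series_eval _ _ f x Hx) in HQ1.
  apply (op_series_eval _ _ f x Hx) in HP2; apply (op_series_eval _ _ f x Hx) in HQ2.
  exists (P1 f x - P2 f x)%C, (Q1 f x - Q2 f x)%C.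
  assert (Hdiff : forall (u v w : nat -> C) l l', csum_lim u l -> csum_lim v l' ->
    (forall k, w k = u k - v k)%C -> csum_lim w (l - l')%C).
  { intros u v w l l' Hu Hv Hw eps He.
    destruct (Hu (eps / 2) ltac:(lra)) as [n1 N1]; destruct (Hv (eps / 2) ltac:(lra)) as [n2 N2].
    exists (Nat.max n1 n2); intros n Hn.
    specialize (N1 n ltac:(lia)); specialize (N2 n ltac:(lia)).
    assert (E : csum w n = (csum u n - csum v n)%C).
    { clear - Hw; induction n as [| n IH]; simpl; [ring | rewrite IH, Hw; ring]. }
    rewrite E; replace (csum u n - csum v n - (l - l'))%C
      with ((csum u n - l) + - (csum v n - l'))%C by ring.
    eapply Rle_lt_trans; [apply Cmod_triangle |]; rewrite Cmod_opp; lra. }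
  split; [| split].
  - apply (Hdiff _ _ _ _ _ HP1 HP2); intros k.
    change ((z ^ k * (a k f x - a' k f x))%C =
      (pow_n (K := C_Ring) ((mu + z) - mu)%C k * a k f x - pow_n (K := C_Ring) ((mu + z) - mu)%C k * a' k f x)%C).
    replace ((mu + z)%C - mu)%C with z by ring; change (@pow_n C_Ring) with Cpow; ring.
  - apply (Hdiff _ _ _ _ _ HQ1 HQ2); intros k.
    change (((/ z) ^ S k * (b k f x - b' k f x))%C =
      (pow_n (K := C_Ring) (/ ((mu + z) - mu))%C (S k) * b k f x -
       pow_n (K := C_Ring) (/ ((mu + z) - mu))%C (S k) * b' k f x)%C).
    replace ((mu + z)%C - mu)%C with z by ring; change (@pow_n C_Ring) with Cpow; ring.
  - assert (E := resolvent_unique A _ R1 R2 f HR1 HR2).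
    rewrite S1, S2 in E; apply (f_equal (fun g : C20 => g x)) in E.
    change ((P1 f x + Q1 f x)%C = (P2 f x + Q2 f x)%C) in E.
    transitivity ((P1 f x + Q1 f x) - (P2 f x + Q2 f x))%C; [ring | rewrite E; ring].
Qed.

(** * Bounded inverses and the resolvent near a simple pole *)

Definition linear_rel (Q : C20 -> C20 -> Prop) : Prop :=
  (forall f g f' g', Q f g -> Q f' g' -> Q (plus f f') (plus g g')) /\
  (forall c f g, Q f g -> Q (scal c f) (scal c g)).

Lemma linear_rel_minus Q f g f' g' : linear_rel Q -> Q f g -> Q f' g' ->
  Q (minus f f') (minus g g').
Proof. intros [Ha Hs] H H'; apply Ha; [exact H |]; apply (Hs (RtoC (-1)) f' g'), H'. Qed.

(** A solution of controlled norm is chosen for every g; uniqueness of solutions makes the choice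
    linear. *)
Lemma linear_rel_bounded_inverse (Q : C20 -> C20 -> Prop) : linear_rel Q ->
  (forall f, Q f zero -> f = zero) ->
  (exists M, 0 < M /\ forall g, exists f, Q f g /\ C20_norm f <= M * C20_norm g) ->
  exists R : C20 -> C20, is_linear R /\ (forall g, Q (R g) g) /\ forall f g, Q f g -> R g = f.
Proof.
  intros HQ Hinj [M [HM Hex]].
  assert (Huniq : forall f f' g, Q f g -> Q f' g -> f = f').
  { intros f f' g H H'.
    assert (E : minus f f' = zero).
    { apply Hinj; replace (zero : C20) with (minus g g) by vec.
      apply linear_rel_minus; auto. }
    replace f with (plus (minus f f') f') by vec; rewrite E; vec. }
  set (R := fun g => proj1_sig (constructive_indefinite_description _ (Hex g))).
  assert (HR : forall g, Q (R g) g /\ C20_norm (R g) <= M * C20_norm g).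
  { intros g; unfold R; destruct (constructive_indefinite_description _ (Hex g)); auto. }
  clearbody R; exists R; split; [split | split].
  - intros f g; apply (Huniq _ _ (plus f g)); [apply HR | apply HQ; apply HR].
  - intros c f; apply (Huniq _ _ (scal c f)); [apply HR | apply HQ; apply HR].
  - exists M; split; [exact HM | intros f; apply HR].
  - intros g; apply HR.
  - intros f g H; apply (Huniq _ _ g); [apply HR | exact H].
Qed.

Lemma resolvent_set_intro (A : C20 -> C20 -> Prop) (lambda : C) : linear_rel A ->
  (forall f, A f (scal lambda f) -> f = zero) ->
  (exists M, 0 < M /\ forall g : C20, exists f, A f (minus (scal lambda f) g) /\
     C20_norm f <= M * C20_norm g) ->
  resolvent_set A lambda.
Proof.
  intros HA Hinj [M [HM Hex]].
  destruct (linear_rel_bounded_inverse (fun f g => A f (minus (scal lambda f) g))) as [R [HL [H1 H2]]].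
  - split.
    + intros f g f' g' H H'.
      replace (minus (scal lambda (plus f f')) (plus g g'))
        with (plus (minus (scal lambda f) g) (minus (scal lambda f') g')) by vec.
      apply HA; assumption.
    + intros c f g H.
      replace (minus (scal lambda (scal c f)) (scal c g)) with (scal c (minus (scal lambda f) g)) by vec.
      apply HA, H.
  - intros f H; apply Hinj.
    replace (scal lambda f) with (minus (scal lambda f) zero) by vec; exact H.
  - exists M; auto.
  - exists R; split; [exact HL | split].
    + intros g; exists (minus (scal lambda (R g)) g); split; [apply H1 | vec].
    + intros f h H; apply H2; refine (eq_ind h (A f) H _ _); vec.
Qed.

Lemma is_linear_iter (S : C20 -> C20) n : is_linear S -> is_linear (fun f => Nat.iter n S f).
Proof.
  intros HS; induction n as [| n IH]; simpl.
  - apply (is_linear_id (V := C20_NormedModule)).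
  - apply (is_linear_comp (fun f => Nat.iter n S f) S); assumption.
Qed.

Lemma C20_norm_zero : C20_norm zero <= 0.
Proof.
  replace 0 with (0 + 0) by ring; apply norm_le_sum; intros s _;
    change (Rabs 0 <= 0); rewrite Rabs_R0; lra.
Qed.

Lemma is_linear_zero : is_linear (fun _ : C20 => zero : C20).
Proof.
  split.
  - intros f g; vec.
  - intros c f; vec.
  - exists 1; split; [lra |]; intros f; rewrite Rmult_1_l.
    apply Rle_trans with 0; [apply C20_norm_zero | apply C20_norm_ge0].
Qed.

Lemma is_linear_scal_comp (c : C) (S : C20 -> C20) : is_linear S -> is_linear (fun f => scal c (S f)).
Proof.
  intros [Hp Hs [M [HM Hn]]]; split.
  - intros f g; rewrite Hp; vec.
  - intros k f; rewrite Hs; vec.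
  - exists (Cmod c * M + 1); assert (Hc := Cmod_ge_0 c).
    split; [assert (0 <= Cmod c * M) by (apply Rmult_le_pos; lra); lra |]; intros f.
    assert (B := C20_norm_ge0 f).
    apply Rle_trans with (Cmod c * C20_norm (S f)); [apply C20_norm_scal |].
    apply Rle_trans with (Cmod c * (M * C20_norm f)); [apply Rmult_le_compat_l; [exact Hc | apply Hn] |].
    change (Cmod c * (M * C20_norm f) <= (Cmod c * M + 1) * C20_norm f); lra.
Qed.

Section SimplePole.

(** P is the projection onto the kernel of A that kills the range, and S the reduced resolvent: it
    inverts -A on the kernel of P and vanishes on the range of P. *)
Variables (A : C20 -> C20 -> Prop) (P S : C20 -> C20) (r : R).
Hypothesis HA : linear_rel A.
Hypotheses (HP : is_linear P) (HS : is_linear S).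
Hypothesis P_kernel : forall f, A (P f) zero.
Hypothesis P_range : forall f h, A f h -> P h = zero.
Hypothesis P_fix : forall f, A f zero -> P f = f.
Hypothesis S_inverse : forall f, A (S f) (minus (P f) f).
Hypothesis P_S : forall f, P (S f) = zero.
Hypothesis Hr : 0 < r.
Hypothesis Hres : forall z : C, 0 < Cmod z < r -> resolvent_set A z.

Definition pole_regular_coef (k : nat) (f : C20) : C20 :=
  scal ((RtoC (-1)) ^ k)%C (Nat.iter (Datatypes.S k) S f).

Definition pole_singular_coef (k : nat) (f : C20) : C20 :=
  match k with O => P f | _ => zero end.

Lemma S_P f : S (P f) = zero.
Proof.
  assert (H := S_inverse (P f)).
  rewrite (P_fix (P f) (P_kernel f)) in H.
  replace (minus (P f) (P f)) with (zero : C20) in H by vec.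
  rewrite <- (P_fix _ H); apply P_S.
Qed.

(** S h + f lies in the kernel of A, so P fixes it, while P (S h) = 0. *)
Lemma S_A f h : A f h -> S h = minus (P f) f.
Proof.
  intros H; assert (HSh := S_inverse h); rewrite (P_range f h H) in HSh.
  assert (H0 : A (plus (S h) f) zero).
  { replace (zero : C20) with (plus (minus zero h) h) by vec; apply HA; assumption. }
  assert (E := P_fix _ H0); rewrite (linear_plus P HP), P_S in E.
  replace (S h) with (minus (plus (S h) f) f) by vec; rewrite <- E.
  vec.
Qed.

(* R(z) = P/z + V with V = S - z S V, so that V is the sum of the Neumann series. *)
Lemma regular_part_eq (z : C) (R : C20 -> C20) (f : C20) : z <> 0%C -> is_resolvent A z R ->
  minus (R f) (scal (/ z)%C (P f)) =
  minus (S f) (scal z (S (minus (R f) (scal (/ z)%C (P f))))).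
Proof.
  intros Hz [_ [HR _]]; destruct (HR f) as [h [Hh Hf0]].
  set (g := R f) in *.
  assert (Hf : minus (scal z g) (h : C20) = f) by exact Hf0; clear Hf0.
  assert (E1 : P f = scal z (P g)).
  { rewrite <- Hf, C20_linear_minus, (P_range g h Hh), (linear_scal P HP) by exact HP; vec. }
  assert (E2 : S f = plus (scal z (S g)) (minus g (P g))).
  { rewrite <- Hf at 1; rewrite C20_linear_minus, (linear_scal S HS), (S_A g h Hh) by exact HS; vec. }
  assert (E3 : S (minus g (scal (/ z)%C (P f))) = S g).
  { rewrite C20_linear_minus, (linear_scal S HS), S_P by exact HS; vec. }
  rewrite E3, E2, E1; apply C20_eq; intros x _; simpl; field; exact Hz.
Qed.

Lemma simple_pole_laurent : exists r',
  resolvent_laurent A (RtoC 0) r' pole_regular_coef pole_singular_coef.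
Proof.
  destruct (is_linear_bounded S HS) as [M [HM HB]].
  assert (HM2 : 0 < / (2 * M)) by (apply Rinv_0_lt_compat; lra).
  (* On this disc |lambda| M <= 1/2, so the Neumann remainders halve at each step. *)
  exists (Rmin r (/ (2 * M))); split; [apply Rmin_pos; assumption |].
  split; [| split].
  - intros k; apply is_linear_scal_comp, (is_linear_iter S (Datatypes.S k)), HS.
  - intros [| k]; [exact HP | exact is_linear_zero].
  - intros lambda; replace (lambda - RtoC 0)%C with lambda by ring; intros Hl.
    assert (B1 := Rmin_l r (/ (2 * M))); assert (B2 := Rmin_r r (/ (2 * M))).
    assert (Hz : lambda <> 0%C) by (intros E; rewrite E, Cmod_0 in Hl; lra).
    destruct (Hres lambda ltac:(lra)) as [R HR].
    set (V := fun f : C20 => minus (R f : C20) (scal (/ lambda)%C (P f))).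
    assert (HV : forall f, V f = minus (S f) (scal lambda (S (V f))))
      by (intros f; apply regular_part_eq; assumption).
    assert (Hq : Cmod lambda * M <= 1 / 2).
    { apply Rle_trans with (/ (2 * M) * M); [apply Rmult_le_compat_r; lra |].
      right; field; lra. }
    assert (HLR : is_linear R) by apply HR.
    destruct (is_linear_bounded R HLR) as [MR [HMR HBR]].
    destruct (is_linear_bounded P HP) as [MP [HMP HBP]].
    assert (HVb : exists K, 0 < K /\ forall f, C20_norm (V f) <= K * C20_norm f).
    { exists (MR + Cmod (/ lambda) * MP + 1); assert (Hi := Cmod_ge_0 (/ lambda)).
      assert (0 <= Cmod (/ lambda) * MP) by (apply Rmult_le_pos; lra).
      split; [lra |]; intros f; assert (Hf := C20_norm_ge0 f).
      assert (T := C20_dist_triangle (R f) zero (scal (/ lambda)%C (P f))).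
      rewrite (C20_norm_sym zero) in T.
      assert (E0 : forall u : C20, C20_norm (minus u zero) = C20_norm u) by (intros u; f_equal; vec).
      rewrite !E0 in T.
      assert (T1 := HBR f); assert (T2 := HBP f).
      assert (T3 : C20_norm (scal (/ lambda)%C (P f)) <= Cmod (/ lambda) * (MP * C20_norm f)).
      { eapply Rle_trans; [apply C20_norm_scal |]; apply Rmult_le_compat_l; assumption. }
      unfold V; lra. }
    destruct HVb as [K [HK HVb]].
    exists R, V, (fun f => scal (/ lambda)%C (P f)).
    split; [exact HR | split; [| split]].
    + intros eps.
      (* Substituting V = S - lambda S V into itself n times leaves the remainder (-lambda)^(n+1)
         S^(n+1) V. *)
      assert (Hrem : forall n f, minus (V f)
        (sum_n (fun k => scal (pow_n (K := C_Ring) lambda k) (pole_regular_coef k f)) n) =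
        scal ((- lambda) ^ Datatypes.S n)%C (Nat.iter (Datatypes.S n) S (V f))).
      { intros n f; induction n as [| n IH].
        - rewrite sum_O; unfold pole_regular_coef; simpl Nat.iter.
          rewrite (HV f) at 1; change (@pow_n C_Ring) with Cpow.
          apply C20_eq; intros x _; simpl; ring.
        - rewrite sum_Sn.
          set (s := sum_n _ n) in *.
          assert (E : V f = plus s (scal ((- lambda) ^ Datatypes.S n)%C (Nat.iter (Datatypes.S n) S (V f)))).
          { rewrite <- IH; vec. }
          rewrite E at 1.
          assert (E2 : Nat.iter (Datatypes.S n) S (V f) =
            minus (Nat.iter (Datatypes.S (Datatypes.S n)) S f)
              (scal lambda (Nat.iter (Datatypes.S (Datatypes.S n)) S (V f)))).
          { assert (Hit := is_linear_iter S (Datatypes.S n) HS).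
            rewrite (HV f) at 1.
            rewrite (C20_linear_minus (fun g => Nat.iter (Datatypes.S n) S g)) by exact Hit.
            rewrite (linear_scal (fun g => Nat.iter (Datatypes.S n) S g) Hit).
            rewrite <- !Nat.iter_succ_r; reflexivity. }
          rewrite E2; unfold pole_regular_coef.
          set (w := Nat.iter (Datatypes.S (Datatypes.S n)) S (V f)).
          set (w' := Nat.iter (Datatypes.S (Datatypes.S n)) S f).
          change (@pow_n C_Ring) with Cpow.
          apply C20_eq; intros x _.
          change ((s x + (- lambda) ^ Datatypes.S n * (w' x + RtoC (-1) * (lambda * w x)) +
            RtoC (-1) * (s x + lambda ^ Datatypes.S n * (RtoC (-1) ^ Datatypes.S n * w' x)))%C =
            ((- lambda) ^ Datatypes.S (Datatypes.S n) * w x)%C).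
          replace (- lambda)%C with (RtoC (-1) * lambda)%C by ring.
          rewrite !Cpow_mult_l, !Cpow_S; ring. }
      destruct (pow_lt_1_zero (1 / 2)) with (y := eps / K) as [N HN].
      * rewrite Rabs_pos_eq; lra.
      * apply Rdiv_lt_0_compat; [apply cond_pos | exact HK].
      * exists N; intros n Hn f.
        change (C20_norm (minus (sum_n (fun k => scal (pow_n (K := C_Ring) lambda k)
          (pole_regular_coef k f)) n : C20) (V f)) <= eps * C20_norm f).
        rewrite C20_norm_sym, Hrem.
        assert (Hit : forall m g, C20_norm (scal ((- lambda) ^ m)%C (Nat.iter m S g)) <=
          (1 / 2) ^ m * C20_norm g).
        { intros m g; induction m as [| m IH].
          - simpl Nat.iter; eapply Rle_trans; [apply C20_norm_scal |].
            simpl; rewrite Cmod_1; lra.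
          - simpl Nat.iter.
            assert (E : scal ((- lambda) ^ Datatypes.S m)%C (S (Nat.iter m S g)) =
              scal (- lambda)%C (S (scal ((- lambda) ^ m)%C (Nat.iter m S g)))).
            { rewrite (linear_scal S HS), Cpow_S; vec. }
            rewrite E; eapply Rle_trans; [apply C20_norm_scal |]; rewrite Cmod_opp.
            assert (T := HB (scal ((- lambda) ^ m)%C (Nat.iter m S g))).
            set (y := C20_norm (scal ((- lambda) ^ m)%C (Nat.iter m S g))) in *.
            apply Rle_trans with (Cmod lambda * (M * y)); [apply Rmult_le_compat_l; [apply Cmod_ge_0 | exact T] |].
            assert (0 <= y) by apply C20_norm_ge0.
            rewrite <- Rmult_assoc; apply Rle_trans with (1 / 2 * y); [apply Rmult_le_compat_r; assumption |].
            simpl; lra. }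
        eapply Rle_trans; [apply Hit |].
        apply Rle_trans with ((1 / 2) ^ Datatypes.S n * (K * C20_norm f)).
        -- apply Rmult_le_compat_l; [apply pow_le; lra | apply HVb].
        -- specialize (HN (Datatypes.S n) ltac:(lia)); rewrite Rabs_pos_eq in HN by (apply pow_le; lra).
           rewrite <- Rmult_assoc; apply Rmult_le_compat_r; [apply C20_norm_ge0 |].
           apply Rle_trans with (eps / K * K); [apply Rmult_le_compat_r; lra | right; field; lra].
    (* The pole is simple: all singular partial sums already equal P f / lambda. *)
    + intros eps; exists O; intros n _ f.
      assert (E : sum_n (fun k => scal (pow_n (K := C_Ring) (/ lambda)%C (Datatypes.S k))
        (pole_singular_coef k f)) n = scal (/ lambda)%C (P f)).
      { induction n as [| n IH].
        - rewrite sum_O; apply C20_eq; intros x _; change (@pow_n C_Ring) with Cpow; simpl; ring.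
        - rewrite sum_Sn, IH; apply C20_eq; intros x _; change (@pow_n C_Ring) with Cpow; simpl; ring. }
      change (C20_norm (minus (sum_n (fun k => scal (pow_n (K := C_Ring) (/ lambda)%C (Datatypes.S k))
        (pole_singular_coef k f)) n) (scal (/ lambda)%C (P f))) <= eps * C20_norm f).
      rewrite E.
      change (C20_norm (minus (scal (/ lambda)%C (P f)) (scal (/ lambda)%C (P f))) <= eps * C20_norm f).
      replace (minus (scal (/ lambda)%C (P f)) (scal (/ lambda)%C (P f))) with (zero : C20) by vec.
      apply Rle_trans with 0; [apply C20_norm_zero |].
      apply Rmult_le_pos; [apply Rlt_le, cond_pos | apply C20_norm_ge0].
    + intros f; unfold V; vec.
Qed.

End SimplePole.

(** * The spectrum of the delay operator *)

Definition derC (f g : C20) : Prop := der (re f) (re g) /\ der (im f) (im g).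

Definition lagC (f : C20) : C := (lag (re f) 0, lag (im f) 0).

Lemma opA_derC f g : opA f g <-> derC f g /\ g 0 = lagC f.
Proof.
  rewrite opA_iff; unfold dom_eq, derC, lagC.
  change (re g 0) with (Re (g 0)); change (im g 0) with (Im (g 0)).
  destruct (g 0) as [a b]; simpl; split.
  - intros [[H1 ->] [H2 ->]]; auto.
  - intros [[H1 H2] E]; injection E; auto.
Qed.

Lemma der_lin p q p' q' c d : cont q -> cont q' -> der p q -> der p' q' ->
  der (fun x => c * p x + d * p' x) (fun x => c * q x + d * q' x).
Proof. intros Hq Hq' H H' x Hx; rewrite prim_lin, (H x Hx), (H' x Hx) by assumption; ring. Qed.

Lemma der_ext p q p' q' : (forall x, I20 x -> p' x = p x) -> (forall x, I20 x -> q' x = q x) ->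
  der p q -> der p' q'.
Proof.
  intros Hp Hq H x Hx; rewrite !Hp, (H x Hx) by (assumption || (unfold I20; lra)).
  f_equal; symmetry; apply (prim_ext_neg _ _ (-2)); [exact Hq | exact Hx].
Qed.

Lemma derC_linear : linear_rel derC.
Proof.
  split.
  - intros f g f' g' [H1 H2] [H1' H2']; split.
    + apply (der_ext _ _ _ _ (fun x _ => re_C20_plus f f' x) (fun x _ => re_C20_plus g g' x)).
      apply (der_ext (fun x => 1 * re f x + 1 * re f' x) (fun x => 1 * re g x + 1 * re g' x));
        [intros; ring | intros; ring | apply der_lin; auto].
    + apply (der_ext _ _ _ _ (fun x _ => im_C20_plus f f' x) (fun x _ => im_C20_plus g g' x)).
      apply (der_ext (fun x => 1 * im f x + 1 * im f' x) (fun x => 1 * im g x + 1 * im g' x));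
        [intros; ring | intros; ring | apply der_lin; auto].
  - intros c f g [H1 H2]; split.
    + apply (der_ext (fun x => Re c * re f x + - Im c * im f x) (fun x => Re c * re g x + - Im c * im g x));
        [intros; rewrite re_C20_scal; ring | intros; rewrite re_C20_scal; ring | apply der_lin; auto].
    + apply (der_ext (fun x => Re c * im f x + Im c * re f x) (fun x => Re c * im g x + Im c * re g x));
        [intros; rewrite im_C20_scal; ring | intros; rewrite im_C20_scal; ring | apply der_lin; auto].
Qed.

Lemma lag_ext p q : (forall x, I20 x -> p x = q x) -> lag p 0 = lag q 0.
Proof. intros H; unfold lag; rewrite !(prim_ext_neg p q (-2)); auto; lra. Qed.

Lemma lagC_plus f g : lagC (plus f g) = (lagC f + lagC g)%C.
Proof.
  unfold lagC, Cplus; simpl fst; simpl snd; f_equal.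
  - rewrite (lag_ext _ (fun x => 1 * re f x + 1 * re g x)) by (intros; rewrite re_C20_plus; ring).
    rewrite lag_lin by auto; ring.
  - rewrite (lag_ext _ (fun x => 1 * im f x + 1 * im g x)) by (intros; rewrite im_C20_plus; ring).
    rewrite lag_lin by auto; ring.
Qed.

Lemma lagC_scal c f : lagC (scal c f) = (c * lagC f)%C.
Proof.
  unfold lagC, Cmult; simpl fst; simpl snd; f_equal.
  - rewrite (lag_ext _ (fun x => Re c * re f x + - Im c * im f x)) by (intros; rewrite re_C20_scal; ring).
    rewrite lag_lin by auto; unfold Re, Im; ring.
  - rewrite (lag_ext _ (fun x => Re c * im f x + Im c * re f x)) by (intros; rewrite im_C20_scal; ring).
    rewrite lag_lin by auto; unfold Re, Im; ring.
Qed.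

Lemma lagC_bound f : Cmod (lagC f) <= 4 * C20_norm f.
Proof.
  eapply Rle_trans; [apply Cmod_le_sum |].
  replace (4 * C20_norm f) with (2 * C20_norm f + 2 * C20_norm f) by ring.
  apply Rplus_le_compat; apply lag_bound; auto; intros t Ht;
    [apply norm_re | apply norm_im]; unfold I20; lra.
Qed.

Lemma opA_linear : linear_rel opA.
Proof.
  split.
  - intros f g f' g' H H'; apply opA_derC in H; apply opA_derC in H'; apply opA_derC; split.
    + apply derC_linear; [apply H | apply H'].
    + rewrite lagC_plus, <- (proj2 H), <- (proj2 H'); reflexivity.
  - intros c f g H; apply opA_derC in H; apply opA_derC; split.
    + apply derC_linear, H.
    + rewrite lagC_scal, <- (proj2 H); reflexivity.
Qed.

Lemma derive_der (p q : R -> R) : (forall x, is_derive p x (q x)) -> cont q -> der p q.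
Proof.
  intros H Hq x _; unfold prim; rewrite (RInt_ftc p q 0 x H Hq); ring.
Qed.

(** * Solving the resolvent equation off the characteristic roots *)

Section Resolvent.

Variables a b : R.

Let lambda : C := (a, b).

Definition exp_re (x : R) : R := exp (a * x) * cos (b * x).
Definition exp_im (x : R) : R := exp (a * x) * sin (b * x).

Lemma exp_re_derive x : is_derive exp_re x (a * exp_re x - b * exp_im x).
Proof. unfold exp_re, exp_im; auto_derive; auto; ring. Qed.

Lemma exp_im_derive x : is_derive exp_im x (a * exp_im x + b * exp_re x).
Proof. unfold exp_re, exp_im; auto_derive; auto; ring. Qed.

Lemma cont_exp_re : cont exp_re.
Proof. exact (cont_derive _ _ exp_re_derive). Qed.

Lemma cont_exp_im : cont exp_im.
Proof. exact (cont_derive _ _ exp_im_derive). Qed.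

Definition exp_fun : C20 := mkC exp_re exp_im cont_exp_re cont_exp_im.

Lemma derC_exp : derC exp_fun (scal lambda exp_fun).
Proof.
  split.
  - apply (der_ext exp_re (fun x => a * exp_re x - b * exp_im x)).
    + intros; apply re_mkC; assumption.
    + intros; rewrite re_C20_scal; unfold exp_fun; rewrite re_mkC, im_mkC; auto.
    + apply derive_der; [apply exp_re_derive |].
      apply cont_minus; apply cont_mult; auto using cont_const, cont_exp_re, cont_exp_im.
  - apply (der_ext exp_im (fun x => a * exp_im x + b * exp_re x)).
    + intros; apply im_mkC; assumption.
    + intros; rewrite im_C20_scal; unfold exp_fun; rewrite re_mkC, im_mkC; auto.
    + apply derive_der; [apply exp_im_derive |].
      apply cont_plus; apply cont_mult; auto using cont_const, cont_exp_re, cont_exp_im.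
Qed.

Lemma exp_fun_0 : exp_fun 0 = RtoC 1.
Proof.
  simpl; rewrite clamp_id by (unfold I20; lra); unfold exp_re, exp_im.
  rewrite !Rmult_0_r, exp_0, cos_0, sin_0, Rmult_1_l, Rmult_0_r; reflexivity.
Qed.

(** Uniqueness for w' = lambda w: the function e^(-2ax) |w|^2 is constant and vanishes at 0. *)
Lemma derC_homogeneous w : derC w (scal lambda w) -> w 0 = RtoC 0 -> w = zero.
Proof.
  intros [H1 H2] H0.
  set (d1 := fun x => a * re w x + - b * im w x); set (d2 := fun x => a * im w x + b * re w x).
  assert (C1 : cont d1) by (apply cont_lin; auto).
  assert (C2 : cont d2) by (apply cont_lin; auto).
  assert (W1 : forall x, I20 x -> re w x = prim d1 x).
  { intros x Hx; rewrite (H1 x Hx); change (re w 0) with (Re (w 0)); rewrite H0; simpl Re.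
    rewrite Rplus_0_l; apply prim_ext_all; intros s; rewrite re_C20_scal; unfold d1; simpl; ring. }
  assert (W2 : forall x, I20 x -> im w x = prim d2 x).
  { intros x Hx; rewrite (H2 x Hx); change (im w 0) with (Im (w 0)); rewrite H0; simpl Im.
    rewrite Rplus_0_l; apply prim_ext_all; intros s; rewrite im_C20_scal; unfold d2; simpl; ring. }
  (* w enters through the primitives of [d1] and [d2], which are differentiable on the whole line
     and agree with w on [-2,0]. *)
  set (N := fun x => exp (- 2 * a * x) * (prim d1 x * prim d1 x + prim d2 x * prim d2 x)).
  assert (HN : forall x, I20 x -> is_derive N x 0).
  { intros x Hx; unfold N; auto_derive.
    - repeat split; eexists; apply prim_derive; assumption.
    - replace (Derive (fun x => prim d1 x) x) with (d1 x)
        by (symmetry; apply is_derive_unique, prim_derive, C1).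
      replace (Derive (fun x => prim d2 x) x) with (d2 x)
        by (symmetry; apply is_derive_unique, prim_derive, C2).
      assert (V1 : d1 x = a * prim d1 x - b * prim d2 x)
        by (rewrite <- W1, <- W2 by exact Hx; unfold d1; ring).
      assert (V2 : d2 x = a * prim d2 x + b * prim d1 x)
        by (rewrite <- W1, <- W2 by exact Hx; unfold d2; ring).
      rewrite V1, V2; ring. }
  apply C20_ext; intros x Hx.
  assert (E : N 0 - N x = 0 - 0).
  { apply (derive_eq N (fun _ => 0) (fun _ => 0) x 0).
    - apply Hx.
    - intros t Ht; apply HN; unfold I20 in *; lra.
    - intros t _; apply (is_derive_const (K := R_AbsRing) (V := R_NormedModule)). }
  assert (N0 : N 0 = 0) by (unfold N; rewrite !prim_0; ring).
  assert (Nx : prim d1 x * prim d1 x + prim d2 x * prim d2 x = 0).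
  { assert (He := exp_pos (- 2 * a * x)).
    apply Rmult_eq_reg_l with (exp (- 2 * a * x)); [| lra].
    change (N x = exp (- 2 * a * x) * 0); lra. }
  rewrite (W1 x Hx), (W2 x Hx), re_C20_zero, im_C20_zero.
  apply Rplus_sqr_eq_0; exact Nx.
Qed.

(** An eigenvector is f(0) e^(lambda x), and the boundary condition then reads f(0) (lambda - lagC
    exp_fun) = 0. *)
Lemma opA_eigen f : lambda <> lagC exp_fun -> opA f (scal lambda f) -> f = zero.
Proof.
  intros Hd H; apply opA_derC in H; destruct H as [HD Hb].
  assert (E : f = scal (f 0) exp_fun).
  { assert (W : minus f (scal (f 0) exp_fun) = zero).
    { apply derC_homogeneous.
      - replace (scal lambda (minus f (scal (f 0) exp_fun)))
          with (minus (scal lambda f) (scal (f 0) (scal lambda exp_fun))) by vec.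
        apply linear_rel_minus; [exact derC_linear | exact HD | apply derC_linear, derC_exp].
      - change ((f 0 + RtoC (-1) * (f 0 * exp_fun 0))%C = RtoC 0); rewrite exp_fun_0; ring. }
    replace f with (plus (minus f (scal (f 0) exp_fun)) (scal (f 0) exp_fun)) at 1 by vec.
    rewrite W; vec. }
  rewrite E, lagC_scal in Hb.
  change ((lambda * (f 0 * exp_fun 0))%C = (f 0 * lagC exp_fun)%C) in Hb.
  rewrite exp_fun_0 in Hb.
  assert (F : (f 0 * (lambda - lagC exp_fun) = 0)%C).
  { transitivity (lambda * (f 0 * 1) - f 0 * lagC exp_fun)%C; [ring | rewrite Hb; ring]. }
  assert (F0 : f 0 = 0%C).
  { apply NNPP; intros Hf; apply Hd.
    apply (f_equal (fun z => / f 0 * z)%C) in F.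
    rewrite Cmult_assoc, Cinv_l, Cmult_1_l in F by exact Hf.
    transitivity ((lambda - lagC exp_fun) + lagC exp_fun)%C; [ring | rewrite F; ring]. }
  rewrite E, F0; vec.
Qed.

(** With c = 1 or -1 one product rule serves both components of the next construction. *)
Lemma is_derive_mult2 (e f u v : R -> R) x de df du dv c :
  is_derive e x de -> is_derive f x df -> is_derive u x du -> is_derive v x dv ->
  is_derive (fun y => c * (e y * u y) - f y * v y) x
    (c * (de * u x + e x * du) - (df * v x + f x * dv)).
Proof.
  intros He Hf Hu Hv; auto_derive.
  - repeat split; eexists; eassumption.
  - replace (Derive (fun y => e y) x) with de by (symmetry; apply is_derive_unique, He).
    replace (Derive (fun y => f y) x) with df by (symmetry; apply is_derive_unique, Hf).
    replace (Derive (fun y => u y) x) with du by (symmetry; apply is_derive_unique, Hu).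
    replace (Derive (fun y => v y) x) with dv by (symmetry; apply is_derive_unique, Hv).
    ring.
Qed.

(** Variation of constants: h(x) = - e^(lambda x) times the integral of e^(-lambda s) g(s) from 0 to
    x. *)
Lemma inhomogeneous_solution : exists K, 0 < K /\ forall g : C20, exists h : C20,
  derC h (minus (scal lambda h) g) /\ h 0 = RtoC 0 /\ C20_norm h <= K * C20_norm g.
Proof.
  (* k bounds |e^(lambda x)| and |e^(-lambda x)| on [-2,0]. Each integrand is at most 2 k m, each
     primitive 4 k m, and each of the four products 4 k^2 m, whence 16 k^2. *)
  set (k := exp (2 * Rabs a)).
  assert (Hk : forall x, I20 x -> exp (a * x) <= k /\ exp (- a * x) <= k).
  { intros x [Hx1 Hx2].
    assert (Hle : forall s t, s <= t -> exp s <= exp t).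
    { intros s t [Hlt | ->]; [apply Rlt_le, exp_increasing, Hlt | apply Rle_refl]. }
    split; apply Hle; unfold Rabs; destruct (Rcase_abs a); nra. }
  assert (k0 : 0 < k) by apply exp_pos.
  exists (16 * k * k); split; [repeat apply Rmult_lt_0_compat; lra |]; intros g.
  set (m := C20_norm g); assert (m0 : 0 <= m) by apply C20_norm_ge0.
  (* [p1] and [p2] are the real and imaginary parts of e^(-lambda s) g(s); [h1] and [h2] are those
     of h. *)
  set (p1 := fun s => exp (- a * s) * (cos (b * s) * re g s + sin (b * s) * im g s)).
  set (p2 := fun s => exp (- a * s) * (cos (b * s) * im g s - sin (b * s) * re g s)).
  assert (Cl : forall c, cont (fun s => c * s)) by (intros c; apply cont_mult; [apply cont_const | apply cont_id]).
  assert (Ce : cont (fun s => exp (- a * s))) by (apply (cont_comp exp); [apply cont_exp | apply Cl]).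
  assert (Cc : cont (fun s => cos (b * s))) by (apply (cont_comp cos); [apply cont_cos | apply Cl]).
  assert (Cs : cont (fun s => sin (b * s))) by (apply (cont_comp sin); [apply cont_sin | apply Cl]).
  assert (C1 : cont p1).
  { apply cont_mult; [exact Ce |]; apply cont_plus; apply cont_mult; auto. }
  assert (C2 : cont p2).
  { apply cont_mult; [exact Ce |]; apply cont_minus; apply cont_mult; auto. }
  set (h1 := fun x => 1 * (exp_im x * prim p2 x) - exp_re x * prim p1 x).
  set (h2 := fun x => -1 * (exp_re x * prim p2 x) - exp_im x * prim p1 x).
  assert (Rot : forall x, exp_re x * p1 x - exp_im x * p2 x = re g x /\
    exp_re x * p2 x + exp_im x * p1 x = im g x).
  { intros x; unfold exp_re, exp_im, p1, p2.
    assert (He : exp (a * x) * exp (- a * x) = 1).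
    { rewrite <- exp_plus; replace (a * x + - a * x) with 0 by ring; apply exp_0. }
    assert (Ht := sin2_cos2 (b * x)); unfold Rsqr in Ht.
    set (E := exp (a * x)) in *; set (E' := exp (- a * x)) in *.
    set (s := sin (b * x)) in *; set (c := cos (b * x)) in *; split.
    - transitivity (E * E' * ((s * s + c * c) * re g x)); [ring | rewrite He, Ht; ring].
    - transitivity (E * E' * ((s * s + c * c) * im g x)); [ring | rewrite He, Ht; ring]. }
  assert (D1 : forall x, is_derive h1 x (a * h1 x - b * h2 x - re g x)).
  { intros x.
    replace (a * h1 x - b * h2 x - re g x) with
      (1 * ((a * exp_im x + b * exp_re x) * prim p2 x + exp_im x * p2 x) -
        ((a * exp_re x - b * exp_im x) * prim p1 x + exp_re x * p1 x))
      by (rewrite <- (proj1 (Rot x)); unfold h1, h2; ring).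
    apply (is_derive_mult2 exp_im exp_re (prim p2) (prim p1));
      [apply exp_im_derive | apply exp_re_derive | apply prim_derive, C2 | apply prim_derive, C1]. }
  assert (D2 : forall x, is_derive h2 x (a * h2 x + b * h1 x - im g x)).
  { intros x.
    replace (a * h2 x + b * h1 x - im g x) with
      (-1 * ((a * exp_re x - b * exp_im x) * prim p2 x + exp_re x * p2 x) -
        ((a * exp_im x + b * exp_re x) * prim p1 x + exp_im x * p1 x))
      by (rewrite <- (proj2 (Rot x)); unfold h1, h2; ring).
    apply (is_derive_mult2 exp_re exp_im (prim p2) (prim p1));
      [apply exp_re_derive | apply exp_im_derive | apply prim_derive, C2 | apply prim_derive, C1]. }
  assert (Ch1 : cont h1) by exact (cont_derive _ _ D1).
  assert (Ch2 : cont h2) by exact (cont_derive _ _ D2).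
  exists (mkC h1 h2 Ch1 Ch2); split; [split | split].
  - apply (der_ext h1 (fun x => a * h1 x - b * h2 x - re g x)).
    + intros; apply re_mkC; assumption.
    + intros; rewrite re_C20_minus, re_C20_scal, re_mkC, im_mkC by assumption; reflexivity.
    + apply derive_der; [exact D1 |].
      apply cont_minus; [apply cont_minus; apply cont_mult; auto using cont_const | auto].
  - apply (der_ext h2 (fun x => a * h2 x + b * h1 x - im g x)).
    + intros; apply im_mkC; assumption.
    + intros; rewrite im_C20_minus, im_C20_scal, re_mkC, im_mkC by assumption; reflexivity.
    + apply derive_der; [exact D2 |].
      apply cont_minus; [apply cont_plus; apply cont_mult; auto using cont_const | auto].
  - simpl; rewrite clamp_id by (unfold I20; lra); unfold h1, h2; rewrite !prim_0.
    unfold RtoC; f_equal; ring.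
  - assert (Bp : forall s, I20 s -> Rabs (p1 s) <= 2 * k * m /\ Rabs (p2 s) <= 2 * k * m).
    { intros s Hs; unfold p1, p2.
      assert (G1 := norm_re g s Hs); assert (G2 := norm_im g s Hs); fold m in G1, G2.
      assert (T1 : Rabs (cos (b * s)) <= 1) by (apply Rabs_le_between, COS_bound).
      assert (T2 : Rabs (sin (b * s)) <= 1) by (apply Rabs_le_between, SIN_bound).
      assert (Q : forall u v, Rabs u <= 1 -> Rabs v <= m -> Rabs (u * v) <= m).
      { intros u v Hu Hv; rewrite Rabs_mult, <- (Rmult_1_l m).
        apply Rmult_le_compat; auto using Rabs_pos. }
      assert (He := exp_pos (- a * s)); assert (He2 := proj2 (Hk s Hs)).
      rewrite !Rabs_mult, (Rabs_pos_eq (exp (- a * s))) by lra.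
      replace (2 * k * m) with (k * (m + m)) by ring.
      split; apply Rmult_le_compat; try lra; try apply Rabs_pos.
      - eapply Rle_trans; [apply Rabs_triang |]; apply Rplus_le_compat; apply Q; auto.
      - eapply Rle_trans; [apply Rabs_triang |]; rewrite Rabs_Ropp.
        apply Rplus_le_compat; apply Q; auto. }
    assert (Bprim : forall x, I20 x -> Rabs (prim p1 x) <= 4 * k * m /\ Rabs (prim p2 x) <= 4 * k * m).
    { intros x Hx; unfold I20 in Hx.
      assert (km : 0 <= 2 * k * m) by (apply Rmult_le_pos; lra).
      assert (L : forall p, cont p -> (forall s, I20 s -> Rabs (p s) <= 2 * k * m) ->
        Rabs (prim p x) <= 4 * k * m).
      { intros p Cp Hp.
        assert (A := prim_abs_le p x 0 (2 * k * m) Cp ltac:(lra) ltac:(intros; apply Hp; unfold I20; lra)).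
        rewrite prim_0, Rminus_0_l, Rabs_Ropp in A; eapply Rle_trans; [exact A |].
        replace (4 * k * m) with (2 * (2 * k * m)) by ring; apply Rmult_le_compat_r; lra. }
      split; apply L; auto; intros; apply Bp; auto. }
    assert (Be : forall x, I20 x -> Rabs (exp_re x) <= k /\ Rabs (exp_im x) <= k).
    { intros x Hx; unfold exp_re, exp_im; rewrite !Rabs_mult.
      assert (He := exp_pos (a * x)); assert (He2 := proj1 (Hk x Hx)).
      rewrite (Rabs_pos_eq (exp (a * x))) by lra.
      split; rewrite <- (Rmult_1_r k); apply Rmult_le_compat; try lra; try apply Rabs_pos;
        apply Rabs_le_between; [apply COS_bound | apply SIN_bound]. }
    assert (Bm : forall u v, Rabs u <= k -> Rabs v <= 4 * k * m -> Rabs (u * v) <= 4 * k * k * m).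
    { intros u v Hu Hv; rewrite Rabs_mult; replace (4 * k * k * m) with (k * (4 * k * m)) by ring.
      apply Rmult_le_compat; auto using Rabs_pos. }
    replace (16 * k * k * m) with ((4 * k * k * m + 4 * k * k * m) + (4 * k * k * m + 4 * k * k * m)) by ring.
    apply norm_le_sum; intros x Hx; destruct (Bprim x Hx) as [P1' P2']; destruct (Be x Hx) as [E1 E2].
    + rewrite re_mkC by exact Hx; unfold h1; rewrite Rmult_1_l.
      eapply Rle_trans; [apply Rabs_triang |]; rewrite Rabs_Ropp.
      apply Rplus_le_compat; apply Bm; assumption.
    + rewrite im_mkC by exact Hx; unfold h2.
      replace (-1 * (exp_re x * prim p2 x) - exp_im x * prim p1 x)
        with (- (exp_re x * prim p2 x + exp_im x * prim p1 x)) by ring.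
      rewrite Rabs_Ropp; eapply Rle_trans; [apply Rabs_triang |].
      apply Rplus_le_compat; apply Bm; assumption.
Qed.

(** The solutions of f' = lambda f - g are h + c e^(lambda x); the boundary condition is one linear
    equation for c, with coefficient delta. *)
Lemma opA_resolvent_set : lambda <> lagC exp_fun -> resolvent_set opA lambda.
Proof.
  intros Hd; apply resolvent_set_intro.
  - exact opA_linear.
  - intros f; apply opA_eigen, Hd.
  - set (delta := (lambda - lagC exp_fun)%C).
    assert (Hdelta : delta <> 0%C).
    { intros E; apply Hd; transitivity (delta + lagC exp_fun)%C;
        [unfold delta; ring | rewrite E; ring]. }
    assert (Hdm : 0 < Cmod delta) by apply Cmod_gt_0, Hdelta.
    destruct inhomogeneous_solution as [K [HK Hsol]].
    exists (K + (1 + 4 * K) / Cmod delta * C20_norm exp_fun).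
    assert (Hn := C20_norm_ge0 exp_fun).
    assert (Hq : 0 < (1 + 4 * K) / Cmod delta) by (apply Rdiv_lt_0_compat; lra).
    assert (0 <= (1 + 4 * K) / Cmod delta * C20_norm exp_fun) by (apply Rmult_le_pos; lra).
    split; [lra |]; intros g; destruct (Hsol g) as [h [HD [H0 HB]]].
    set (c := ((g 0 + lagC h) / delta)%C).
    exists (plus h (scal c exp_fun)); split.
    + apply opA_derC; split.
      * replace (minus (scal lambda (plus h (scal c exp_fun))) g)
          with (plus (minus (scal lambda h) g) (scal c (scal lambda exp_fun))) by vec.
        apply derC_linear; [exact HD | apply derC_linear, derC_exp].
      * rewrite lagC_plus, lagC_scal.
        change ((lambda * (h 0 + c * exp_fun 0) + RtoC (-1) * g 0)%C = (lagC h + c * lagC exp_fun)%C).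
        rewrite H0, exp_fun_0.
        assert (Ec : (c * delta = g 0 + lagC h)%C) by (unfold c; field; exact Hdelta).
        transitivity (c * delta + c * lagC exp_fun - g 0)%C; [unfold delta; ring | rewrite Ec; ring].
    + eapply Rle_trans; [apply C20_norm_triangle |].
      rewrite Rmult_plus_distr_r; apply Rplus_le_compat; [exact HB |].
      eapply Rle_trans; [apply C20_norm_scal |].
      replace ((1 + 4 * K) / Cmod delta * C20_norm exp_fun * C20_norm g)
        with (((1 + 4 * K) * C20_norm g / Cmod delta) * C20_norm exp_fun) by (field; lra).
      apply Rmult_le_compat_r; [exact Hn |].
      unfold c; rewrite Cmod_div by exact Hdelta.
      apply Rmult_le_compat_r; [apply Rlt_le, Rinv_0_lt_compat, Hdm |].
      eapply Rle_trans; [apply Cmod_triangle |].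
      assert (A1 := C20_norm_ge g 0 ltac:(unfold I20; lra)); assert (A2 := lagC_bound h).
      lra.
Qed.

(* lambda Phi(e_lambda) = Phi(e_lambda') is computed by the fundamental theorem of calculus. *)
Lemma characteristic_eq : lambda = lagC exp_fun ->
  (lambda * lambda = 2 * exp_fun (-1) - exp_fun (-1) * exp_fun (-1) - 1)%C.
Proof.
  intros E; rewrite E at 2; rewrite <- lagC_scal.
  destruct derC_exp as [H1 H2].
  assert (Hx1 : I20 (-1)) by (unfold I20; lra); assert (Hx2 : I20 (-2)) by (unfold I20; lra).
  assert (V : exp_fun (-1) = (exp_re (-1), exp_im (-1))) by (simpl; rewrite clamp_id by exact Hx1; reflexivity).
  assert (A1 := H1 (-1) Hx1); assert (A2 := H1 (-2) Hx2).
  assert (B1 := H2 (-1) Hx1); assert (B2 := H2 (-2) Hx2).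
  unfold exp_fun at 1 2 in A1; unfold exp_fun at 1 2 in A2.
  unfold exp_fun at 1 2 in B1; unfold exp_fun at 1 2 in B2.
  rewrite !re_mkC in A1, A2 by (unfold I20; lra).
  rewrite !im_mkC in B1, B2 by (unfold I20; lra).
  rewrite V; unfold lagC, lag; rewrite !prim_0.
  replace (0 - 1) with (-1) by ring; replace (0 - 2) with (-2) by ring.
  replace (prim (re (scal lambda exp_fun)) (-1)) with (exp_re (-1) - exp_re 0) by lra.
  replace (prim (re (scal lambda exp_fun)) (-2)) with (exp_re (-2) - exp_re 0) by lra.
  replace (prim (im (scal lambda exp_fun)) (-1)) with (exp_im (-1) - exp_im 0) by lra.
  replace (prim (im (scal lambda exp_fun)) (-2)) with (exp_im (-2) - exp_im 0) by lra.
  assert (R0 : exp_re 0 = 1) by (unfold exp_re; rewrite !Rmult_0_r, exp_0, cos_0; ring).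
  assert (I0 : exp_im 0 = 0) by (unfold exp_im; rewrite !Rmult_0_r, exp_0, sin_0; ring).
  assert (Ex : exp (a * -2) = exp (a * -1) * exp (a * -1)) by (rewrite <- exp_plus; f_equal; ring).
  assert (R2 : exp_re (-2) = exp_re (-1) * exp_re (-1) - exp_im (-1) * exp_im (-1)).
  { unfold exp_re, exp_im; rewrite Ex; replace (b * -2) with (b * -1 + b * -1) by ring.
    rewrite cos_plus; ring. }
  assert (I2 : exp_im (-2) = 2 * exp_re (-1) * exp_im (-1)).
  { unfold exp_re, exp_im; rewrite Ex; replace (b * -2) with (b * -1 + b * -1) by ring.
    rewrite sin_plus; ring. }
  rewrite R0, I0, R2, I2.
  unfold Cminus, Cplus, Copp, Cmult, RtoC; simpl; f_equal; ring.
Qed.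

End Resolvent.

(** The two equations say lambda = i (1 - e^(-lambda)) for lambda = a + ib. *)
Lemma characteristic_root_zero a b : a = - (exp (- a) * sin b) -> b = 1 - exp (- a) * cos b ->
  0 <= a \/ Rabs b < 1 -> a = 0 /\ b = 0.
Proof.
  intros Ha Hb Hab.
  assert (He := exp_pos (- a)); assert (HPI := PI2_1).
  assert (Hc := COS_bound b); assert (Hs := SIN_bound b).
  destruct (Rle_dec 0 a) as [a0 | a0].
  - assert (He1 : exp (- a) <= 1).
    { rewrite <- exp_0; destruct (Req_dec a 0) as [-> | Hn].
      - rewrite Ropp_0; apply Rle_refl.
      - apply Rlt_le, exp_increasing; lra. }
    (* Since 2 < PI, sin b >= 0 and the first equation forces a <= 0; then a = 0 and sin b = 0 leave
       only b = 0. *)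
    assert (b0 : 0 <= b <= 2) by nra.
    assert (s0 : 0 <= sin b) by (apply sin_ge_0; lra).
    assert (az : a = 0) by nra; split; [exact az |].
    apply Rle_antisym; [| lra]; apply Rnot_lt_le; intros Hlt.
    assert (0 < sin b) by (apply sin_gt_0; lra).
    assert (0 < exp (- a) * sin b) by (apply Rmult_lt_0_compat; lra); lra.
  - exfalso; destruct Hab as [Hab | Hab]; [lra |].
    apply Rabs_def2 in Hab.
    assert (He1 : 1 <= exp (- a)) by (assert (A := exp_ineq1 (- a) ltac:(lra)); lra).
    assert (b0 : 0 < b).
    { apply Rnot_le_lt; intros Hle.
      assert (A : 0 <= sin (- b)) by (apply sin_ge_0; lra).
      rewrite sin_neg in A; nra. }
    assert (c0 : 0 < cos b) by (apply cos_gt_0; lra).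
    (* With exp (- a) >= 1 the second equation gives b <= 1 - cos b <= b^2 / 2, impossible for 0 < b
       < 1. *)
    assert (Hcos : 1 - b * b / 2 <= cos b).
    { replace b with (2 * (b / 2)) at 3 by field; rewrite cos_2a_sin.
      assert (A := sin_lt_x (b / 2) ltac:(lra)).
      assert (B : 0 < sin (b / 2)) by (apply sin_gt_0; lra); nra. }
    nra.
Qed.

Lemma opA_resolvent (lambda : C) : lambda <> 0%C -> 0 <= Re lambda \/ Rabs (Im lambda) < 1 ->
  resolvent_set opA lambda.
Proof.
  destruct lambda as [a b]; simpl; intros Hn Hab; apply opA_resolvent_set; intros E.
  apply Hn; apply characteristic_eq in E.
  assert (Hx1 : I20 (-1)) by (unfold I20; lra).
  assert (V : exp_fun a b (-1) = (exp (- a) * cos b, - (exp (- a) * sin b))).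
  { simpl; rewrite clamp_id by exact Hx1; unfold exp_re, exp_im.
    replace (a * -1) with (- a) by ring; replace (b * -1) with (- b) by ring.
    rewrite cos_neg, sin_neg; f_equal; ring. }
  rewrite V in E; set (X := exp (- a) * cos b) in *; set (Y := exp (- a) * sin b) in *.
  set (z := (X, - Y) : C) in E; set (l := (a, b) : C) in E.
  (* The characteristic equation l^2 + (1 - z)^2 = 0 factors into l = i (1 - z) and l = - i (1 -
     z). *)
  assert (F : ((l - Ci * (1 - z)) * (l + Ci * (1 - z)) = 0)%C).
  { transitivity (l * l - (2 * z - z * z - 1))%C; [| rewrite E; ring].
    unfold l, z, Ci, Cminus, Cplus, Copp, Cmult, RtoC; simpl; f_equal; ring. }
  assert (Hfac : forall u v : C, (u * v = 0)%C -> u = 0%C \/ v = 0%C).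
  { intros u v H; destruct (classic (u = 0%C)) as [Hu | Hu]; [left; exact Hu | right].
    transitivity (/ u * (u * v))%C; [field; exact Hu | rewrite H; ring]. }
  destruct (Hfac _ _ F) as [G | G]; injection G as G1 G2; simpl in G1, G2.
  - destruct (characteristic_root_zero a b) as [-> ->]; [fold Y; lra | fold X; lra | exact Hab | reflexivity].
  (* Complex conjugation turns the second factor into the first, with -b in place of b. *)
  - destruct (characteristic_root_zero a (- b)) as [Ea Eb].
    + rewrite sin_neg; fold Y; unfold Y in *; lra.
    + rewrite cos_neg; fold X; unfold X in *; lra.
    + rewrite Rabs_Ropp; exact Hab.
    + replace b with 0 by lra; rewrite Ea; reflexivity.
Qed.

(** * The spectral projection *)

Definition proj (f : C20) : C20 :=
  mkC (fun _ => psi (re f)) (fun _ => psi (im f)) (cont_const _) (cont_const _).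

Lemma re_proj f x : re (proj f) x = psi (re f).
Proof. reflexivity. Qed.

Lemma im_proj f x : im (proj f) x = psi (im f).
Proof. reflexivity. Qed.

Lemma proj_linear : is_linear proj.
Proof.
  split.
  - intros f g; apply C20_ext; intros x _.
    rewrite re_C20_plus, im_C20_plus, !re_proj, !im_proj; split.
    + rewrite (psi_ext _ (fun x => 1 * re f x + 1 * re g x)) by (intros; rewrite re_C20_plus; ring).
      rewrite psi_lin by auto; ring.
    + rewrite (psi_ext _ (fun x => 1 * im f x + 1 * im g x)) by (intros; rewrite im_C20_plus; ring).
      rewrite psi_lin by auto; ring.
  - intros c f; apply C20_ext; intros x _.
    rewrite re_C20_scal, im_C20_scal, !re_proj, !im_proj; split.
    + rewrite (psi_ext _ (fun x => Re c * re f x + - Im c * im f x)) by (intros; rewrite re_C20_scal; ring).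
      rewrite psi_lin by auto; ring.
    + rewrite (psi_ext _ (fun x => Re c * im f x + Im c * re f x)) by (intros; rewrite im_C20_scal; ring).
      rewrite psi_lin by auto; ring.
  - exists 2; split; [lra |]; intros f.
    apply Rle_trans with (C20_norm f + C20_norm f).
    + apply norm_le_sum; intros x _; [rewrite re_proj | rewrite im_proj];
        apply psi_abs_le; auto; intros s Hs; [apply norm_re | apply norm_im]; exact Hs.
    + change (C20_norm f + C20_norm f <= 2 * C20_norm f); lra.
Qed.

Lemma lag_const c : lag (fun _ => c) 0 = 0.
Proof. unfold lag; rewrite !prim_const; ring. Qed.

(** Both sides are the second difference W(0) - 2 W(-1) + W(-2) of a second primitive W of q. *)
Lemma avg_lag_prim q : cont q -> avg q 0 = - lag (prim q) 0.
Proof.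
  intros Hq; unfold avg; rewrite prim_0.
  assert (HU := cont_prim q Hq).
  rewrite (prim_ext_all (unit_int q) (fun s => 1 * prim q s + -1 * prim q (s + - (1))))
    by (intros s; unfold unit_int, Rminus; ring).
  rewrite prim_lin by (try exact HU; apply (cont_shift (prim q)), HU).
  rewrite prim_shift by exact HU; unfold lag; rewrite prim_0.
  replace (0 - 1) with (- (1)) by ring; replace (0 - 2) with (- (1) + - (1)) by ring; ring.
Qed.

(** Constants do not affect [lag], so the boundary condition reads q 0 = lag (prim q) 0 = - avg q
    0. *)
Lemma psi_derivative p q : cont q -> dom_eq p q -> psi q = 0.
Proof.
  intros Hq [Hd Hb]; unfold psi; rewrite avg_lag_prim, Hb by exact Hq.
  rewrite (lag_ext p (fun x => 1 * prim q x + p 0 * (fun _ => 1) x)).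
  - rewrite lag_lin, lag_const by (auto using cont_prim, cont_const); field.
  - intros x Hx; rewrite (Hd x Hx); ring.
Qed.

Lemma psi_eq_0 (p : R -> R) : (forall x, I20 x -> p x = 0) -> psi p = 0.
Proof. intros H; rewrite (psi_ext p (fun _ => 0)) by exact H; apply psi_const. Qed.

Lemma proj_kernel f : opA (proj f) zero.
Proof.
  assert (D : forall c p, (forall x, p x = c) -> dom_eq p (fun _ => 0)).
  { intros c p Hp; split.
    - intros x _; rewrite !Hp, prim_const; ring.
    - rewrite (lag_ext p (fun _ => c)) by (intros; apply Hp); rewrite lag_const; reflexivity. }
  apply opA_iff; split; [apply (D (psi (re f))) | apply (D (psi (im f)))]; reflexivity.
Qed.

Lemma proj_range f h : opA f h -> proj h = zero.
Proof.
  intros H; apply opA_iff in H; destruct H as [H1 H2].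
  apply C20_ext; intros x _; rewrite re_proj, im_proj, re_C20_zero, im_C20_zero.
  split; [apply (psi_derivative (re f)) | apply (psi_derivative (im f))]; auto.
Qed.

Lemma proj_fix f : opA f zero -> proj f = f.
Proof.
  intros H; apply opA_iff in H; destruct H as [[H1 _] [H2 _]].
  assert (E : forall p q, der p q -> (forall x, q x = 0) -> forall x, I20 x -> psi p = p x).
  { intros p q Hd Hq.
    assert (Hc : forall x, I20 x -> p x = p 0).
    { intros x Hx; rewrite (Hd x Hx), (prim_ext_all q (fun _ => 0) x Hq), prim_const; ring. }
    intros x Hx; rewrite (psi_ext p (fun _ => p 0)) by (intros; apply Hc; assumption).
    rewrite psi_const, (Hc x Hx); reflexivity. }
  apply C20_ext; intros x Hx; rewrite re_proj, im_proj; split.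
  - apply (E _ _ H1); auto using re_C20_zero.
  - apply (E _ _ H2); auto using im_C20_zero.
Qed.

(** y is minus the primitive of h = p - psi p, plus a constant. Its boundary condition is equivalent
    to psi h = 0, and the constant is fixed by psi y = 0. Since |h| <= 2m, the primitive and the
    constant are each at most 4m. *)
Lemma reduced_resolvent_real p m : cont p -> (forall x, I20 x -> Rabs (p x) <= m) ->
  exists y, cont y /\ dom_eq y (fun x => psi p - p x) /\ psi y = 0 /\
    forall x, I20 x -> Rabs (y x) <= 8 * m.
Proof.
  intros Hp Hm.
  assert (m0 : 0 <= m) by (apply Rle_trans with (2 := Hm 0 ltac:(unfold I20; lra)), Rabs_pos).
  set (h := fun x => 1 * p x + - psi p * (fun _ => 1) x).
  assert (Hh : cont h) by (apply cont_lin; auto using cont_const).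
  assert (HU := cont_prim h Hh).
  assert (Ph : psi h = 0).
  { unfold h; rewrite psi_lin, psi_const by (auto using cont_const); ring. }
  set (k := psi (prim h)).
  set (y := fun x => -1 * prim h x + k * (fun _ => 1) x).
  assert (Hpsi : Rabs (psi p) <= m) by (apply psi_abs_le; auto).
  assert (Bh : forall x, I20 x -> Rabs (prim h x) <= 4 * m).
  { intros x Hx; unfold I20 in Hx.
    assert (A : Rabs (prim h 0 - prim h x) <= (0 - x) * (2 * m)).
    { apply prim_abs_le; [exact Hh | lra |]; intros t Ht.
      assert (B := Hm t ltac:(unfold I20; lra)); unfold h.
      apply Rabs_le_between in B; apply Rabs_le_between in Hpsi; apply Rabs_le_between; lra. }
    rewrite prim_0, Rminus_0_l, Rabs_Ropp in A; eapply Rle_trans; [exact A |].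
    replace (4 * m) with (2 * (2 * m)) by ring; apply Rmult_le_compat_r; lra. }
  exists y; split; [apply cont_lin; auto using cont_const | split; [split | split]].
  - intros x _; unfold y; rewrite prim_0.
    rewrite (prim_ext_all (fun s => psi p - p s) (fun s => -1 * h s + 0 * h s))
      by (intros; unfold h; ring).
    rewrite prim_lin by exact Hh; ring.
  - unfold y; rewrite lag_lin, lag_const by (auto using cont_const).
    assert (E := avg_lag_prim h Hh).
    assert (E2 : h 0 + avg h 0 = 0) by (unfold psi in Ph; lra).
    unfold h at 1 in E2; lra.
  - unfold y; rewrite psi_lin, psi_const by (auto using cont_const); unfold k; ring.
  - intros x Hx; assert (B := Bh x Hx).
    assert (Bk : Rabs k <= 4 * m) by (apply psi_abs_le; auto).
    unfold y; apply Rabs_le_between in B; apply Rabs_le_between in Bk; apply Rabs_le_between; lra.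
Qed.

(** The conditions A f = P g - g and P f = 0 determine f: a solution for g = 0 lies in the kernel of
    A, is fixed by P, and so is 0. *)
Lemma reduced_resolvent_exists : exists S : C20 -> C20, is_linear S /\
  (forall f, opA (S f) (minus (proj f) f)) /\ forall f, proj (S f) = zero.
Proof.
  destruct (linear_rel_bounded_inverse (fun f g => opA f (minus (proj g) g) /\ proj f = zero))
    as [S [HS [H1 _]]].
  - split.
    + intros f g f' g' [H P1] [H' P2]; split.
      * refine (eq_ind _ (opA _) (proj1 opA_linear _ _ _ _ H H') _ _).
        rewrite (C20_linear_plus proj g g' proj_linear); vec.
      * rewrite (C20_linear_plus proj f f' proj_linear), P1, P2; vec.
    + intros c f g [H P1]; split.
      * refine (eq_ind _ (opA _) (proj2 opA_linear c _ _ H) _ _).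
        rewrite (C20_linear_scal proj c g proj_linear); vec.
      * rewrite (C20_linear_scal proj c f proj_linear), P1; vec.
  - intros f [H P1]; rewrite <- P1; symmetry; apply proj_fix.
    refine (eq_ind _ (opA f) H _ _).
    apply C20_ext; intros x _; rewrite re_C20_minus, im_C20_minus, re_proj, im_proj.
    rewrite !psi_eq_0 by (intros; apply re_C20_zero || apply im_C20_zero).
    rewrite re_C20_zero, im_C20_zero; split; ring.
  - exists 16; split; [lra |]; intros g.
    destruct (reduced_resolvent_real (re g) (C20_norm g) (cont_re g) (fun x Hx => norm_re g x Hx))
      as [y1 [C1 [D1 [P1 B1]]]].
    destruct (reduced_resolvent_real (im g) (C20_norm g) (cont_im g) (fun x Hx => norm_im g x Hx))
      as [y2 [C2 [D2 [P2 B2]]]].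
    exists (mkC y1 y2 C1 C2); split; [split |].
    + apply opA_iff; split.
      * apply (dom_eq_ext y1 (fun x => psi (re g) - re g x)); auto.
        -- intros; apply re_mkC; assumption.
        -- intros; rewrite re_C20_minus, re_proj; reflexivity.
      * apply (dom_eq_ext y2 (fun x => psi (im g) - im g x)); auto.
        -- intros; apply im_mkC; assumption.
        -- intros; rewrite im_C20_minus, im_proj; reflexivity.
    + apply C20_ext; intros x _; rewrite re_proj, im_proj, re_C20_zero, im_C20_zero; split.
      * rewrite (psi_ext _ y1) by (intros; apply re_mkC; assumption); exact P1.
      * rewrite (psi_ext _ y2) by (intros; apply im_mkC; assumption); exact P2.
    + replace (16 * C20_norm g) with (8 * C20_norm g + 8 * C20_norm g) by ring.
      apply norm_le_sum; intros x Hx.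
      * rewrite re_mkC by exact Hx; apply B1, Hx.
      * rewrite im_mkC by exact Hx; apply B2, Hx.
  - exists S; split; [exact HS | split; intros f; apply H1].
Qed.

Lemma opA_laurent : exists r a b, resolvent_laurent opA (RtoC 0) r a b /\
  (forall f, b O f = proj f) /\ forall k f, (0 < k)%nat -> b k f = zero.
Proof.
  destruct reduced_resolvent_exists as [S [HS [H1 H2]]].
  (* In the unit disc |Im z| < 1, so the second alternative in [opA_resolvent] also covers points
     with negative real part. *)
  assert (Hres : forall z : C, 0 < Cmod z < 1 -> resolvent_set opA z).
  { intros z [Hz1 Hz2]; apply opA_resolvent.
    - intros E; rewrite E, Cmod_0 in Hz1; lra.
    - right; eapply Rle_lt_trans; [| exact Hz2].
      eapply Rle_trans; [apply Rmax_r | apply Rmax_Cmod]. }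
  destruct (simple_pole_laurent opA proj S 1 opA_linear proj_linear HS proj_kernel proj_range
    proj_fix H1 H2 Rlt_0_1 Hres) as [r Hr].
  exists r, (pole_regular_coef S), (pole_singular_coef proj); split; [exact Hr | split].
  - reflexivity.
  - intros [| k] f Hk; [lia | reflexivity].
Qed.

(** * Spectral bound, positivity of the projection and behaviour of the flow *)

Definition one20 : C20 := mkC (fun _ => 1) (fun _ => 0) (cont_const 1) (cont_const 0).

Lemma proj_one : proj one20 = one20.
Proof.
  apply C20_ext; intros x _; rewrite re_proj, im_proj; split.
  - transitivity 1; [apply (psi_const 1) | reflexivity].
  - transitivity 0; [apply (psi_const 0) | reflexivity].
Qed.

Lemma one20_neq_0 : one20 <> zero.
Proof.
  intros E; apply (f_equal (fun f => re f 0)) in E; rewrite re_C20_zero in E.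
  change (1 = 0) in E; lra.
Qed.

(** The constant 1 lies in the kernel, so a resolvent at 0 would send 0 to 1. *)
Lemma spectrum_0 : spectrum opA (RtoC 0).
Proof.
  intros [R [HL [_ HR]]].
  assert (H : opA one20 zero) by (rewrite <- proj_one; apply proj_kernel).
  apply HR in H; apply one20_neq_0; rewrite <- H.
  assert (E : R (scal (RtoC 0) one20) = scal (RtoC 0) (R one20)) by apply (linear_scal R HL).
  transitivity (R (scal (RtoC 0) one20)).
  - f_equal; apply C20_eq; intros; simpl; ring.
  - rewrite E; vec.
Qed.

Lemma spectrum_Re lambda : spectrum opA lambda -> lambda = 0%C \/ Re lambda < 0.
Proof.
  intros H; destruct (classic (lambda = 0%C)) as [E | Hn]; [left; exact E | right].
  apply Rnot_le_lt; intros H0; apply H, opA_resolvent; auto.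
Qed.

Lemma opA_spectral_bound : spectral_bound opA = Finite 0.
Proof.
  apply is_lub_Rbar_unique; split.
  - intros x [lambda [Hl ->]]; simpl.
    destruct (spectrum_Re lambda Hl) as [-> | H]; [simpl; lra | lra].
  - intros b Hb; apply (Hb 0); exists (RtoC 0); split; [exact spectrum_0 | reflexivity].
Qed.

Lemma C20_pos_parts f : C20_pos f -> (forall x, I20 x -> im f x = 0) /\
  (forall x, I20 x -> 0 <= re f x) /\ exists x, I20 x /\ 0 < re f x.
Proof.
  intros [H Hn].
  assert (Hi : forall x, I20 x -> im f x = 0) by (intros x Hx; symmetry; exact (proj1 (H x Hx))).
  assert (Hr : forall x, I20 x -> 0 <= re f x) by (intros x Hx; exact (proj2 (H x Hx))).
  split; [exact Hi | split; [exact Hr |]].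
  apply NNPP; intros HN; apply Hn, C20_ext; intros x Hx.
  rewrite re_C20_zero, im_C20_zero; split; [| apply Hi, Hx].
  apply Rle_antisym; [| apply Hr, Hx].
  apply Rnot_lt_le; intros Hlt; apply HN; exists x; auto.
Qed.

Lemma psi_C20_pos f : C20_pos f -> 0 < psi (re f).
Proof.
  intros H; destruct (C20_pos_parts f H) as [_ [Hr [x [Hx Hpx]]]].
  apply (psi_pos _ x); auto.
Qed.

Lemma proj_strongly_positive : strongly_positive proj.
Proof.
  intros f Hf; exists (psi (re f)); split; [apply psi_C20_pos, Hf |]; intros x Hx.
  destruct (C20_pos_parts f Hf) as [Hi _]; split.
  - change (0 = im (proj f) x); rewrite im_proj; symmetry; apply psi_eq_0, Hi.
  - change (psi (re f) <= re (proj f) x); rewrite re_proj; apply Rle_refl.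
Qed.

Lemma flow_eventually_strongly_positive : indiv_eventually_strongly_positive flow.
Proof.
  intros f Hf; assert (Hpsi := psi_C20_pos f Hf).
  destruct (C20_pos_parts f Hf) as [Hi _].
  set (u := delay_flow (re f) (cont_re f)).
  assert (Hu : psi u = psi (re f)) by (apply psi_ext; intros t Ht; apply delay_flow_init; lra).
  destruct (sol_limit u (psi u / 2)) as [t0 [H0 Ht0]]; [apply delay_flow_sol | lra |].
  (* The segment at time t reads the solution back to t - 2, which must be past t0. *)
  exists (t0 + 2); split; [lra |]; intros t Ht.
  exists (psi u / 2); split; [lra |]; intros x Hx; unfold I20 in Hx; split.
  - change (0 = im (flow t f) x); rewrite im_flow by exact Hx; symmetry.
    apply (delay_flow_unique _ _ (fun _ => 0)); [apply is_sol_const | intros; symmetry; auto | lra].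
  - change (psi u / 2 <= re (flow t f) x); rewrite re_flow by exact Hx; fold u.
    specialize (Ht0 (x + t) ltac:(lra)); apply Rabs_def2 in Ht0; lra.
Qed.

(* f(x) = -x (x+2)^2 vanishes at 0 and puts more mass on [-1,0] than on [-2,-1],
   so the solution starts out of 0 with negative slope. *)
Lemma flow_not_positive : ~ positive_semigroup flow.
Proof.
  intros H.
  set (p := fun x : R => - x * ((x + 2) * (x + 2))).
  set (P := fun x : R => - (x ^ 4 / 4 + 4 * x ^ 3 / 3 + 2 * x ^ 2)).
  assert (Hp : cont p).
  { apply (cont_derive _ (fun x => - ((x + 2) * (x + 2)) - x * (2 * (x + 2)))).
    intros x; unfold p; auto_derive; auto; ring. }
  assert (HP : forall x, prim p x = P x).
  { intros x; unfold prim; rewrite (RInt_ftc P p 0 x); [unfold P; field | | exact Hp].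
    intros t; unfold P, p; auto_derive; auto; field. }
  assert (Hlag : lag p 0 = - 1 / 2).
  { unfold lag; rewrite !HP; unfold P; field. }
  set (f := mkC p (fun _ => 0) Hp (cont_const 0)).
  assert (Hf : C20_nonneg f).
  { intros x Hx; split.
    - change (0 = im f x); unfold f; rewrite im_mkC; auto.
    - change (0 <= re f x); unfold f; rewrite re_mkC by exact Hx; unfold p, I20 in *.
      apply Rmult_le_pos; [lra | apply Rle_0_sqr]. }
  set (u := delay_flow (re f) (cont_re f)).
  destruct (delay_flow_sol (re f) (cont_re f)) as [Hu Su]; fold u in Hu, Su.
  assert (Hup : forall x, I20 x -> u x = p x).
  { intros x Hx; unfold u; rewrite delay_flow_init by apply Hx; apply re_mkC, Hx. }
  (* The slope at 0 is -1/2; an error of a quarter still leaves u h <= - h / 4 for small h. *)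
  destruct (prim_near (lag u) 0 (1 / 4) (cont_lag u Hu)) as [d [Hd Hd']]; [lra |].
  set (h := d / 2); assert (Hh : 0 < h < d) by (unfold h; lra).
  specialize (Hd' h); rewrite !Rminus_0_r, Rabs_pos_eq, prim_0, Rminus_0_r in Hd' by lra.
  specialize (Hd' (proj2 Hh)); rewrite (lag_ext u p Hup), Hlag in Hd'.
  apply Rabs_le_between in Hd'.
  assert (I0 : I20 0) by (unfold I20; lra).
  assert (A := proj2 (H h f ltac:(lra) Hf 0 I0)).
  change (0 <= re (flow h f) 0) in A; rewrite re_flow, Rplus_0_l in A by exact I0; fold u in A.
  rewrite (Su h), (Hup 0 I0) in A by lra; unfold p in A; lra.
Qed.

Theorem proposition6p8 :
  (exists T : R -> C20 -> C20, C0_semigroup T /\ is_generator opA T) /\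
  (* (i) *)
  (spectral_bound opA = Finite 0 /\
   dominant_spectral_value opA 0 /\
   pole_of_resolvent opA (RtoC 0)) /\
  (* (ii) *)
  ((exists P : C20 -> C20, is_spectral_projection opA (RtoC 0) P) /\
   (forall P : C20 -> C20,
      is_spectral_projection opA (RtoC 0) P -> strongly_positive P)) /\
  (* (iii), (iv) *)
  (forall T : R -> C20 -> C20,
     C0_semigroup T -> is_generator opA T ->
     indiv_eventually_strongly_positive T /\ ~ positive_semigroup T).
Proof.
  destruct opA_laurent as [r [a [b [Hlaurent [Hb0 Hb]]]]].
  split; [| split; [split; [| split] | split; [split |]]].
  - exists flow; split; [exact flow_C0 | exact flow_generator].
  - exact opA_spectral_bound.
  - split; [exact opA_spectral_bound | split; [exact spectrum_0 |]].
    intros lambda Hl H0; destruct (spectrum_Re lambda Hl) as [E | Hneg]; [exact E | lra].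
  - exists r, a, b; split; [exact Hlaurent |].
    exists O; split; [| exact (fun k f => Hb k f)].
    exists one20; rewrite Hb0, proj_one; exact one20_neq_0.
  - exists proj; split; [exact spectrum_0 |].
    exists r, a, b; split; [exact Hlaurent | intros f; symmetry; apply Hb0].
  (* P may come from a different expansion; uniqueness of the residue identifies it with [proj]. *)
  - intros P [_ [r' [a' [b' [Hlaurent' HP]]]]] f Hf.
    rewrite HP, <- (laurent_residue_unique opA (RtoC 0) r a b r' a' b' f Hlaurent Hlaurent'), Hb0.
    apply proj_strongly_positive, Hf.
  - intros T HT GT.
    assert (E : forall t f, 0 <= t -> T t f = flow t f)
      by (intros; apply flow_unique; assumption).
    split.
    + intros f Hf; destruct (flow_eventually_strongly_positive f Hf) as [t0 [H0 Ht0]].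
      exists t0; split; [exact H0 |]; intros t Ht; rewrite E by lra; apply Ht0, Ht.
    + intros H; apply flow_not_positive; intros t f Ht Hf.
      rewrite <- E by exact Ht; apply H; assumption.
Qed.
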